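(* Let $s\in[-1,1]$ with $s\notin\{-\frac12,0\}$, $k\ge2$, $x_0:=\frac1k\in(0,1)$, and let $\chi\in C^\infty([0,1],\mathbb R)$ be such that $\chi=1$ in a neighborhood of $x_0$ and $\chi=0$ in a neighborhood of $1$. For $x\in[0,1]$, set $$\mathcal M(x):=\begin{cases}0&\text{if }x\in[0,x_0],\\(x-x_0)^{s-\frac12}\chi(x)&\text{if }x\in(x_0,1].\end{cases}$$ If $s>-\frac12$, then $\mathcal M\in L^1(0,1)$, and one naturally defines $\langle\mathcal M,\varphi_n\rangle:=\int_0^1\mathcal M\varphi_n\,dx$. If $s<-\frac12$, one defines $\langle\mathcal M,\varphi\rangle$ for $\varphi\in C^\infty([0,1],\mathbb R)$ by setting $$\langle\mathcal M,\varphi\rangle:=\lim_{\varepsilon\to0^+}\left(\int_{x_0+\varepsilon}^1(x-x_0)^{s-\frac12}\chi(x)\varphi(x)\,dx+\frac{\varphi(x_0)\varepsilon^{s+\frac12}}{s+\frac12}\right).$$ Then $\mathcal M\in\mathcal H^{s+\frac12}_\infty(0,1)$. There exists $\psi\in C^\infty_{\mathrm c}((0,1),\mathbb R)$ such that, setting $\mu:=\mathcal M+\psi$, one has $\langle\mu,\varphi_k\rangle=0$ if $s<0$, and one has $\langle\mu,\varphi_k\rangle=\langle\mu^2,\varphi_k'\rangle=0$ if $s>0$. Then $$K_{\mu,k}(\omega)=\frac{\alpha_s}{\omega^{2+s}}+\mathcal O\left(\frac1{\omega^{2+s+\nu}}\right)\quad\text{when }\omega\to+\infty,$$ for some $\alpha_s\ne0$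 and some $\nu>0$.
   Context: All functions are real-valued. $A=-\frac{d^2}{dx^2}$ is the Dirichlet Laplacian on $(0,1)$, with domain $D(A)=H^2\cap H^1_0(0,1)\subset L^2(0,1)$; its eigenvalues are $\lambda_j=(j\pi)^2$, $j\ge1$, with $L^2(0,1)$-orthonormal eigenfunctions $\varphi_j(x)=\sqrt2\sin(j\pi x)$. $\langle\cdot,\cdot\rangle$ denotes the $L^2(0,1)$ scalar product (and its extension to distributions as specified in the claim). Set $D(A^\infty)=\bigcap_{n\ge0}D(A^{n/2})$. For $s\in\mathbb R$ and $p\in[1,+\infty]$, $\mathcal H^s_p(0,1)$ is defined as the closure of $D(A^\infty)$ for the norm $\|\mu\|_{\mathcal H^s_p}:=\big\|(\lambda_j^{s/2}\langle\mu,\varphi_j\rangle)_{j\ge1}\big\|_{\ell^p(\mathbb N^* )}$. With $\lambda_{n,k}:=\lambda_n-\frac{\lambda_k}2$, the quadratic kernel is defined for $\omega\in\mathbb R$ by $$K_{\mu,k}(\omega)=\sum_{n\ge1}\frac{\langle\mu,\varphi_n\rangle}{n}\left(\frac{\langle\mu,\varphi_{n+k}\rangle}{n+k}+\frac{\langle\mu,\varphi_{|n-k|}\rangle}{|n-k|}\mathbb 1_{n\ne k}\right)\frac{\lambda_{n,k}}{\lambda_{n,k}^2+\omega^2}.$$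
   Formalization: The space H^{s+1/2}_∞ is taken as the weak-* closure of D(A^∞) (finite norm and a norm-bounded coefficientwise limit) instead of the norm closure, since weighted coefficients of M oscillate without tending to 0, so M is never in the norm closure. *)

(* Defs.v *)
From HB Require Import structures.
From mathcomp Require Import all_boot all_order all_algebra.
From mathcomp Require Import all_classical all_reals all_analysis.

Set Implicit Arguments.
Unset Strict Implicit.
Unset Printing Implicit Defensive.

Import Order.TTheory GRing.Theory Num.Theory.
Import numFieldNormedType.Exports.

Local Open Scope classical_set_scope.
Local Open Scope ring_scope.

Section Definitions.
Context {R : realType}.
Implicit Types (f g chi psi phi : R -> R) (s t x w : R) (j k n : nat).

Definition smooth_on (D : set R) f : Prop :=
  forall n x, D x -> derivable (derive1n n f) x 1.

(* C^oo([0,1]): smooth inside, with all derivatives extending continuously to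
   the end points.  Values outside [0,1] are irrelevant. *)
Definition smooth01 f : Prop :=
  [/\ smooth_on `]0, 1[ f, {within `[0, 1], continuous f} &
      forall n, cvg (derive1n n f x @[x --> 0^'+]) /\
                cvg (derive1n n f x @[x --> 1^'-])].

(* C^oo_c((0,1)), extended by 0 to the real line *)
Definition test_function01 psi : Prop :=
  [/\ smooth_on setT psi, compact (closure [set x | psi x != 0]) &
      closure [set x | psi x != 0] `<=` `]0, 1[].

(* eigenpairs of the Dirichlet Laplacian, indexed by j >= 1 *)
Definition eigval j : R := (j%:R * pi) ^+ 2.
Definition eigfun j : R -> R := fun x => Num.sqrt 2 * sin (j%:R * pi * x).

Definition pairing f g : R :=
  (\int[lebesgue_measure]_(x in `]0%R, 1%R[) (f x * g x))%R.

(* A distribution is represented by its action on smooth functions. *)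
Definition distr := (R -> R) -> R.
Definition distr_of f : distr := pairing f.

(* D(A^(n/2)), by the spectral definition of the powers of A *)
Definition dom_half_power n f : Prop :=
  [/\ measurable_fun (`]0, 1[ : set R) f,
      lebesgue_measure.-integrable `]0%R, 1%R[ (fun x => (f x ^+ 2)%:E) &
      (\sum_(1 <= j <oo) (eigval j ^+ n * pairing f (eigfun j) ^+ 2)%:E
         < +oo)%E].

Definition dom_infty f : Prop := forall n, dom_half_power n f.

Definition normH_infty t (mu : distr) : \bar R :=
  ereal_sup [set (`|eigval j `^ (t / 2) * mu (eigfun j)|)%:E
            | j in [set j | (1 <= j)%N]].

(* The weighted l^oo space with norm normH_infty, generated by D(A^oo).  For
   p = oo the closure of D(A^oo) is taken in the weak-* topology
   of l^oo = (l^1)': since l^1 is separable, sequential weak-* convergence is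
   boundedness in norm together with convergence of each coefficient.  (The
   closure in norm is the smaller space, with weighted coefficients tending to
   0, to which a distribution such as dsing below does not belong.) *)
Definition in_H_infty t (mu : distr) : Prop :=
  (normH_infty t mu < +oo)%E /\
  exists u : nat -> R -> R,
    [/\ forall m, dom_infty (u m),
        exists B : R, forall m, (normH_infty t (distr_of (u m)) <= B%:E)%E &
        forall j, (1 <= j)%N ->
          pairing (u m) (eigfun j) @[m --> \oo] --> mu (eigfun j)].

Section Singular.
Variables (s : R) (k : nat) (chi : R -> R).

Let x0 : R := k%:R^-1.

Definition fsing x : R :=
  if x <= x0 then 0 else (x - x0) `^ (s - 2^-1) * chi x.

(* the expression whose limit at 0^'+ is the Hadamard finite part *)
Definition fp_approx phi (eps : R) : R :=
  (\int[lebesgue_measure]_(x in `[(x0 + eps)%R, 1%R])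
      ((x - x0) `^ (s - 2^-1) * chi x * phi x))%R
  + phi x0 * eps `^ (s + 2^-1) / (s + 2^-1).

Definition dsing : distr := fun phi =>
  if - 2^-1 < s then pairing fsing phi
  else lim (fp_approx phi eps @[eps --> 0^'+]).

Definition dsing_plus psi : distr := fun phi => dsing phi + pairing psi phi.

Definition orthogonality psi : Prop :=
  (s < 0 -> dsing_plus psi (eigfun k) = 0) /\
  (0 < s -> dsing_plus psi (eigfun k) = 0 /\
            pairing (fun x => (fsing x + psi x) ^+ 2) (derive1 (eigfun k)) = 0).

End Singular.

Definition eigval_shift n k : R := eigval n - eigval k / 2.

Definition quad_kernel_term (mu : distr) k w n : R :=
  let a i := mu (eigfun i) / i%:R in
  a n * (a (n + k)%N + (if n != k then a `|n%:Z - k%:Z|%N else 0))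
      * (eigval_shift n k / (eigval_shift n k ^+ 2 + w ^+ 2)).

Definition quad_kernel (mu : distr) k w : R :=
  limn (fun N => \sum_(1 <= n < N) quad_kernel_term mu k w n).

End Definitions.

(* Main.v *)
Require Import Defs.
From HB Require Import structures.
From mathcomp Require Import all_boot all_order all_algebra.
From mathcomp Require Import all_classical all_reals all_analysis.
From mathcomp Require Import measurable_realfun.
From mathcomp Require Import ring lra.
Set Implicit Arguments.
Unset Strict Implicit.
Unset Printing Implicit Defensive.
Import Order.TTheory GRing.Theory Num.Theory.
Import numFieldNormedType.Exports.
Local Open Scope classical_set_scope.
Local Open Scope ring_scope.

(** Put p = s - 1/2 and x0 = 1/k.  The distribution is smooth away from x0, where
    it is (x - x0)^p, so its n-th sine coefficient is
    n^-(p+1) (A sin (n pi / k) + B cos (n pi / k)) up to O(n^(-(p+1)-d)) for some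
    d > 0, with A and B determined by s and not both zero.  Integrations by parts
    express A and B by boundary terms and by the integral of t^q (1 - cos t) over
    the half line, -3 < q < -1, which is positive; in the finite part of an exponent below -1 this integral is what
    is left after subtracting the constant 1 from the cosine
    (coef_asymptotics, fp_limit, dsing_asymptotics).  The bound on the
    coefficients gives the membership in the weighted space, the sine sums of
    the distribution being the approximating sequence.

    Since x0 = 1/k, the factor A sin + B cos changes sign when n becomes n + k
    or n - k.  With a_n = <mu, phi_n>/n and q = s + 3/2 the product
    a_n (a_(n+k) + a_|n-k|) is therefore close to
    - 2 n^-2q (A sin + B cos)^2.  No cancellation occurs: the square has mean
    (A^2 + B^2)/2, and its deviation from the mean telescopes
    (product_asymptotics, osc_sqr).

    Let h = pi / sqrt w, so that lambda_{n,k} / w is (h n)^2 up to O(h^2).  The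
    kernel is, up to a power of h, a Riemann sum of step h for the integral of
    y^(2-2q) / (1 + y^4) over the half line (profile_sum, mode_sum).  The
    integral converges at 0 for s < 0.  For s > 0 one writes
    z/(1 + z^2) = z - z^3/(1 + z^2): the second part leads to
    y^(6-2q) / (1 + y^4), which is integrable, and the first part to
    the sum of a_n (a_(n+k) + a_|n-k|) lambda_{n,k}.  By Parseval's identity
    that sum is a multiple of the integral of mu^2 cos (k pi x), which is the
    second orthogonality condition (pair_coef_level_cvg0, kernel_asymptotics).
    In both cases the constant is a nonzero multiple of A^2 + B^2.

    Parseval's identity is needed for functions vanishing near 0 and 1 and
    continuous off one point.  After truncation and division by sin (pi x), such
    a function is approximated by its Bernstein polynomials in
    (1 - cos (pi x))/2, and sin (pi x) times a polynomial in cos (pi x) is a sine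
    sum (L2_approx).

    The function psi is a combination of bumps supported in (0, 1/k), where the
    singular part vanishes, so that the two conditions become one linear and one
    quadratic equation in psi alone.  There phi_k is positive while phi_k'
    changes sign at 1/(2k): one bump settles the linear equation, and a pair of
    bumps on the appropriate side, combined so as to be orthogonal to phi_k,
    settles the quadratic one (exists_test_quadratic). *)

(** * Integrals with a power singularity *)
Section Calculus.
Context {R : realType}.
Implicit Types (f g F : R -> R) (a b c x y r C : R).
Notation mu := (@lebesgue_measure R).

Lemma is_derive_continuous f x c : is_derive x 1 f c -> {for x, continuous f}.
Proof.
by move=> df; apply/differentiable_continuous/derivable1_diffP; exact: ex_derive.
Qed.

Lemma continuous_in_within f a b :
  (forall x, a <= x <= b -> {for x, continuous f}) ->
  {within `[a, b], continuous f}.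
Proof.
move=> cf; apply: continuous_in_subspaceT => x; rewrite inE/= in_itv/=; exact: cf.
Qed.

Lemma continuous_itv_integrable f a b :
  (forall x, a <= x <= b -> {for x, continuous f}) ->
  mu.-integrable `[a, b] (EFin \o f).
Proof.
move=> cf; apply: continuous_compact_integrable; first exact: segment_compact.
exact: continuous_in_within.
Qed.

(** The fundamental theorem of calculus for a function known to be differentiable
    up to the ends, the form in which explicit primitives are used below. *)
Lemma FTC_closed F f a b : a <= b ->
  (forall x, a <= x <= b -> is_derive x 1 F (f x)) ->
  (forall x, a <= x <= b -> {for x, continuous f}) ->
  (\int[mu]_(x in `[a, b]) f x)%R = F b - F a.
Proof.
rewrite le_eqVlt => /predU1P[-> _ _|ab dF cf].
  by rewrite set_itv1 Rintegral_set1 subrr.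
have cF x : a <= x <= b -> {for x, continuous F}.
  by move=> /dF; exact: is_derive_continuous.
rewrite /Rintegral (@continuous_FTC2 _ f F)//.
- exact: continuous_in_within.
- have /continuous_within_itvP : {within `[a, b], continuous F}.
    exact: continuous_in_within.
  move=> /(_ ab)[_ Fa Fb]; split => // x; rewrite in_itv/= => /andP[ax xb].
  by have := dF x; rewrite !ltW// => /(_ isT) /@ex_derive.
- move=> x; rewrite in_itv/= => /andP[ax xb].
  by rewrite derive1E; apply: derive_val; apply: dF; rewrite !ltW.
Qed.

Lemma eqW x y : x = y -> x <= y. Proof. by move=> ->. Qed.

Lemma le0_ler_powR r x y : r <= 0 -> 0 < x -> x <= y -> y `^ r <= x `^ r.
Proof.
move=> r0 x0 xy; have y0 := lt_le_trans x0 xy.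
rewrite -(opprK r) !(powRN _ (- r)) lef_pV2 ?posrE ?powR_gt0//.
by apply: ge0_ler_powR; rewrite ?nnegrE ?oppr_ge0//; exact: ltW.
Qed.

(** A power is monotone, increasing or decreasing; adding both ends bounds it
    on an interval without a discussion of the sign of the exponent. *)
Lemma powR_le_ends r x y z : 0 < x -> x <= y -> y <= z ->
  y `^ r <= x `^ r + z `^ r.
Proof.
move=> x0 xy yz; have y0 := lt_le_trans x0 xy; have z0 := lt_le_trans y0 yz.
have [r0|r0] := leP 0 r.
  rewrite (@le_trans _ _ (z `^ r))// ?lerDr ?powR_ge0//.
  by apply: ge0_ler_powR; rewrite ?nnegrE//; exact: ltW.
rewrite (@le_trans _ _ (x `^ r))// ?lerDl ?powR_ge0//.
by apply: le0_ler_powR => //; exact: ltW.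
Qed.

Lemma powR_split (N u v w : R) : 0 < N -> w = u + v -> N `^ w = N `^ u * N `^ v.
Proof. by move=> N0 ->; rewrite powRD// (gt_eqF N0) implybT. Qed.

Lemma near_open_itv (u v x : R) : u < x < v -> \forall y \near x, u < y < v.
Proof.
move=> hx; have : \forall y \near x, y \in `]u, v[ by apply: near_in_itvoo; rewrite in_itv.
by apply: filterS => y; rewrite in_itv.
Qed.

Lemma is_derive_powR_shift a r x : a < x ->
  is_derive x 1 (fun x => (x - a) `^ r) (r * (x - a) `^ (r - 1)).
Proof.
move=> ax; have xa : 0 < x - a by rewrite subr_gt0.
have h := is_derive1_powR r xa.
have d : is_derive x 1 (fun x => x - a) 1.
  by apply: is_derive_eq; rewrite subr0.
have := @is_derive1_comp _ (fun y => y `^ r) (fun x => x - a) _ _ _ h d.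
by rewrite mulr1.
Qed.

Lemma powR_shift_continuous a r x : a < x ->
  {for x, continuous (fun x => (x - a) `^ r)}.
Proof. by move=> /(is_derive_powR_shift r)/is_derive_continuous. Qed.

Lemma measurable_powR_shift a r (D : set R) : measurable D ->
  measurable_fun D (fun x => (x - a) `^ r).
Proof.
move=> mD; apply: (measurable_funTS).
apply: (@measurableT_comp _ _ _ _ _ _ (@powR R ^~ r)); first exact: measurable_powR.
by apply: measurable_funB.
Qed.

Lemma bigcup_itv_obnd a b : a < b ->
  \bigcup_n `[a + (b - a) / n.+1%:R, b]%classic = `]a, b]%classic.
Proof.
move=> ab; have ba : 0 < b - a by rewrite subr_gt0.
apply/seteqP; split => x /=.
  move=> [n _] /=; rewrite !in_itv/= => /andP[h ->]; rewrite andbT.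
  by rewrite (lt_le_trans _ h)// ltrDl divr_gt0.
rewrite in_itv/= => /andP[ax xb].
exists (Num.truncn ((b - a) / (x - a))) => //=; rewrite in_itv/= xb andbT.
rewrite -lerBrDl ler_pdivrMr// -ler_pdivrMl ?subr_gt0//.
by rewrite mulrC ltW// truncnS_gt.
Qed.

(** The intervals [a + (b - a)/(n + 1), b] increase to ]a, b], and on each of them
    the power has a primitive. *)
Lemma integral_powR_le a b r : -1 < r -> a <= b ->
  (\int[mu]_(x in `]a, b]) ((x - a) `^ r)%:E <=
   ((b - a) `^ (r + 1) / (r + 1))%:E)%E.
Proof.
move=> r1; have r0 : 0 < r + 1 by rewrite -ltrBlDr sub0r.
rewrite le_eqVlt => /predU1P[->|ab].
  rewrite set_itv_ge ?bnd_simp ?ltxx// integral_set0 lee_fin.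
  by rewrite divr_ge0 ?powR_ge0 ?ltW.
have ba : 0 < b - a by rewrite subr_gt0.
rewrite -(bigcup_itv_obnd ab).
have nd : {homo (fun n => `[(a + (b - a) / n.+1%:R)%R, b]%classic) :
    n m / (n <= m)%N >-> (n <= m)%O}.
  move=> n m nm; apply/subsetPset => x /=; rewrite !in_itv/= => /andP[h ->].
  rewrite andbT (le_trans _ h)// lerD2l ler_pM2l// lef_pV2 ?posrE//.
  by rewrite ler_nat.
have mF i : measurable `[(a + (b - a) / i.+1%:R)%R, b]%classic by [].
have /cvg_lim <-// : (\int[mu]_(x in `[(a + (b - a) / n.+1%:R)%R, b]) ((x - a) `^ r)%:E)%E @[n --> \oo]
   --> (\int[mu]_(x in \bigcup_n `[(a + (b - a) / n.+1%:R)%R, b]%classic) ((x - a) `^ r)%:E)%E.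
  apply: ge0_nondecreasing_set_cvg_integral => //.
    by move=> i; apply/measurable_EFinP; exact: measurable_powR_shift.
  by move=> i x _; rewrite lee_fin powR_ge0.
apply: lime_le; first by apply: ereal_nondecreasing_is_cvgn => n m nm;
  apply: ge0_subset_integral => //;
    [by apply/measurable_EFinP; exact: measurable_powR_shift
    |by move=> x _; rewrite lee_fin powR_ge0 | exact/subsetPset/nd].
apply: nearW => n; set e := a + _.
have ae : a < e by rewrite ltrDl divr_gt0.
have eb : e <= b.
  by rewrite -lerBrDl ler_pdivrMr// ler_peMr ?(ltW ba)// ler1n.
have cf x : e <= x <= b -> {for x, continuous (fun x => (x - a) `^ r)}.
  by move=> /andP[ex xb]; apply: powR_shift_continuous; exact: lt_le_trans ex.
have fi := @integrable_fin_num _ _ _ _ _ _ _ (continuous_itv_integrable cf).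
rewrite -(fineK (fi _))//= lee_fin.
have -> : fine (\int[mu]_(x in `[e, b]) ((x - a) `^ r)%:E)
   = (\int[mu]_(x in `[e, b]) ((x - a) `^ r))%R by [].
have dF x : e <= x <= b ->
    is_derive x 1 (fun x => (x - a) `^ (r + 1) / (r + 1)) ((x - a) `^ r).
  move=> /andP[ex xb].
  have d := is_derive_powR_shift (r + 1) (lt_le_trans ae ex).
  have -> : (fun x => (x - a) `^ (r + 1) / (r + 1)) =
      (r + 1)^-1 \*: (fun x => (x - a) `^ (r + 1)).
    by apply/funext => y; rewrite /= mulrC.
  apply: is_derive_eq; rewrite -[_ *: _]/(_ * _) mulKf ?gt_eqF//.
  by rewrite addrK.
rewrite (FTC_closed eb dF cf).
by rewrite lerBlDr lerDl divr_ge0 ?powR_ge0 ?ltW.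
Qed.

(** Continuity plus a bound by an integrable power of x - a: the class in which all
    the integrands below live.  At b it amounts to boundedness. *)
Definition sing a b f := (forall x, a < x < b -> {for x, continuous f}) /\
  exists2 C : R, 0 <= C & exists2 r : R, -1 < r &
    forall x, a < x < b -> `|f x| <= C * (x - a) `^ r.

Lemma powR_shift_le a b r r' x : a < x < b -> r <= r' ->
  (x - a) `^ r' <= (b - a) `^ (r' - r) * (x - a) `^ r.
Proof.
move=> /andP[ax xb] rr.
have xa : 0 < x - a by rewrite subr_gt0.
rewrite (@powR_split _ (r' - r) r)// ?subrK// ler_pM2r ?powR_gt0//.
apply: ge0_ler_powR; rewrite ?nnegrE ?subr_ge0 ?lerD2r//.
- exact: ltW.
- exact: ltW (lt_trans ax xb).
- exact: ltW.
Qed.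

Lemma singW a b f C r : 0 <= C -> -1 < r ->
  (forall x, a < x < b -> {for x, continuous f}) ->
  (forall x, a < x < b -> `|f x| <= C * (x - a) `^ r) -> sing a b f.
Proof. by move=> C0 r1 cf fC; split => //; exists C => //; exists r. Qed.

Lemma sing_eq a b f g : (forall x, a < x < b -> f x = g x) -> sing a b f ->
  sing a b g.
Proof.
move=> fg [cf [C C0 [r r1 fC]]]; split; last first.
  by exists C => //; exists r => // x xab; rewrite -fg// fC.
move=> x xab; have := cf _ xab; rewrite /prop_for /continuous_at (fg _ xab).
apply: cvg_trans; apply: near_eq_cvg.
by apply: filterS (near_open_itv xab) => z /fg.
Qed.

Lemma singD a b f g : sing a b f -> sing a b g -> sing a b (fun x => f x + g x).
Proof.
move=> [cf [C C0 [r r1 fC]]] [cg [D D0 [s s1 gD]]].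
wlog rs : f g C D r s cf cg C0 D0 r1 s1 fC gD / r <= s.
  move=> H; have [rs|/ltW sr] := leP r s; first exact: (H f g C D r s).
  by apply: (sing_eq _ (H g f D C s r _ _ _ _ _ _ _ _ _)) => // x _; rewrite addrC.
apply: (@singW _ _ _ (C + D * (b - a) `^ (s - r)) r) => //.
- by rewrite addr_ge0// mulr_ge0// powR_ge0.
- by move=> x xab; apply: cvgD; [exact: cf|exact: cg].
move=> x xab; apply: (le_trans (ler_normD _ _)); rewrite mulrDl lerD ?fC//.
by apply: (le_trans (gD _ xab)); rewrite -mulrA ler_wpM2l// powR_shift_le.
Qed.

Lemma singMr a b f g M : 0 <= M -> sing a b f ->
  (forall x, a < x < b -> {for x, continuous g}) ->
  (forall x, a < x < b -> `|g x| <= M) -> sing a b (fun x => f x * g x).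
Proof.
move=> M0 [cf [C C0 [r r1 fC]]] cg gM.
apply: (@singW _ _ _ (C * M) r) => //; first exact: mulr_ge0.
  by move=> x xab; apply: cvgM; [exact: cf|exact: cg].
move=> x xab; rewrite normrM mulrAC ler_pM//; [exact: fC|exact: gM].
Qed.

Lemma singZ a b f c : sing a b f -> sing a b (fun x => c * f x).
Proof.
move=> sf; apply: (@sing_eq _ _ (fun x => f x * (cst c) x)).
  by move=> x _; rewrite mulrC.
apply: (@singMr _ _ _ _ `|c|) => // x _; exact: cst_continuous.
Qed.

Lemma sing_measurable a b f : (forall x, a < x < b -> {for x, continuous f}) ->
  measurable_fun `]a, b[ f.
Proof.
move=> cf; apply: open_continuous_measurable_fun; first exact: interval_open.
by move=> x; rewrite inE/= in_itv/= => /cf.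
Qed.

Lemma powR_shift_integrable a b r : -1 < r ->
  mu.-integrable `]a, b[ (fun x => ((x - a) `^ r)%:E).
Proof.
move=> r1; apply/integrableP; split.
  by apply/measurable_EFinP; exact: measurable_powR_shift.
have [ab|ba] := leP a b; last first.
  by rewrite set_itv_ge ?integral_set0// bnd_simp -leNgt ltW.
under eq_integral do rewrite /= ger0_norm ?powR_ge0//.
apply: (le_lt_trans _ (ltry ((b - a) `^ (r + 1) / (r + 1)))).
apply: le_trans (integral_powR_le r1 ab).
apply: ge0_subset_integral => //; last exact: subset_itv_oo_oc.
  by apply/measurable_EFinP; exact: measurable_powR_shift.
by move=> x _; rewrite lee_fin powR_ge0.
Qed.

Lemma sing_integrable a b f : sing a b f -> mu.-integrable `]a, b[ (EFin \o f).
Proof.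
move=> [cf [C C0 [r r1 fC]]].
apply: (le_integrable _ _ _ (integrableZl _ C (powR_shift_integrable a b r1))) => //.
- by apply/measurable_EFinP; exact: sing_measurable.
- move=> x; rewrite /= in_itv/= => xab; rewrite lee_fin.
  by rewrite (ger0_norm (mulr_ge0 _ (powR_ge0 _ _)))// fC.
Qed.

Lemma Rintegral_norm_le_powR a b f C r : -1 < r -> a <= b -> 0 <= C ->
  mu.-integrable `]a, b[ (EFin \o f) ->
  (forall x, a < x < b -> `|f x| <= C * (x - a) `^ r) ->
  `|(\int[mu]_(x in `]a, b[) f x)%R| <= C * ((b - a) `^ (r + 1) / (r + 1)).
Proof.
move=> r1 ab C0 fi fC.
have pi := powR_shift_integrable a b r1.
apply: (le_trans (le_normr_Rintegral _ fi)) => //.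
apply: (@le_trans _ _ (\int[mu]_(x in `]a, b[) (C * (x - a) `^ r))).
  apply: le_Rintegral => //; first exact: integrable_norm.
    under [X in _.-integrable _ X]eq_fun do rewrite /= EFinM.
    by apply: integrableZl.
rewrite RintegralZl// ler_wpM2l// -lee_fin /Rintegral fineK; last exact: integrable_fin_num.
apply: le_trans (integral_powR_le r1 ab).
apply: ge0_subset_integral => //; last exact: subset_itv_oo_oc.
  by apply/measurable_EFinP; exact: measurable_powR_shift.
by move=> x _; rewrite lee_fin powR_ge0.
Qed.


Lemma powR_shift_cvg0 a r : 0 < r -> (x - a) `^ r @[x --> a^'+] --> 0.
Proof.
move=> r0; apply/cvgrPdist_le => e e0; near=> x.
rewrite sub0r normrN ger0_norm ?powR_ge0//.
have -> : e = (e `^ r^-1) `^ r by rewrite -powRrM mulVf ?gt_eqF// powRr1// ltW.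
apply: ge0_ler_powR; rewrite ?nnegrE ?powR_ge0 ?subr_ge0 ?(ltW r0)//.
near: x; apply: filterS (nbhs_right_ltDr a (powR_gt0 r^-1 e0)) => x; exact: ltW.
Unshelve. all: by end_near. Qed.

Lemma cvg0_at_right f a b C r : a < b -> 0 < r ->
  (forall x, a < x < b -> `|f x| <= C * (x - a) `^ r) ->
  f x @[x --> a^'+] --> 0.
Proof.
move=> ab r0 fC; apply/norm_cvg0P.
have h : C * (x - a) `^ r @[x --> a^'+] --> 0.
  by rewrite -[X in _ --> X](mulr0 C); apply: cvgMr; exact: powR_shift_cvg0.
apply: (squeeze_cvgr _ (cvg_cst 0) h).
near=> x; rewrite normr_ge0/= fC//; apply/andP; split; near: x.
  exact: nbhs_right_gt.
exact: nbhs_right_lt.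
Unshelve. all: by end_near. Qed.

(** The primitive given by the integral from a and F differ by a constant, read off
    at a where the integral tends to 0; the limit at b then gives the value. *)
Lemma FTC_sing F f a b (l0 l1 : R) : a < b -> sing a b f ->
  (forall x, a < x < b -> is_derive x 1 F (f x)) ->
  F x @[x --> a^'+] --> l0 -> F x @[x --> b^'-] --> l1 ->
  (\int[mu]_(x in `]a, b[) f x)%R = l1 - l0.
Proof.
move=> ab sf dF F0 F1; have fi := sing_integrable sf.
case: sf => cf [C C0 [r r1 fC]]; have r0 : 0 < r + 1 by rewrite -ltrBlDr sub0r.
pose Q x := (\int[mu]_(t in `]a, x]) f t)%R.
have fiS u v : a <= u -> v <= b -> mu.-integrable `]u, v[ (EFin \o f).
  move=> au vb; apply: integrableS fi => //.
  by apply: subset_itv; rewrite bnd_simp.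
have fiSc u v : a <= u -> v < b -> mu.-integrable `]u, v] (EFin \o f).
  move=> au vb; apply: integrableS fi => //.
  by apply: subset_itv; rewrite bnd_simp.
have QE x : a < x < b -> Q x = (\int[mu]_(t in `]a, x[) f t)%R.
  move=> /andP[ax xb]; rewrite /Q -Rintegral_itv_bndo_bndc//.
  by apply: fiS => //; exact: ltW.
have dQ x : a < x < b -> is_derive x 1 Q (f x).
  move=> xab; have /andP[ax xb] := xab.
  have xm : x < (x + b) / 2 by rewrite midf_lt.
  have mb : (x + b) / 2 < b by rewrite midf_lt.
  have := @continuous_FTC1 _ f (BRight a) x ((x + b) / 2) xm (fiSc a _ (lexx _) mb).
  have axE : (BRight a < BRight x)%O by rewrite bnd_simp.
  move=> /(_ axE (cf _ xab))[].
  by move=> d1 d2; apply: DeriveDef; [exact: d1|rewrite derive1E in d2; exact: d2].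
have dFQ x : a < x < b -> is_derive x 1 (fun x => F x - Q x) 0.
  move=> xab; have := dF _ xab; have := dQ _ xab => h1 h2.
  by apply: is_derive_eq; rewrite subrr.
pose m := (a + b) / 2.
have mab : a < m < b by rewrite !midf_lt.
have cst x : a < x < b -> F x - Q x = F m - Q m.
  have le u v : a < u -> v < b -> u <= v -> F u - Q u = F v - Q v.
    move=> au vb uv.
    have dd z : u <= z <= v -> is_derive z 1 (fun x => F x - Q x) 0.
      move=> /andP[uz zv]; apply: dFQ.
      by rewrite (lt_le_trans au uz) (le_lt_trans zv vb).
    have [||c _] := @MVT_segment _ (fun x => F x - Q x) (fun=> 0) _ _ uv.
    - by move=> z; rewrite in_itv/= => /andP[uz zv]; apply: dd; rewrite !ltW.
    - by apply: continuous_in_within => z /dd/is_derive_continuous.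
    by rewrite mul0r => /eqP; rewrite subr_eq0 => /eqP.
  move=> /andP[ax xb]; have /andP[am mb] := mab.
  by have [xm|/ltW mx] := leP x m; [exact: le|apply/esym; exact: le].
have ar : ProperFilter a^'+ by exact: at_right_proper_filter.
have bl : ProperFilter b^'- by exact: at_left_proper_filter.
have Q0 : Q x @[x --> a^'+] --> 0.
  apply: (@cvg0_at_right _ _ b (C / (r + 1)) (r + 1)) => // x xab.
  have /andP[ax xb] := xab; rewrite QE//.
  rewrite mulrAC -mulrA; apply: Rintegral_norm_le_powR => //; first exact: ltW.
    by apply: fiS => //; exact: ltW.
  by move=> y /andP[ay yx]; apply: fC; rewrite ay (lt_trans yx).
have near_a : \forall x \near a^'+, a < x < b.
  near=> x; apply/andP; split; near: x; [exact: nbhs_right_gt|exact: nbhs_right_lt].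
have near_b : \forall x \near b^'-, m < x < b.
  have /andP[am mb] := mab.
  near=> x; apply/andP; split; near: x; [exact: nbhs_left_gt|exact: nbhs_left_lt].
have K : F m - Q m = l0.
  have h : F x - Q x @[x --> a^'+] --> l0 - 0 by exact: cvgB.
  have h2 : F x - Q x @[x --> a^'+] --> F m - Q m.
    by apply: cvg_near_cst; apply: filterS near_a => x; exact: cst.
  by rewrite (cvg_unique _ h2 h)// subr0.
have Q1 : Q x @[x --> b^'-] --> (\int[mu]_(x in `]a, b[) f x)%R.
  pose M := C * (powR (m - a) r + powR (b - a) r).
  have bd x : m < x < b -> `|(\int[mu]_(t in `]a, b[) f t)%R - Q x| <= M * (b - x).
    move=> /andP[mx xb]; have /andP[am mb] := mab; have ax := lt_trans am mx.
    rewrite (Rintegral_itvB fi) ?bnd_simp ?(ltW ax)//.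
    have fi' : mu.-integrable `]x, b[ (EFin \o f) by apply: fiS => //; exact: ltW.
    have M0 : 0 <= M by rewrite /M mulr_ge0// addr_ge0 ?powR_ge0.
    apply: (le_trans (@Rintegral_norm_le_powR x b f M 0 _ _ M0 fi' _)); last 1 first.
    - by rewrite add0r divr1 powRr1// subr_ge0 ltW.
    - exact: ltrN10.
    - exact: ltW.
    move=> y /andP[xy yb]; rewrite powRr0 mulr1.
    have ay := lt_trans ax xy.
    apply: (le_trans (fC _ _)); first by rewrite ay yb.
    by rewrite ler_wpM2l// powR_le_ends ?subr_gt0// lerD2r ltW// (lt_trans mx).
  apply/cvgrPdist_le => e e0; have [M0|M0] := leP M 0.
    apply: filterS near_b => x mxb; apply: (le_trans (bd _ mxb)).
    have /andP[_ xb] := mxb.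
    apply: (@le_trans _ _ 0); last exact: ltW.
    by rewrite mulr_le0_ge0// subr_ge0 ltW.
  near=> x.
  have mxb : m < x < b by near: x.
  apply: (le_trans (bd _ mxb)).
  rewrite mulrC -ler_pdivlMr// lerBlDr -lerBlDl.
  near: x; apply: nbhs_left_ge.
  by rewrite ltrBlDr ltrDl divr_gt0.
have h : F x - Q x @[x --> b^'-] --> l1 - (\int[mu]_(x in `]a, b[) f x)%R by exact: cvgB.
have h2 : F x - Q x @[x --> b^'-] --> l0.
  rewrite -K; apply: cvg_near_cst; apply: filterS near_b => x /andP[mx xb].
  by have /andP[am _] := mab; apply: cst; rewrite (lt_trans am mx).
by rewrite (cvg_unique _ h2 h)// subKr.
Unshelve. all: by end_near. Qed.

(** The integral over ]a, e[ is O((e - a)^(r+1)). *)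
Lemma sing_cvg f a b : a < b -> sing a b f ->
  (\int[mu]_(x in `]e, b[) f x)%R @[e --> a^'+] --> (\int[mu]_(x in `]a, b[) f x)%R.
Proof.
move=> ab sf; have fi := sing_integrable sf.
case: sf => cf [C C0 [r r1 fC]]; have r0 : 0 < r + 1 by rewrite -ltrBlDr sub0r.
apply: (cvg_sub0 _ (cvg_cst _)).
apply: (@cvg0_at_right _ _ b (C / (r + 1)) (r + 1)) => // x /andP[ax xb].
have fi' : mu.-integrable `]a, x[ (EFin \o f).
  by apply: integrableS fi => //; apply: subset_itv; rewrite bnd_simp// ltW.
rewrite -(Rintegral_itvB fi) ?bnd_simp ?(ltW ax)//.
rewrite -[X in `|X|]/(_ - _ - _) addrAC subrr add0r normrN -Rintegral_itv_bndo_bndc//.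
rewrite mulrAC -mulrA; apply: Rintegral_norm_le_powR => //; first exact: ltW.
by move=> y /andP[ay yx]; apply: fC; rewrite ay (lt_trans yx).
Qed.
End Calculus.

(** * Primitives on the half line *)
Section Primitive.
Context {R : realType}.
Implicit Types (f g F P : R -> R) (a b c x y r C : R).
Notation mu := (@lebesgue_measure R).

Lemma le_of_derive_le F G (f g : R -> R) x y : x <= y ->
  (forall z, x <= z <= y -> is_derive z 1 F (f z)) ->
  (forall z, x <= z <= y -> is_derive z 1 G (g z)) ->
  (forall z, x <= z <= y -> f z <= g z) ->
  F y - F x <= G y - G x.
Proof.
move=> xy dF dG fg.
have dd z : x <= z <= y -> is_derive z 1 (fun t => G t - F t) (g z - f z).
  by move=> h; have := dF _ h; have := dG _ h => h1 h2; apply: is_derive_eq.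
have [||c] := @MVT_segment _ (fun t => G t - F t) (fun z => g z - f z) _ _ xy.
- by move=> z; rewrite in_itv/= => /andP[uz zv]; apply: dd; rewrite !ltW.
- by apply: continuous_in_within => z /dd/is_derive_continuous.
rewrite in_itv/= => cxy E.
have : 0 <= (G y - F y) - (G x - F x).
  by rewrite E mulr_ge0// subr_ge0 ?fg.
lra.
Qed.

Lemma is_derive_powR_div r x : 0 < x -> r + 1 != 0 ->
  is_derive x 1 (fun x => x `^ (r + 1) / (r + 1)) (x `^ r).
Proof.
move=> x0 r1; have d := is_derive1_powR (r + 1) x0.
have -> : (fun x => x `^ (r + 1) / (r + 1)) = (r + 1)^-1 \*: (fun x => x `^ (r + 1)).
  by apply/funext => y; rewrite /= mulrC.
by apply: is_derive_eq; rewrite -[_ *: _]/(_ * _) mulKf// addrK.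
Qed.

(** An integrable function on the half line is handled through its primitive P and
    the limit G of P at infinity, with a rate at both ends: the two power bounds
    are integrated explicitly, and G is the supremum of P. *)
Lemma half_line_primitive f C r r' : 0 <= C -> r' < -1 -> -1 < r ->
  (forall x, 0 < x -> {for x, continuous f}) ->
  (forall x, 0 < x -> 0 <= f x) ->
  (forall x, 0 < x -> f x <= C * x `^ r) ->
  (forall x, 0 < x -> f x <= C * x `^ r') ->
  exists P (G : R), [/\ forall x, 0 < x -> is_derive x 1 P (f x),
    forall x, 0 < x -> 0 <= P x <= C * (x `^ (r + 1) / (r + 1)),
    forall x y, 0 < x -> x <= y -> P x <= P y &
    forall x, 0 < x -> 0 <= G - P x <= C * (x `^ (r' + 1) / (- (r' + 1)))].
Proof.
move=> C0 r'1 r1 cf f0 fr fr'.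
have sf b : sing 0 b f.
  apply: (@singW _ _ _ _ C r) => // x /andP[x0 _]; first exact: cf.
  by rewrite subr0 ger0_norm ?f0// fr.
have fi b : mu.-integrable `]0, b[ (EFin \o f) := sing_integrable (sf b).
pose P x := (\int[mu]_(t in `]0, x]) f t)%R.
have fic b : mu.-integrable `]0, b] (EFin \o f).
  apply: integrableS (fi (b + 1)) => //; apply: subset_itv; rewrite bnd_simp//.
  by rewrite ltrDl.
have dP x : 0 < x -> is_derive x 1 P (f x).
  move=> x0; have x1 : x < x + 1 by rewrite ltrDl.
  have := @continuous_FTC1 _ f (BRight 0) x (x + 1) x1 (fic _).
  have axE : (BRight (0:R) < BRight x)%O by rewrite bnd_simp.
  move=> /(_ axE (cf _ x0))[] d1 d2.
  by apply: DeriveDef; [exact: d1|rewrite derive1E in d2; exact: d2].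
have P0 x : 0 < x -> 0 <= P x <= C * (x `^ (r + 1) / (r + 1)).
  move=> x0; have Pge : 0 <= P x.
    by apply: Rintegral_ge0 => z; rewrite /= in_itv/= => /andP[z0 _]; exact: f0.
  rewrite Pge/= -(ger0_norm Pge) /P -Rintegral_itv_bndo_bndc//.
  rewrite -{2}(subr0 x); apply: Rintegral_norm_le_powR => //; first exact: ltW.
  by move=> z /andP[z0 _]; rewrite subr0 ger0_norm ?f0// fr.
have r'0 : r' + 1 != 0 by rewrite lt_eqF// -ltrBrDr sub0r.
have Pinc x y : 0 < x -> x <= y -> P x <= P y.
  move=> x0 xy; have := @le_of_derive_le (cst 0) P (cst 0) f x y xy.
  rewrite subrr subr_ge0; apply.
  - by move=> z /andP[xz _]; apply: dP; exact: lt_le_trans xz.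
  - by move=> z /andP[xz _]; apply: f0; exact: lt_le_trans xz.
have Pbd x y : 0 < x -> x <= y -> P y - P x <= C * (x `^ (r' + 1) / (- (r' + 1))).
  move=> x0 xy.
  have := @le_of_derive_le P (fun x => C * (x `^ (r' + 1) / (r' + 1))) f
    (fun z => C * z `^ r') x y xy.
  have h1 z : x <= z <= y -> is_derive z 1 P (f z).
    by move=> /andP[xz _]; apply: dP; exact: lt_le_trans xz.
  have h2 z : x <= z <= y ->
      is_derive z 1 (fun x => C * (x `^ (r' + 1) / (r' + 1))) (C * z `^ r').
    move=> /andP[xz _]; have d := is_derive_powR_div (lt_le_trans x0 xz) r'0.
    by apply: is_derive_eq; rewrite /GRing.scale/=; ring.
  have h3 z : x <= z <= y -> f z <= C * z `^ r'.
    by move=> /andP[xz _]; apply: fr'; exact: lt_le_trans xz.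
  move=> /(_ h1 h2 h3) /le_trans; apply.
  rewrite -mulrBr ler_wpM2l// invrN mulrN -mulrBl -mulNr.
  rewrite ler_nM2r; last by rewrite invr_lt0 -ltrBrDr sub0r.
  by rewrite lerBrDr addrC subrr powR_ge0.
pose G := sup [set P x | x in [set x | 1 <= x]].
have hs : has_sup [set P x | x in [set x | 1 <= x]].
  split; first by exists (P 1); exists 1 => //=; exact: lexx.
  exists (P 1 + C * (1 `^ (r' + 1) / (- (r' + 1)))) => _ [x /= x1 <-].
  by rewrite -lerBlDl Pbd.
have PG x : 0 < x -> P x <= G.
  move=> x0; apply: (@le_trans _ _ (P (Num.max 1 x))).
    by apply: Pinc; rewrite // le_max lexx orbT.
  by apply: sup_upper_bound => //; exists (Num.max 1 x) => //=; rewrite le_max lexx.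
exists P, G; split => // x x0; rewrite subr_ge0 PG//=.
rewrite lerBlDr; apply: ge_sup; first by case: hs.
move=> _ [y /= y1 <-]; apply: (@le_trans _ _ (P (Num.max x y))).
  by apply: Pinc; [exact: lt_le_trans y1|rewrite le_max lexx orbT].
by rewrite -lerBlDr Pbd// le_max lexx.
Qed.

Lemma sin_le_id x : 0 <= x -> sin x <= x.
Proof.
move=> x0; have := @le_of_derive_le sin id cos (cst 1) 0 x x0.
rewrite sin0 !subr0; apply.
by move=> z _; exact: cos_le1.
Qed.

Lemma norm_sin_le x : 0 <= x -> `|sin x| <= x.
Proof.
move=> x0; have := @le_of_derive_le (fun x => - sin x) id (fun x => - cos x) (cst 1) 0 x x0.
rewrite sin0 subr0 oppr0 subr0 => h; rewrite ler_norml sin_le_id// andbT lerNl.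
apply: h.
by move=> z _; have := cos_geN1 z; rewrite /=; lra.
Qed.

Lemma one_minus_cos_le x : 0 <= x -> 1 - cos x <= x ^+ 2.
Proof.
move=> x0.
have := @le_of_derive_le (fun x => 1 - cos x) (fun x => x * x) sin (fun x => 2 * x) 0 x x0.
rewrite cos0 subrr mul0r !subr0 expr2; apply.
- by move=> z _; apply: is_derive_eq; rewrite /GRing.scale/=; ring.
- by move=> z _; apply: is_derive_eq; rewrite /GRing.scale/=; lra.
- by move=> z /andP[z0 _]; apply: (le_trans (sin_le_id z0)); lra.
Qed.

Lemma one_minus_cos_ge0 x : 0 <= 1 - cos x.
Proof. by rewrite subr_ge0 cos_le1. Qed.

Lemma one_minus_cos_le2 x : 1 - cos x <= 2.
Proof. by have := cos_geN1 x; lra. Qed.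

(** G is the Mellin transform of 1 - cos at q + 1.  It converges at 0 because
    1 - cos x <= x^2, at infinity because 1 - cos x <= 2, and it is positive. *)
Lemma one_minus_cos_primitive q : -3 < q -> q < -1 ->
  exists P (G : R), [/\ 0 < G,
    forall x, 0 < x -> is_derive x 1 P (x `^ q * (1 - cos x)),
    forall x, 0 < x -> 0 <= P x <= 2 * (x `^ (q + 3) / (q + 3)) &
    forall x, 0 < x -> 0 <= G - P x <= 2 * (x `^ (q + 1) / (- (q + 1)))].
Proof.
move=> q3 q1.
have q2 : -1 < q + 2 by lra.
have c x : 0 < x -> {for x, continuous (fun x => x `^ q * (1 - cos x))}.
  move=> x0; apply: cvgM.
    exact: is_derive_continuous (is_derive1_powR q x0).
  by apply: cvgB; [exact: cvg_cst|exact: continuous_cos].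
have f0 x : 0 < x -> 0 <= x `^ q * (1 - cos x).
  by move=> _; rewrite mulr_ge0 ?powR_ge0 ?one_minus_cos_ge0.
have f1 x : 0 < x -> x `^ q * (1 - cos x) <= 2 * x `^ (q + 2).
  move=> x0; rewrite powRD ?(gt_eqF x0) ?implybT//.
  rewrite mulrCA ler_wpM2l ?powR_ge0// (@powR_mulrn _ x 2 (ltW x0)).
  apply: (le_trans (one_minus_cos_le (ltW x0))).
  by have := sqr_ge0 x; lra.
have f2 x : 0 < x -> x `^ q * (1 - cos x) <= 2 * x `^ q.
  by move=> x0; rewrite mulrC ler_wpM2r ?powR_ge0//; exact: one_minus_cos_le2.
have := half_line_primitive (ler0n R 2) q1 q2 c f0 f1 f2.
move=> [P [G [dP P0 Pinc PG]]]; exists P, G; split => //; last first.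
  by move=> x x0; have := P0 x x0; have -> : q + 2 + 1 = q + 3 by lra.
have h12 : (1 : R) <= 2 by lra.
have [||c0] := @MVT_segment _ P (fun x => x `^ q * (1 - cos x)) 1 2 h12.
- by move=> z; rewrite in_itv/= => /andP[z1 _]; apply: dP; lra.
- by apply: continuous_in_within => z /andP[z1 _]; apply: is_derive_continuous (dP _ _); lra.
rewrite in_itv/= => /andP[c1 c2] E.
have c00 : 0 < c0 by lra.
have h1 : 0 <= P 1 by case/andP: (P0 1 ltr01).
have h2 : 0 <= G - P 2 by case/andP: (PG 2 (ltr0n R 2)).
suff : 0 < P 2 - P 1 by lra.
rewrite E; apply: mulr_gt0; last by lra.
rewrite mulr_gt0 ?powR_gt0//.
have -> : c0 = (c0 / 2) *+ 2 by rewrite -mulr_natr divfK ?pnatr_eq0.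
rewrite cos_mulr2n.
have s2 := cos2Dsin2 (c0 / 2).
have : 0 < sin (c0 / 2) by apply: sin_gt0_pi; have := pi_ge2 R; lra.
by move=> /(exprn_gt0 2); lra.
Qed.
End Primitive.

(** * Integration by parts against a cut-off power *)
Section Cutoff.
Context {R : realType}.
Implicit Types (f g F P : R -> R) (x y r C p q : R).
Notation mu := (@lebesgue_measure R).

Lemma sing_bounded a b f (D : R) : (forall x, a < x < b -> {for x, continuous f}) ->
  0 <= D -> (forall x, a < x < b -> `|f x| <= D) -> sing a b f.
Proof.
move=> cf D0 fD; apply: (@singW _ _ _ _ D 0) => //.
by move=> x xab; rewrite powRr0 mulr1 fD.
Qed.

Lemma RintegralD_sing a b f g : sing a b f -> sing a b g ->
  (\int[mu]_(x in `]a, b[) (f x + g x) =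
   \int[mu]_(x in `]a, b[) f x + \int[mu]_(x in `]a, b[) g x)%R.
Proof. by move=> sf sg; apply: RintegralD => //; exact: sing_integrable. Qed.

Lemma RintegralZ_sing a b f (k : R) : sing a b f ->
  (\int[mu]_(x in `]a, b[) (k * f x) = k * \int[mu]_(x in `]a, b[) f x)%R.
Proof. by move=> sf; apply: RintegralZl => //; exact: sing_integrable. Qed.

(** The pattern of all the integrations by parts below: a primitive whose derivative
    is the integrand f1 up to a bounded f2 gives the integral up to O(b - a). *)
Lemma FTC_approx F f1 f2 a b (l0 l1 D : R) : a < b -> 0 <= D -> sing a b f1 ->
  (forall x, a < x < b -> {for x, continuous f2}) ->
  (forall x, a < x < b -> `|f2 x| <= D) ->
  (forall x, a < x < b -> is_derive x 1 F (f1 x + f2 x)) ->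
  F x @[x --> a^'+] --> l0 -> F x @[x --> b^'-] --> l1 ->
  `|(\int[mu]_(x in `]a, b[) f1 x)%R - (l1 - l0)| <= D * (b - a).
Proof.
move=> ab D0 s1 c2 f2D dF F0 F1.
have s2 : sing a b f2 by exact: (sing_bounded c2 D0).
have := FTC_sing ab (singD s1 s2) dF F0 F1.
rewrite (RintegralD_sing s1 s2) => <-.
rewrite opprD addrA subrr sub0r normrN.
apply: (le_trans (@Rintegral_norm_le_powR _ a b f2 D 0 _ _ D0 _ _)).
- exact: ltrN10.
- exact: ltW.
- exact: sing_integrable.
- by move=> x xab; rewrite powRr0 mulr1 f2D.
- by rewrite add0r powRr1 ?divr1// subr_ge0 ltW.
Qed.

(** The data of a C^2 function equal to 1 next to a and to 0 next to b, with
    explicit derivatives.  The derivatives live away from a, so they suppress any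
    power of x - a, which is why nothing is lost in integrating by parts. *)
Record cutoff (a b c : R) (h h1 h2 : R -> R) (M : R) : Prop := Cutoff {
  cut_ac : a < c; cut_cb : c < b; cut_M : 0 <= M;
  cut_d : forall x, a < x < b -> is_derive x 1 h (h1 x);
  cut_d1 : forall x, a < x < b -> is_derive x 1 h1 (h2 x);
  cut_c2 : forall x, a < x < b -> {for x, continuous h2};
  cut_left : forall x, a < x < c -> [/\ h x = 1, h1 x = 0 & h2 x = 0];
  cut_right : \forall x \near b^'-, h x = 0 /\ h1 x = 0;
  cut_bound : forall x, a < x < b -> [/\ `|h x| <= M, `|h1 x| <= M & `|h2 x| <= M] }.

Variables (a b c : R) (h h1 h2 : R -> R) (M : R).
Hypothesis H : cutoff a b c h h1 h2 M.

Let ab : a < b. Proof. by case: H => ac cb *; exact: lt_trans cb. Qed.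

Lemma cutoff_continuous x : a < x < b -> {for x, continuous h}.
Proof. by move=> /(cut_d H)/is_derive_continuous. Qed.

Lemma cutoff1_continuous x : a < x < b -> {for x, continuous h1}.
Proof. by move=> /(cut_d1 H)/is_derive_continuous. Qed.

(** This is how terms containing a derivative of the cut-off are bounded, whatever
    the exponent. *)
Lemma powR_away_bound r g D x : 0 <= D -> (forall x, a < x < c -> g x = 0) ->
  (forall x, a < x < b -> `|g x| <= D) -> a < x < b ->
  `|(x - a) `^ r * g x| <= ((c - a) `^ r + (b - a) `^ r) * D.
Proof.
move=> D0 g0 gD xab; have /andP[ax xb] := xab.
have [xc|cx] := ltP x c.
  by rewrite g0 ?ax// mulr0 normr0 mulr_ge0// addr_ge0// powR_ge0.
rewrite normrM ler_pM// ?gD// ger0_norm ?powR_ge0//.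
by apply: powR_le_ends; rewrite ?subr_gt0 ?(cut_ac H)// lerD2r// ltW.
Qed.

Lemma cvg_eq0_near f : (\forall x \near b^'-, f x = 0) -> f x @[x --> b^'-] --> 0.
Proof. by move=> f0; apply: cvg_near_cst. Qed.

Lemma near_cut_left f l : (forall x, a < x < c -> f x = l) ->
  f x @[x --> a^'+] --> l.
Proof.
move=> f0; apply: cvg_near_cst; near=> x; apply: f0; apply/andP; split; near: x.
  exact: nbhs_right_gt.
by apply: nbhs_right_lt; exact: cut_ac H.
Unshelve. all: by end_near. Qed.

Lemma is_derive_affine_comp f (l N x : R) : is_derive (N * (x - a)) 1 f l ->
  is_derive x 1 (fun x => f (N * (x - a))) (N * l).
Proof.
move=> df.
have d : is_derive x 1 (fun x => N * (x - a)) N.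
  by apply: is_derive_eq; rewrite /GRing.scale/=; ring.
by have := @is_derive1_comp _ f (fun x => N * (x - a)) _ _ _ df d; rewrite mulrC.
Qed.

Lemma sing_powM q m g C : 0 <= C -> -1 < q + m ->
  (forall x, a < x < b -> {for x, continuous g}) ->
  (forall x, a < x < b -> `|g x| <= C * (x - a) `^ m) ->
  sing a b (fun x => (x - a) `^ q * g x).
Proof.
move=> C0 qm cg gC; apply: (@singW _ _ _ _ C (q + m)) => //.
  move=> x xab; have /andP[ax _] := xab.
  by apply: cvgM; [exact: powR_shift_continuous|exact: cg].
move=> x xab; have /andP[ax _] := xab.
have xa : 0 < x - a by rewrite subr_gt0.
rewrite powRD ?(gt_eqF xa) ?implybT// normrM ger0_norm ?powR_ge0//.
by rewrite mulrCA ler_wpM2l ?powR_ge0// gC.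
Qed.

Lemma powM_cvg0 q m g C : 0 < q + m ->
  (forall x, a < x < b -> `|g x| <= C * (x - a) `^ m) ->
  (x - a) `^ q * g x @[x --> a^'+] --> 0.
Proof.
move=> qm gC; apply: (@cvg0_at_right _ _ _ b C (q + m)) => // x xab.
have /andP[ax _] := xab.
have xa : 0 < x - a by rewrite subr_gt0.
rewrite powRD ?(gt_eqF xa) ?implybT// normrM ger0_norm ?powR_ge0//.
by rewrite mulrCA ler_wpM2l ?powR_ge0// gC.
Qed.

Section Trig.
Variables (N : R) (N0 : 0 < N).
Let co x := cos (N * (x - a)).
Let si x := sin (N * (x - a)).

Lemma is_derive_co x : is_derive x 1 (fun x => cos (N * (x - a))) (N * - si x).
Proof. by apply: is_derive_affine_comp. Qed.

Lemma is_derive_si x : is_derive x 1 (fun x => sin (N * (x - a))) (N * co x).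
Proof. by apply: is_derive_affine_comp. Qed.

Lemma omc_continuous x : {for x, continuous (fun x => 1 - cos (N * (x - a)))}.
Proof.
by apply: cvgB; [exact: cvg_cst|exact: is_derive_continuous (is_derive_co x)].
Qed.

Lemma cut_co_bound x : a < x < b -> `|h x * co x| <= M * (x - a) `^ 0.
Proof.
move=> xab; rewrite powRr0 mulr1 normrM -[X in _ <= X]mulr1.
by have [hM _ _] := cut_bound H xab; rewrite ler_pM// cos_max.
Qed.

Lemma cut_si_bound x : a < x < b -> `|h x * si x| <= M * N * (x - a) `^ 1.
Proof.
move=> xab; have /andP[ax _] := xab; have xa : 0 < x - a by rewrite subr_gt0.
have [hM _ _] := cut_bound H xab.
rewrite powRr1 ?(ltW xa)// normrM -mulrA ler_pM// norm_sin_le//.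
by rewrite mulr_ge0// ltW.
Qed.

Lemma cut_omc_bound x : a < x < b ->
  `|h x * (1 - co x)| <= M * N ^+ 2 * (x - a) `^ 2.
Proof.
move=> xab; have /andP[ax _] := xab; have xa : 0 < x - a by rewrite subr_gt0.
have [hM _ _] := cut_bound H xab.
rewrite (@powR_mulrn _ _ 2 (ltW xa)) normrM (ger0_norm (one_minus_cos_ge0 _)).
have := one_minus_cos_le (ltW (mulr_gt0 N0 xa)); rewrite exprMn => cN.
by rewrite -mulrA ler_pM// one_minus_cos_ge0.
Qed.

Lemma sing_co q : -1 < q -> sing a b (fun x => (x - a) `^ q * (h x * co x)).
Proof.
move=> q1; apply: (@sing_powM q 0 _ M); rewrite ?(cut_M H) ?addr0//.
  move=> x xab; apply: cvgM; first exact: cutoff_continuous.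
  exact: is_derive_continuous (is_derive_co x).
exact: cut_co_bound.
Qed.

Lemma sing_si q : -2 < q -> sing a b (fun x => (x - a) `^ q * (h x * si x)).
Proof.
move=> q1; apply: (@sing_powM q 1 _ (M * N)).
- by rewrite mulr_ge0 ?(cut_M H) ?ltW.
- by lra.
- move=> x xab; apply: cvgM; first exact: cutoff_continuous.
  exact: is_derive_continuous (is_derive_si x).
exact: cut_si_bound.
Qed.

Lemma sing_omc q : -3 < q -> sing a b (fun x => (x - a) `^ q * (h x * (1 - co x))).
Proof.
move=> q1; apply: (@sing_powM q 2 _ (M * N ^+ 2)).
- by rewrite mulr_ge0 ?(cut_M H) ?sqr_ge0.
- by lra.
- move=> x xab; apply: cvgM; first exact: cutoff_continuous.
  exact: omc_continuous.
exact: cut_omc_bound.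
Qed.

(** The substitution t = N (x - a) is avoided by using N^-(q+1) (P (N (x - a)) - G) h
    as a primitive: it is equal to - N^-(q+1) G at a and to 0 at b, and the error
    carries h', hence is bounded by the decay of G - P. *)
Lemma cutoff_one_minus_cos q P G : -3 < q -> q < -1 ->
  (forall x, 0 < x -> is_derive x 1 P (x `^ q * (1 - cos x))) ->
  (forall x, 0 < x -> 0 <= P x <= 2 * (x `^ (q + 3) / (q + 3))) ->
  (forall x, 0 < x -> 0 <= G - P x <= 2 * (x `^ (q + 1) / (- (q + 1)))) ->
  `|(\int[mu]_(x in `]a, b[) ((x - a) `^ q * (h x * (1 - cos (N * (x - a))))))%R
    - N `^ (- (q + 1)) * G| <=
  2 * (((c - a) `^ (q + 1) + (b - a) `^ (q + 1)) * M) / (- (q + 1)) * (b - a).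
Proof.
move=> q3 q1 dP P0 PG.
set f1 := fun x => (x - a) `^ q * (h x * (1 - cos (N * (x - a)))).
pose f2 x := N `^ (- (q + 1)) * (P (N * (x - a)) - G) * h1 x.
pose F x := N `^ (- (q + 1)) * (P (N * (x - a)) - G) * h x.
set D := 2 * _ / _.
have q10 : 0 < - (q + 1) by lra.
have D0 : 0 <= D.
  rewrite /D divr_ge0 ?(ltW q10)// mulr_ge0// mulr_ge0 ?(cut_M H)//.
  by rewrite addr_ge0 ?powR_ge0.
have dPN x : a < x < b -> is_derive x 1 (fun x => P (N * (x - a)))
    (N * ((N * (x - a)) `^ q * (1 - cos (N * (x - a))))).
  move=> /andP[ax xb]; apply: is_derive_affine_comp; apply: dP.
  by rewrite mulr_gt0// subr_gt0.
have NN : N `^ (- (q + 1)) * (N * N `^ q) = 1.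
  rewrite -{2}(powRr1 (ltW N0)) -!powRD ?(gt_eqF N0) ?implybT//.
  by rewrite (addrC 1) addNr powRr0.
have s1 : sing a b f1 by exact: sing_omc.
have c2 x : a < x < b -> {for x, continuous f2}.
  move=> xab; apply: cvgM; last exact: cutoff1_continuous.
  apply: cvgM; first exact: cvg_cst.
  apply: cvgB; last exact: cvg_cst.
  exact: is_derive_continuous (dPN _ xab).
have f2D x : a < x < b -> `|f2 x| <= D.
  move=> xab; have /andP[ax xb] := xab; have [xc|cx] := ltP x c.
    by have [|_ h0 _] := cut_left H (x := x); rewrite ?ax// /f2 h0 mulr0 normr0.
  have xa : 0 < x - a by rewrite subr_gt0.
  have Nx : 0 < N * (x - a) by rewrite mulr_gt0.
  have /andP[G1 G2] := PG _ Nx.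
  rewrite /f2 !normrM (ger0_norm (powR_ge0 _ _)) distrC (ger0_norm G1).
  have [_ hM _] := cut_bound H xab.
  have NE : N `^ (- (q + 1)) * N `^ (q + 1) = 1.
    by rewrite -powRD ?(gt_eqF N0) ?implybT// addNr powRr0.
  apply: (@le_trans _ _ (N `^ (- (q + 1)) * (2 * ((N * (x - a)) `^ (q + 1) / - (q + 1))) * M)).
    by rewrite ler_pM ?mulr_ge0 ?powR_ge0// ler_wpM2l ?powR_ge0.
  rewrite powRM ?(ltW N0) ?(ltW xa)//.
  have -> : N `^ (- (q + 1)) * (2 * (N `^ (q + 1) * (x - a) `^ (q + 1) / - (q + 1))) * M
    = (N `^ (- (q + 1)) * N `^ (q + 1)) * (2 * ((x - a) `^ (q + 1) * M) / - (q + 1)) by ring.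
  rewrite NE mul1r /D ler_wpM2r ?invr_ge0 ?(ltW q10)// ler_wpM2l// ler_wpM2r ?(cut_M H)//.
  by apply: powR_le_ends; rewrite ?subr_gt0 ?(cut_ac H)// lerD2r// ltW.
have dF x : a < x < b -> is_derive x 1 F (f1 x + f2 x).
  move=> xab; have d1 := dPN _ xab; have d2 := cut_d H xab.
  have /andP[ax xb] := xab.
  apply: is_derive_eq; rewrite /GRing.scale/= /f1 /f2.
  rewrite powRM ?(ltW N0) ?subr_ge0 ?(ltW ax)//.
  ring: NN.
have F0 : F x @[x --> a^'+] --> - (N `^ (- (q + 1)) * G).
  have -> : - (N `^ (- (q + 1)) * G) = N `^ (- (q + 1)) * (0 - G) * 1 by ring.
  apply: cvgM; last by apply: near_cut_left => x /(cut_left H)[].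
  apply: cvgMr; apply: cvgB; last exact: cvg_cst.
  apply: (@cvg0_at_right _ _ _ b (2 / (q + 3) * N `^ (q + 3)) (q + 3)) => //.
    by lra.
  move=> x /andP[ax xb]; have xa : 0 < x - a by rewrite subr_gt0.
  have /andP[P1 P2] := P0 _ (mulr_gt0 N0 xa).
  rewrite ger0_norm//; apply: (le_trans P2).
  rewrite powRM ?(ltW N0) ?(ltW xa)//.
  by apply: eqW; ring.
have F1 : F x @[x --> b^'-] --> 0.
  apply: cvg_eq0_near; apply: filterS (cut_right H) => x [h0 _].
  by rewrite /F h0 mulr0.
by have := FTC_approx ab D0 s1 c2 f2D dF F0 F1; rewrite sub0r opprK.
Qed.

Lemma h1_zero x : a < x < c -> h1 x = 0. Proof. by move=> /(cut_left H)[]. Qed.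
Lemma h2_zero x : a < x < c -> h2 x = 0. Proof. by move=> /(cut_left H)[]. Qed.
Lemma h1_bound x : a < x < b -> `|h1 x| <= M. Proof. by move=> /(cut_bound H)[]. Qed.
Lemma h2_bound x : a < x < b -> `|h2 x| <= M. Proof. by move=> /(cut_bound H)[]. Qed.

Let K q := ((c - a) `^ q + (b - a) `^ q) * M.
Let K0 q : 0 <= K q.
Proof. by rewrite mulr_ge0 ?(cut_M H)// addr_ge0 ?powR_ge0. Qed.

(** sin is N^-1 times the derivative of 1 - cos, which vanishes to second order at
    a: no boundary term appears, even for p < -1. *)
Lemma si_omc p : -2 < p -> p < 0 ->
  `|(\int[mu]_(x in `]a, b[) ((x - a) `^ p * (h x * si x)))%R +
    N^-1 * (p * (\int[mu]_(x in `]a, b[) ((x - a) `^ (p - 1) * (h x * (1 - co x))))%R)|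
  <= N^-1 * (K p * 2) * (b - a).
Proof.
move=> p2 p0.
pose f2 x := N^-1 * ((x - a) `^ p * h1 x * (1 - co x)).
have sA : sing a b (fun x => (x - a) `^ p * (h x * si x)) by exact: sing_si.
have sB : sing a b (fun x => (x - a) `^ (p - 1) * (h x * (1 - co x))).
  by apply: sing_omc; lra.
have sB1 := singZ N^-1 (singZ p sB).
have Ni : 0 <= N^-1 by rewrite invr_ge0 ltW.
have D0 : 0 <= N^-1 * (K p * 2) by apply: mulr_ge0 => //; apply: mulr_ge0.
rewrite -(RintegralZ_sing p sB) -(RintegralZ_sing N^-1 (singZ p sB)).
rewrite -(RintegralD_sing sA sB1) -[X in `|X|]subr0 -[X in _ - X](subrr 0).
apply: (@FTC_approx (fun x => N^-1 * ((x - a) `^ p * (h x * (1 - co x)))) _ f2 _ _ _ _ _ ab D0).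
- exact: singD.
- move=> x xab; have /andP[ax _] := xab; apply: cvgM; first exact: cvg_cst.
  apply: cvgM; last exact: omc_continuous.
  by apply: cvgM; [exact: powR_shift_continuous|exact: cutoff1_continuous].
- move=> x xab; rewrite /f2 normrM (ger0_norm Ni) ler_wpM2l// normrM ler_pM//.
    exact: (powR_away_bound p (cut_M H) h1_zero h1_bound).
  by rewrite ger0_norm ?one_minus_cos_ge0// one_minus_cos_le2.
- move=> x xab; have /andP[ax _] := xab.
  have d1 := is_derive_powR_shift p ax; have d2 := cut_d H xab.
  have d3 := is_derive_co x.
  by apply: is_derive_eq; rewrite /GRing.scale/= /f2; field; rewrite gt_eqF.
- rewrite -[X in _ --> X](mulr0 N^-1); apply: cvgMr.
  apply: (@powM_cvg0 p 2 _ (M * N ^+ 2)); first by lra.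
  exact: cut_omc_bound.
- apply: cvg_eq0_near; apply: filterS (cut_right H) => x [h0 _].
  by rewrite h0 mul0r !mulr0.
Qed.

(** First against sin, then against 1 - cos, so that the boundary terms at a
    vanish both times. *)
Lemma co_omc p : -1 < p -> p < 1 ->
  `|(\int[mu]_(x in `]a, b[) ((x - a) `^ p * (h x * co x)))%R -
    N ^- 2 * (p * (p - 1) * (\int[mu]_(x in `]a, b[) ((x - a) `^ (p - 2) * (h x * (1 - co x))))%R)|
  <= N ^- 2 * (`|p| * K (p - 1) * 2 + (`|p| * K (p - 1) + K p)) * (b - a).
Proof.
move=> p1 p2.
pose f2 x := N ^- 2 * (- p * ((x - a) `^ (p - 1) * h1 x) * (1 - co x)
   + (p * ((x - a) `^ (p - 1) * h1 x) + (x - a) `^ p * h2 x) * co x).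
have sA : sing a b (fun x => (x - a) `^ p * (h x * co x)) by exact: sing_co.
have sB : sing a b (fun x => (x - a) `^ (p - 2) * (h x * (1 - co x))).
  by apply: sing_omc; lra.
have sB1 := singZ (- N ^- 2) (singZ (p * (p - 1)) sB).
have Ni : 0 <= N ^- 2 by rewrite invr_ge0 sqr_ge0.
set D := (X in _ <= X * _).
have pK := mulr_ge0 (normr_ge0 p) (K0 (p - 1)).
have D0 : 0 <= D by apply: mulr_ge0 => //; have := K0 p; lra.
rewrite -mulNr -(RintegralZ_sing (p * (p - 1)) sB).
rewrite -(RintegralZ_sing (- N ^- 2) (singZ (p * (p - 1)) sB)).
rewrite -(RintegralD_sing sA sB1) -[X in `|X|]subr0 -[X in _ - X](subrr 0).
apply: (@FTC_approx (fun x => N^-1 * ((x - a) `^ p * (h x * si x)) +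
   N ^- 2 * ((x - a) `^ p * h1 x * co x - p * ((x - a) `^ (p - 1) * (h x * (1 - co x)))))
   _ f2 _ _ _ _ _ ab D0).
- exact: singD.
- move=> x xab; have /andP[ax _] := xab.
  have cc : {for x, continuous co} by exact: is_derive_continuous (is_derive_co x).
  have c1 r : {for x, continuous (fun x => (x - a) `^ r * h1 x)}.
    by apply: cvgM; [exact: powR_shift_continuous|exact: cutoff1_continuous].
  have c2 r : {for x, continuous (fun x => (x - a) `^ r * h2 x)}.
    by apply: cvgM; [exact: powR_shift_continuous|exact: cut_c2 H _ xab].
  apply: cvgM; first exact: cvg_cst.
  apply: cvgD; apply: cvgM; last 1 first.
  + exact: cc.
  + by apply: cvgM; [exact: cvg_cst|exact: c1].
  + exact: omc_continuous.
  + by apply: cvgD; [apply: cvgM; [exact: cvg_cst|exact: c1]|exact: c2].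
- move=> x xab; rewrite /f2 normrM (ger0_norm Ni) ler_wpM2l//.
  have k1 := powR_away_bound (p - 1) (cut_M H) h1_zero h1_bound xab.
  have k2 := powR_away_bound p (cut_M H) h2_zero h2_bound xab.
  apply: (le_trans (ler_normD _ _)); apply: lerD; rewrite normrM.
    apply: ler_pM => //; first by rewrite normrM normrN ler_wpM2l.
    by rewrite ger0_norm ?one_minus_cos_ge0// one_minus_cos_le2.
  rewrite -[X in _ <= X]mulr1 ler_pM ?cos_max//.
  apply: (le_trans (ler_normD _ _)); apply: lerD => //.
  by rewrite normrM ler_wpM2l.
- move=> x xab; have /andP[ax _] := xab.
  have d1 := is_derive_powR_shift p ax; have d2 := cut_d H xab.
  have d1' := is_derive_powR_shift (p - 1) ax; have d2' := cut_d1 H xab.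
  have pE : p - 1 - 1 = p - 2 by lra.
  rewrite pE in d1'.
  have d3 := is_derive_co x; have d4 := is_derive_si x.
  by apply: is_derive_eq; rewrite /GRing.scale/= /f2; field; rewrite gt_eqF.
- rewrite -[X in _ --> X]addr0; apply: cvgD.
    rewrite -[X in _ --> X](mulr0 N^-1); apply: cvgMr.
    apply: (@powM_cvg0 p 1 _ (M * N)); first by lra.
    exact: cut_si_bound.
  rewrite -[X in _ --> X](mulr0 (N ^- 2)); apply: cvgMr.
  rewrite -[X in _ --> X](subrr 0); apply: cvgB.
    by apply: near_cut_left => x /h1_zero ->; rewrite mulr0 mul0r.
  rewrite -[X in _ --> X](mulr0 p); apply: cvgMr.
  apply: (@powM_cvg0 (p - 1) 2 _ (M * N ^+ 2)); first by lra.
  exact: cut_omc_bound.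
- apply: cvg_eq0_near; apply: filterS (cut_right H) => x [h0 h10].
  by rewrite h0 h10 !mul0r !mulr0 !mul0r subrr mulr0 addr0.
Qed.

(** For p >= 0 the boundary term of - cos survives exactly when p = 0; the limit l
    of (x - a)^p records it. *)
Lemma si_co p (l : R) : 0 <= p -> p < 1 ->
  (x - a) `^ p @[x --> a^'+] --> l ->
  sing a b (fun x => p * ((x - a) `^ (p - 1) * (h x * co x))) ->
  `|(\int[mu]_(x in `]a, b[) ((x - a) `^ p * (h x * si x)))%R -
    N ^- 1 * (\int[mu]_(x in `]a, b[) (p * ((x - a) `^ (p - 1) * (h x * co x))))%R
    - N^-1 * l|
  <= N ^- 2 * (`|p| * K (p - 1) + K p) * (b - a).
Proof.
move=> p1 p2 pl sB.
pose f2 x := N ^- 2 * ((p * ((x - a) `^ (p - 1) * h1 x) + (x - a) `^ p * h2 x) * si x).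
have sA : sing a b (fun x => (x - a) `^ p * (h x * si x)) by apply: sing_si; lra.
have sB1 := singZ (- N ^- 1) sB.
have Ni : 0 <= N ^- 2 by rewrite invr_ge0 sqr_ge0.
set D := (X in _ <= X * _).
have pK := mulr_ge0 (normr_ge0 p) (K0 (p - 1)).
have D0 : 0 <= D by apply: mulr_ge0 => //; have := K0 p; lra.
rewrite -[X in `|_ + X - _|]mulNr -(RintegralZ_sing (- N ^- 1) sB).
rewrite -(RintegralD_sing sA sB1).
have -> : N^-1 * l = 0 - (- N^-1 * (l * 1 * 1) + N^-2 * 0) by ring.
apply: (@FTC_approx (fun x => - N^-1 * ((x - a) `^ p * h x * co x) +
   N ^- 2 * ((x - a) `^ p * h1 x * si x))
   _ f2 _ _ _ _ _ ab D0).
- exact: singD.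
- move=> x xab; have /andP[ax _] := xab.
  have cc : {for x, continuous si} by exact: is_derive_continuous (is_derive_si x).
  have c1 r : {for x, continuous (fun x => (x - a) `^ r * h1 x)}.
    by apply: cvgM; [exact: powR_shift_continuous|exact: cutoff1_continuous].
  have c2 r : {for x, continuous (fun x => (x - a) `^ r * h2 x)}.
    by apply: cvgM; [exact: powR_shift_continuous|exact: cut_c2 H _ xab].
  apply: cvgM; first exact: cvg_cst.
  apply: cvgM; last exact: cc.
  by apply: cvgD; [apply: cvgM; [exact: cvg_cst|exact: c1]|exact: c2].
- move=> x xab; rewrite /f2 normrM (ger0_norm Ni) ler_wpM2l//.
  have k1 := powR_away_bound (p - 1) (cut_M H) h1_zero h1_bound xab.
  have k2 := powR_away_bound p (cut_M H) h2_zero h2_bound xab.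
  rewrite normrM -[X in _ <= X]mulr1 ler_pM ?sin_max//.
  apply: (le_trans (ler_normD _ _)); apply: lerD => //.
  by rewrite normrM ler_wpM2l.
- move=> x xab; have /andP[ax _] := xab.
  have d1 := is_derive_powR_shift p ax; have d2 := cut_d H xab.
  have d2' := cut_d1 H xab.
  have d3 := is_derive_co x; have d4 := is_derive_si x.
  by apply: is_derive_eq; rewrite /GRing.scale/= /f2; field; rewrite gt_eqF.
- apply: cvgD; apply: cvgMr; last first.
    by apply: near_cut_left => x /h1_zero ->; rewrite mulr0 mul0r.
  apply: cvgM; first apply: cvgM; first exact: pl.
    by apply: near_cut_left => x /(cut_left H)[].
  have -> : 1 = co a by rewrite /co subrr mulr0 cos0.
  apply: cvg_at_right_filter.
  exact: is_derive_continuous (is_derive_co a).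
- apply: cvg_eq0_near; apply: filterS (cut_right H) => x [h0 h10].
  by rewrite h0 h10 !mulr0 !mul0r !mulr0 addr0.
Qed.
End Trig.
End Cutoff.

(** * Trigonometric integrals of a cut-off power *)
Section CoefAsymptotics.
Context {R : realType}.
Implicit Types (p x r C : R).
Notation mu := (@lebesgue_measure R).

Definition cos_int (a b p : R) (h : R -> R) (N : R) : R :=
  (\int[mu]_(x in `]a, b[) ((x - a) `^ p * (h x * cos (N * (x - a)))))%R.

Definition sin_int (a b p : R) (h : R -> R) (N : R) : R :=
  (\int[mu]_(x in `]a, b[) ((x - a) `^ p * (h x * sin (N * (x - a)))))%R.

Definition omc_int (a b p : R) (h : R -> R) (N : R) : R :=
  (\int[mu]_(x in `]a, b[) ((x - a) `^ p * (h x * (1 - cos (N * (x - a))))))%R.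

(** The finite part of the integral of (x - a)^p h for p < -1: one integration by
    parts, with the divergent boundary term dropped. *)
Definition fp_int (a b p : R) (h1 : R -> R) : R :=
  - ((\int[mu]_(x in `]a, b[) ((x - a) `^ (p + 1) * h1 x))%R / (p + 1)).

(** cos is 1 minus 1 - cos, and the second part converges for p > -3. *)
Definition fp_cos_int (a b p : R) (h h1 : R -> R) (N : R) : R :=
  if -1 < p then cos_int a b p h N
  else fp_int a b p h1 - omc_int a b p h N.

Lemma omc_asymptotics (q : R) : -3 < q -> q < -1 -> exists2 G : R, 0 < G &
  forall a b c h h1 h2 M, cutoff a b c h h1 h2 M ->
  exists2 C : R, 0 <= C & forall N : R, 0 < N ->
    `|omc_int a b q h N - N `^ (- (q + 1)) * G| <= C.
Proof.
move=> q3 q1; have [P [G [G0 dP P0 PG]]] := one_minus_cos_primitive q3 q1.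
exists G => // a b c h h1 h2 M H.
exists (2 * (((c - a) `^ (q + 1) + (b - a) `^ (q + 1)) * M) / (- (q + 1)) * (b - a)).
  have ab : a < b by case: H => ac cb *; exact: lt_trans cb.
  rewrite mulr_ge0 ?subr_ge0 ?(ltW ab)// mulr_ge0 ?invr_ge0 ?oppr_ge0//; last by lra.
  by rewrite mulr_ge0// mulr_ge0 ?(cut_M H)// addr_ge0 ?powR_ge0.
by move=> N N0; exact: (cutoff_one_minus_cos H N0 q3 q1 dP P0 PG).
Qed.

Lemma triangle_bound (x y z e d : R) : `|x - y| <= e -> `|y - z| <= d -> `|x - z| <= e + d.
Proof. by move=> h1 h2; rewrite (le_trans (ler_distD y _ _))// lerD. Qed.

Lemma scale_bound (k x y e : R) : `|x - y| <= e -> `|k * x - k * y| <= `|k| * e.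
Proof. by move=> h; rewrite -mulrBr normrM ler_wpM2l. Qed.

Lemma sin_asymptotics_neg p : -2 < p -> p < 0 -> exists2 B : R, B != 0 &
  forall a b c h h1 h2 M, cutoff a b c h h1 h2 M ->
  exists2 C : R, 0 <= C & forall N : R, 0 < N ->
    `|sin_int a b p h N - B * N `^ (- (p + 1))| <= C * N^-1.
Proof.
move=> p2 p0; have q3 : -3 < p - 1 by lra. have q1 : p - 1 < -1 by lra.
have [G G0 HG] := omc_asymptotics q3 q1; exists (- p * G).
  by rewrite mulf_neq0 ?oppr_eq0 ?(lt_eqF p0) ?(gt_eqF G0).
move=> a b c h h1 h2 M H; have [C C0 HC] := HG _ _ _ _ _ _ _ H.
exists ((((c - a) `^ p + (b - a) `^ p) * M * 2) * (b - a) + `|p| * C).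
  have ab : a < b by case: H => ac cb *; exact: lt_trans cb.
  rewrite addr_ge0 ?mulr_ge0 ?subr_ge0 ?(ltW ab) ?(cut_M H)// ?addr_ge0 ?powR_ge0//.
move=> N N0; have k1 := si_omc H N0 p2 p0; have k2 := HC N N0.
have {k2} k2 := scale_bound (- N^-1 * p) k2.
have NE : N `^ (- (p + 1)) = N^-1 * N `^ (- (p - 1 + 1)).
  by rewrite -(powR_inv1 (ltW N0)); apply: powR_split => //; ring.
have -> : - p * G * N `^ (- (p + 1)) = - N^-1 * p * (N `^ (- (p - 1 + 1)) * G).
  by rewrite NE; ring.
rewrite mulrDl; apply: triangle_bound; last first.
  apply: (le_trans k2).
  have Nn : `|N^-1| = N^-1 by rewrite gtr0_norm ?invr_gt0.
  rewrite normrM normrN Nn; apply: eqW; ring.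
move: k1; rewrite -/(omc_int a b (p - 1) h N) => k1.
have -> : sin_int a b p h N - - N^-1 * p * omc_int a b (p - 1) h N =
  sin_int a b p h N + N^-1 * (p * omc_int a b (p - 1) h N) by ring.
apply: (le_trans k1).
by apply: eqW; ring.
Qed.

Lemma cos_asymptotics_int p : -1 < p -> p < 1 -> exists2 A : R, (p != 0 -> A != 0) &
  forall a b c h h1 h2 M, cutoff a b c h h1 h2 M ->
  exists2 C : R, 0 <= C & forall N : R, 0 < N ->
    `|cos_int a b p h N - A * N `^ (- (p + 1))| <= C * N ^- 2.
Proof.
move=> p1 p2; have q3 : -3 < p - 2 by lra. have q1 : p - 2 < -1 by lra.
have [G G0 HG] := omc_asymptotics q3 q1; exists (p * (p - 1) * G).
  by move=> p0; rewrite !mulf_neq0 ?(gt_eqF G0)// subr_eq0 lt_eqF.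
move=> a b c h h1 h2 M H; have [C C0 HC] := HG _ _ _ _ _ _ _ H.
set K := (`|p| * (((c - a) `^ (p - 1) + (b - a) `^ (p - 1)) * M) * 2
  + (`|p| * (((c - a) `^ (p - 1) + (b - a) `^ (p - 1)) * M)
  + ((c - a) `^ p + (b - a) `^ p) * M)).
exists (K * (b - a) + `|p * (p - 1)| * C).
  have ab : a < b by case: H => ac cb *; exact: lt_trans cb.
  rewrite addr_ge0 ?(mulr_ge0 (normr_ge0 _) C0)// mulr_ge0 ?subr_ge0 ?(ltW ab)//.
  by rewrite /K !addr_ge0 ?mulr_ge0 ?(cut_M H)// ?addr_ge0 ?powR_ge0.
move=> N N0; have k1 := co_omc H N0 p1 p2; have k2 := HC N N0.
have {k2} k2 := scale_bound (N ^- 2 * (p * (p - 1))) k2.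
have NE : N `^ (- (p + 1)) = N ^- 2 * N `^ (- (p - 2 + 1)).
  by rewrite -(powR_invn _ (ltW N0)); apply: powR_split => //; ring.
have -> : p * (p - 1) * G * N `^ (- (p + 1)) = N ^- 2 * (p * (p - 1)) * (N `^ (- (p - 2 + 1)) * G).
  by rewrite NE; ring.
rewrite mulrDl; apply: triangle_bound; last first.
  apply: (le_trans k2).
  rewrite normrM [`|N ^- 2|]ger0_norm ?invr_ge0 ?sqr_ge0//.
  by apply: eqW; ring.
rewrite -mulrA; apply: (le_trans k1).
by apply: eqW; rewrite /K; ring.
Qed.

Lemma sin_asymptotics0 a b c h h1 h2 M : cutoff a b c h h1 h2 M ->
  exists2 C : R, 0 <= C & forall N : R, 0 < N ->
    `|sin_int a b 0 h N - 1 * N `^ (- (0 + 1))| <= C * N ^- 2.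
Proof.
move=> H; have ab : a < b by case: H => ac cb *; exact: lt_trans cb.
exists ((((c - a) `^ 0 + (b - a) `^ 0) * M) * (b - a)).
  by rewrite !mulr_ge0 ?subr_ge0 ?(ltW ab) ?(cut_M H) ?addr_ge0 ?powR_ge0.
move=> N N0.
have l0 : (x - a) `^ 0 @[x --> a^'+] --> (1 : R).
  by apply: cvg_near_cst; apply: nearW => x; rewrite powRr0.
have E0 : (fun x => 0 * ((x - a) `^ (0 - 1) * (h x * cos (N * (x - a))))) = cst 0 :> (R -> R).
  by apply/funext => x; rewrite mul0r.
have s0 : sing a b (fun x => 0 * ((x - a) `^ (0 - 1) * (h x * cos (N * (x - a))))).
  by rewrite E0; apply: (@sing_bounded _ _ _ _ 0) => // x _; [exact: cvg_cst|rewrite normr0].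
have := si_co H N0 (lexx 0) ltr01 l0 s0.
rewrite E0 Rintegral_cst// mul0r mulr0 subr0 normr0 mul0r add0r mulr1.
rewrite add0r powR_inv1 ?(ltW N0)// mul1r => k.
by apply: (le_trans k); apply: eqW; ring.
Qed.

(** Integrating by parts turns the sine integral into the cosine integral of
    exponent p - 1, without a boundary term. *)
Lemma sin_asymptotics_pos p : 0 < p -> p < 1 -> exists B : R,
  forall a b c h h1 h2 M, cutoff a b c h h1 h2 M ->
  exists2 C : R, 0 <= C & forall N : R, 1 <= N ->
    `|sin_int a b p h N - B * N `^ (- (p + 1))| <= C * N ^- 2.
Proof.
move=> p0 p1; have q3 : -1 < p - 1 by lra. have q1 : p - 1 < 1 by lra.
have [A _ HA] := cos_asymptotics_int q3 q1; exists (p * A).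
move=> a b c h h1 h2 M H; have [C C0 HC] := HA _ _ _ _ _ _ _ H.
set K := (`|p| * (((c - a) `^ (p - 1) + (b - a) `^ (p - 1)) * M)
  + ((c - a) `^ p + (b - a) `^ p) * M).
have ab : a < b by case: H => ac cb *; exact: lt_trans cb.
exists (K * (b - a) + `|p| * C).
  rewrite addr_ge0 ?(mulr_ge0 (normr_ge0 _) C0)// mulr_ge0 ?subr_ge0 ?(ltW ab)//.
  by rewrite /K !addr_ge0 ?mulr_ge0 ?(cut_M H)// ?addr_ge0 ?powR_ge0.
move=> N N1; have N0 : 0 < N by lra.
have sB := sing_co H N q3.
have := si_co H N0 (ltW p0) p1 (@powR_shift_cvg0 _ a _ p0) (singZ p sB).
rewrite mulr0 subr0 (RintegralZ_sing p sB) -/(cos_int a b (p - 1) h N) => k1.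
have k2 := scale_bound (N^-1 * p) (HC N N0).
have NE : N `^ (- (p + 1)) = N^-1 * N `^ (- (p - 1 + 1)).
  by rewrite -(powR_inv1 (ltW N0)); apply: powR_split => //; ring.
have -> : p * A * N `^ (- (p + 1)) = N^-1 * p * (A * N `^ (- (p - 1 + 1))).
  by rewrite NE; ring.
rewrite mulrDl; apply: triangle_bound; last first.
  apply: (le_trans k2); rewrite normrM gtr0_norm ?invr_gt0//.
  have -> : N^-1 * `|p| * (C * N ^- 2) = (`|p| * C * N ^- 2) * N^-1 by ring.
  rewrite ler_piMr ?invf_le1// mulr_ge0 ?invr_ge0 ?sqr_ge0//.
  exact: mulr_ge0.
rewrite -mulrA; apply: (le_trans k1).
by apply: eqW; rewrite /K; ring.
Qed.

(** The sine integral has a nonzero leading term for p <= 0, the cosine integral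
    for p > 0, so one of the two is always available. *)
Theorem coef_asymptotics p : - (3 / 2) <= p <= 1 / 2 -> p != -1 ->
  exists A B d : R, [/\ A != 0 \/ B != 0, 0 < d <= 1 &
  forall a b c h h1 h2 M, cutoff a b c h h1 h2 M ->
  exists2 C : R, 0 <= C & forall N : R, 1 <= N ->
    `|fp_cos_int a b p h h1 N - A * N `^ (- (p + 1))| <= C * N `^ (- (p + 1) - d) /\
    `|sin_int a b p h N - B * N `^ (- (p + 1))| <= C * N `^ (- (p + 1) - d)].
Proof.
move=> /andP[plo phi] pN1.
have Nmono (N u v : R) : 1 <= N -> u <= v -> N `^ u <= N `^ v by move=> N1; exact: ler_powR.
have [pm1|pm1|E] := ltgtP p (-1); last by rewrite E eqxx in pN1.
- have q3 : -3 < p by lra.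
  have [G G0 HG] := omc_asymptotics q3 pm1.
  have p2 : -2 < p by lra.
  have pneg : p < 0 by lra.
  have [B B0 HB] := sin_asymptotics_neg p2 pneg.
  exists (- G), B, (- (p + 1)); split; [by right|by lra|].
  move=> a b c h h1 h2 M H.
  have [C1 C10 HC1] := HG _ _ _ _ _ _ _ H.
  have [C2 C20 HC2] := HB _ _ _ _ _ _ _ H.
  exists (`|fp_int a b p h1| + C1 + C2); first by rewrite !addr_ge0.
  move=> N N1; have N0 : 0 < N by lra.
  rewrite subrr powRr0 mulr1 /fp_cos_int ltNge (ltW pm1)/=; split.
    have := HC1 N N0; set u := omc_int _ _ _ _ _; set v := _ * G => k.
    have -> : fp_int a b p h1 - u - - G * N `^ (- (p + 1)) = fp_int a b p h1 - (u - v).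
      by rewrite /v; ring.
    apply: (le_trans (ler_normB _ _)); lra.
  apply: (le_trans (HC2 N N0)).
  have := normr_ge0 (fp_int a b p h1).
  have : C2 * N^-1 <= C2 by rewrite ler_piMr// invf_le1.
  lra.
have N2 (N : R) : 1 <= N -> N ^- 2 = N `^ (-2) by move=> N1; rewrite powR_invn//; lra.
have Ni (N : R) : 1 <= N -> N^-1 = N `^ (-1) by move=> N1; rewrite powR_inv1//; lra.
have plt1 : p < 1 by lra.
have [A A0 HA] := cos_asymptotics_int pm1 plt1.
have [p0|p0|p0] := ltgtP p 0.
- have p2 : -2 < p by lra.
  have [B B0 HB] := sin_asymptotics_neg p2 p0.
  exists A, B, (- p); split; [by right|by lra|].
  move=> a b c h h1 h2 M H.
  have [C1 C10 HC1] := HA _ _ _ _ _ _ _ H.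
  have [C2 C20 HC2] := HB _ _ _ _ _ _ _ H.
  exists (C1 + C2); first by rewrite addr_ge0.
  move=> N N1; have N0 : 0 < N by lra.
  have -> : - (p + 1) - - p = -1 by ring.
  rewrite /fp_cos_int pm1; split.
    apply: (le_trans (HC1 N N0)); rewrite N2//.
    by apply: ler_pM => //; [exact: powR_ge0|rewrite lerDl|apply: Nmono => //; lra].
  apply: (le_trans (HC2 N N0)); rewrite Ni//.
  by rewrite ler_wpM2r ?powR_ge0// lerDr.
- have [B HB] := sin_asymptotics_pos p0 plt1.
  exists A, B, (1 - p); split; [by left; apply: A0; rewrite gt_eqF|by lra|].
  move=> a b c h h1 h2 M H.
  have [C1 C10 HC1] := HA _ _ _ _ _ _ _ H.
  have [C2 C20 HC2] := HB _ _ _ _ _ _ _ H.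
  exists (C1 + C2); first by rewrite addr_ge0.
  move=> N N1; have N0 : 0 < N by lra.
  have -> : - (p + 1) - (1 - p) = -2 by ring.
  rewrite /fp_cos_int pm1 -N2//; split.
    apply: (le_trans (HC1 N N0)).
    by rewrite ler_wpM2r ?invr_ge0 ?sqr_ge0// lerDl.
  apply: (le_trans (HC2 N N1)).
  by rewrite ler_wpM2r ?invr_ge0 ?sqr_ge0// lerDr.
- exists A, 1, 1; split; [by right; exact: oner_neq0|by lra|].
  move=> a b c h h1 h2 M H.
  have [C1 C10 HC1] := HA _ _ _ _ _ _ _ H.
  have [C2 C20 HC2] := sin_asymptotics0 H.
  exists (C1 + C2); first by rewrite addr_ge0.
  move=> N N1; have N0 : 0 < N by lra.
  have -> : - (p + 1) - 1 = -2 by rewrite p0; ring.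
  rewrite /fp_cos_int pm1 -N2//; split.
    apply: (le_trans (HC1 N N0)).
    by rewrite ler_wpM2r ?invr_ge0 ?sqr_ge0// lerDl.
  rewrite p0; apply: (le_trans (HC2 N N0)).
  by rewrite ler_wpM2r ?invr_ge0 ?sqr_ge0// lerDr.
Qed.
End CoefAsymptotics.

(** * Riemann sums of the kernel profile *)
Section Sums.
Context {R : realType}.
Implicit Types (e x y h t C : R).

(** Comparison of each term with the integral over the preceding unit interval. *)
Lemma zeta_bound t N : 1 < t ->
  \sum_(1 <= n < N) (n%:R : R) `^ (- t) <= 1 + (t - 1)^-1.
Proof.
move=> t1; have t10 : 0 < t - 1 by rewrite subr_gt0.
have pos : 0 <= (t - 1)^-1 by rewrite invr_ge0 ltW.
suff main : forall m, \sum_(1 <= n < m.+2) (n%:R : R) `^ (- t) <=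
    1 + (t - 1)^-1 - (m.+1%:R) `^ (1 - t) / (t - 1).
  case: N => [|[|m]].
  - by rewrite big_geq// addr_ge0.
  - by rewrite big_geq// addr_ge0.
  apply: (le_trans (main m)).
  by rewrite lerBlDr lerDl divr_ge0 ?powR_ge0 ?ltW.
elim=> [|m IH].
  by rewrite big_nat1 !powR1 mul1r addrK.
rewrite big_nat_recr//=.
have m0 : 0 < m.+1%:R :> R by rewrite ltr0n.
have mm : m.+1%:R <= m.+2%:R :> R by rewrite ler_nat.
pose F (x : R) := - (x `^ (1 - t) / (t - 1)).
have dF x : m.+1%:R <= x <= m.+2%:R -> is_derive x 1 F (x `^ (- t)).
  move=> /andP[mx _]; have x0 := lt_le_trans m0 mx.
  have d := is_derive1_powR (1 - t) x0.
  apply: is_derive_eq; rewrite /GRing.scale/=.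
  have -> : 1 - t - 1 = - t by ring.
  by field; rewrite gt_eqF.
have dG x : m.+1%:R <= x <= m.+2%:R ->
    is_derive x 1 (fun x => m.+2%:R `^ (- t) * x) (m.+2%:R `^ (- t)).
  by move=> _; apply: is_derive_eq; rewrite /GRing.scale/=; ring.
have le x : m.+1%:R <= x <= m.+2%:R -> m.+2%:R `^ (- t) <= x `^ (- t).
  move=> /andP[mx xm]; apply: le0_ler_powR => //; first by lra.
  exact: lt_le_trans mx.
have := le_of_derive_le mm dG dF le.
rewrite -mulrBr -natrB// subSnn mulr1 /F => k.
apply: (le_trans (lerD IH k)); lra.
Qed.

Lemma sum_from1 (u : nat -> R) N :
  \sum_(1 <= n < N) u n = series (fun n => if n is 0 then 0 else u n) N.
Proof.
rewrite /series/=; case: N => [|N]; first by rewrite !big_geq.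
rewrite [RHS]big_nat_recl// add0r big_add1/=.
by [].
Qed.

Lemma is_cvg_sum_from1 (u : nat -> R) t C : 1 < t ->
  (forall n, (0 < n)%N -> `|u n| <= C * n%:R `^ (- t)) ->
  cvgn (fun N => \sum_(1 <= n < N) u n).
Proof.
move=> t1 uC.
have C0 : 0 <= C.
  by have := uC 1%N isT; rewrite powR1 mulr1; apply: le_trans.
rewrite (_ : (fun N => _) = series (fun n => if n is 0 then 0 else u n)); last first.
  by apply/funext => N; rewrite sum_from1.
apply: normed_cvg; apply: nondecreasing_is_cvgn.
  apply/nondecreasing_seqP => n /=; rewrite /series/=.
  by rewrite [X in _ <= X]big_nat_recr//= lerDl.
exists (C * (1 + (t - 1)^-1)) => _ [N _ <-].
rewrite /=.
have -> : (fun n => `|if n is 0 then 0 else u n|) = (fun n => if n is 0 then 0 else `|u n|).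
  by apply/funext => -[|n]//; rewrite normr0.
rewrite -(sum_from1 (fun n => `|u n|)).
apply: (@le_trans _ _ (C * \sum_(1 <= n < N) (n%:R : R) `^ (- t))).
  rewrite mulr_sumr big_nat_cond [X in _ <= X]big_nat_cond.
  by apply: ler_sum => n /andP[/andP[n1 _] _]; exact: uC.
by rewrite ler_wpM2l// zeta_bound.
Qed.

Section Profile.
Variables (e : R) (e1 : -1 < e) (e3 : e < 3).
Local Ltac elra := move: (e1) (e3) => ? ?; lra.

(** With y = h n, this is what n^-2q z/(1 + z^2) or n^-2q z^3/(1 + z^2) becomes at
    z = y^2, with e = 2 - 2q or e = 6 - 2q.  It behaves like y^e at 0 and like
    y^(e-4) at infinity, whence the range of e. *)
Definition profile y := y `^ e / (1 + y ^+ 4).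

Let den_gt0 y : 0 < 1 + y ^+ 4 :> R.
Proof. by rewrite ltr_pwDl// (exprM y 2 2) sqr_ge0. Qed.

Lemma profile_ge0 y : 0 <= profile y.
Proof. by rewrite divr_ge0 ?powR_ge0 ?(ltW (den_gt0 _)). Qed.

Let powR_le_den x y : 0 < y -> 0 <= x <= 4 -> y `^ x <= 1 + y ^+ 4.
Proof.
move=> y0 /andP[x0 x4]; have [y1|y1] := leP y 1.
  apply: (@le_trans _ _ 1); last by rewrite lerDl exprn_ge0// ltW.
  apply: (@le_trans _ _ (1 `^ x)); last by rewrite powR1.
  by apply: ge0_ler_powR => //; rewrite nnegrE ltW.
apply: (@le_trans _ _ (y ^+ 4)); last by elra.
by rewrite -(@powR_mulrn _ y 4 (ltW y0)); apply: ler_powR => //; exact: ltW.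
Qed.

Let div_den_le r x y : 0 < y -> 0 <= x <= 4 -> y `^ r / (1 + y ^+ 4) <= y `^ (r - x).
Proof.
move=> y0 hx; rewrite ler_pdivrMr ?den_gt0//.
have -> : y `^ r = y `^ (r - x) * y `^ x by apply: powR_split => //; ring.
by rewrite ler_wpM2l ?powR_ge0// powR_le_den.
Qed.

Lemma profile_le x y : 0 < y -> 0 <= x <= 4 -> profile y <= y `^ (e - x).
Proof. exact: div_den_le. Qed.

Definition dprofile y := e * (y `^ (e - 1) / (1 + y ^+ 4))
  - 4 * (y `^ (e - 1) / (1 + y ^+ 4)) * (y ^+ 4 / (1 + y ^+ 4)).

Lemma is_derive_profile y : 0 < y -> is_derive y 1 profile (dprofile y).
Proof.
move=> y0; have d := is_derive1_powR e y0.
have d4 : is_derive y 1 (fun y => 1 + y ^+ 4 : R) (4 * y ^+ 3).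
  by apply: is_derive_eq; rewrite /GRing.scale/=; ring.
have dn : 1 + y ^+ 4 != 0 by rewrite gt_eqF ?den_gt0.
have di := @is_deriveV _ (fun y => 1 + y ^+ 4 : R) _ _ _ dn d4.
apply: is_derive_eq; rewrite /GRing.scale/= /dprofile.
have -> : y `^ e = y * y `^ (e - 1).
  by rewrite -{2}(powRr1 (ltW y0)); apply: powR_split => //; ring.
by field.
Qed.

Lemma dprofile_le x y : 0 < y -> 0 <= x <= 4 ->
  `|dprofile y| <= (`|e| + 4) * y `^ (e - 1 - x).
Proof.
move=> y0 hx; have k := div_den_le (e - 1) y0 hx.
have k0 : 0 <= y `^ (e - 1) / (1 + y ^+ 4) by rewrite divr_ge0 ?powR_ge0 ?(ltW (den_gt0 _)).
have k1 : 0 <= y ^+ 4 / (1 + y ^+ 4) <= 1.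
  rewrite divr_ge0 ?exprn_ge0 ?(ltW y0) ?(ltW (den_gt0 _))//=.
  by rewrite ler_pdivrMr ?den_gt0// mul1r lerDr.
have /andP[k10 k11] := k1.
rewrite /dprofile [X in _ <= X]mulrDl; apply: (le_trans (ler_normB _ _)); apply: lerD.
  by rewrite normrM ler_wpM2l// ger0_norm.
have k4 := mulr_ge0 (ler0n R 4) k0.
rewrite (ger0_norm (mulr_ge0 k4 k10)) -[X in _ <= X]mulr1.
by apply: ler_pM => //; rewrite ler_wpM2l.
Qed.

Lemma profile_var x h n y : 0 < h -> (0 < n)%N -> 0 <= x <= 4 -> e - 1 - x <= 0 ->
  h * n%:R <= y <= h * n.+1%:R ->
  `|profile y - profile (h * n%:R)| <= (`|e| + 4) * (h * n%:R) `^ (e - 1 - x) * h.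
Proof.
move=> h0 n0 hx ex /andP[hy yh].
have hn : 0 < h * n%:R by rewrite mulr_gt0 ?ltr0n.
have [||z] := @MVT_segment _ profile dprofile _ _ hy.
- by move=> z; rewrite in_itv/= => /andP[z1 _]; apply: is_derive_profile; exact: lt_trans z1.
- apply: continuous_in_within => z /andP[z1 _].
  by apply: is_derive_continuous (is_derive_profile _); exact: lt_le_trans z1.
rewrite in_itv/= => /andP[z1 z2] ->; have z0 := lt_le_trans hn z1.
rewrite normrM; apply: ler_pM => //.
  apply: (le_trans (dprofile_le z0 hx)); rewrite ler_wpM2l ?addr_ge0//.
  exact: le0_ler_powR.
rewrite ger0_norm ?subr_ge0//.
move: yh; rewrite -natr1 mulrDr mulr1; elra.
Qed.

(* Any bound y^(e-x) with x in ]e, e + 1[ would make the sums below converge with a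
   gain h^(e+1-x); this x is in that range for every e in ]-1, 3[. *)
Let x := 3 / 4 * (e + 1).
Let hx : 0 <= x <= 4. Proof. by rewrite /x; elra. Qed.
Let nu := (e + 1) / 4.

Lemma variation_sum h N : 0 < h ->
  h * \sum_(1 <= n < N) ((`|e| + 4) * (h * n%:R) `^ (e - 1 - x) * h) <=
  (`|e| + 4) * (1 + (x - e)^-1) * h `^ nu.
Proof.
move=> h0.
have -> : h * \sum_(1 <= n < N) ((`|e| + 4) * (h * n%:R) `^ (e - 1 - x) * h) =
   (`|e| + 4) * h `^ nu * \sum_(1 <= n < N) n%:R `^ (- (1 + x - e)).
  rewrite !mulr_sumr big_nat_cond [RHS]big_nat_cond; apply: eq_bigr => n /andP[/andP[n1 _] _].
  have -> : - (1 + x - e) = e - 1 - x by ring.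
  rewrite powRM ?ler0n ?(ltW h0)//.
  have -> : h `^ nu = h * (h * h `^ (e - 1 - x)).
    have -> : h `^ nu = h `^ 2 * h `^ (e - 1 - x).
      by apply: powR_split => //; rewrite /nu /x; field.
    by rewrite (@powR_mulrn _ h 2 (ltW h0)) expr2 mulrA.
  by ring.
rewrite -mulrA [X in _ <= X]mulrAC -[X in _ <= X]mulrA ler_wpM2l ?addr_ge0//.
rewrite ler_wpM2l ?powR_ge0//.
have xe : 1 < 1 + x - e by rewrite /x; elra.
apply: (le_trans (zeta_bound N xe)).
by have -> : 1 + x - e - 1 = x - e by ring.
Qed.

(** The sum is compared cell by cell with the increments of a primitive, the error
    being the total variation of the profile, and the first cell is O(h^(e+1)). *)
Lemma exists_profile_integral : exists2 I : R, 0 < I &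
  exists2 C : R, 0 <= C & forall h, 0 < h -> h <= 1 ->
  \forall N \near \oo, `|h * \sum_(1 <= n < N) profile (h * n%:R) - I| <= C * h `^ nu.
Proof.
have e4 : e - 4 < -1 by elra.
have cp y : 0 < y -> {for y, continuous profile}.
  by move=> /is_derive_profile/is_derive_continuous.
have p0 y : 0 < y -> 0 <= profile y by move=> _; exact: profile_ge0.
have pe y : 0 < y -> profile y <= 1 * y `^ e.
  by move=> y0; rewrite mul1r -[X in _ `^ X]subr0 profile_le// lexx ler0n.
have pe4 y : 0 < y -> profile y <= 1 * y `^ (e - 4).
  by move=> y0; rewrite mul1r profile_le// lexx ler0n.
have [P [G [dP P0 Pinc PG]]] := half_line_primitive ler01 e4 e1 cp p0 pe pe4.
have G0 : 0 < G.
  have h12 : (1 : R) <= 2 by elra.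
  have [||c0] := @MVT_segment _ P profile 1 2 h12.
  - by move=> z; rewrite in_itv/= => /andP[z1 _]; apply: dP; elra.
  - by apply: continuous_in_within => z /andP[z1 _]; apply: is_derive_continuous (dP _ _); elra.
  rewrite in_itv/= => /andP[c1 c2] E.
  have c00 : 0 < c0 by elra.
  have h1 : 0 <= P 1 by case/andP: (P0 1 ltr01).
  have h2 : 0 <= G - P 2 by case/andP: (PG 2 (ltr0n R 2)).
  have : 0 < profile c0 * (2 - 1) by rewrite mulr_gt0 ?divr_gt0 ?den_gt0 ?powR_gt0//; elra.
  by rewrite -E; elra.
exists G => //.
exists ((`|e| + 4) * (1 + (x - e)^-1) + (e + 1)^-1 + 1).
  rewrite !addr_ge0// ?mulr_ge0 ?addr_ge0 ?invr_ge0//; rewrite /x; elra.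
move=> h h0 h1.
have hnu : 0 < h `^ nu by rewrite powR_gt0.
have cell n : (0 < n)%N ->
    `|h * profile (h * n%:R) - (P (h * n.+1%:R) - P (h * n%:R))| <=
    h * ((`|e| + 4) * (h * n%:R) `^ (e - 1 - x) * h).
  move=> n0; have hn : 0 < h * n%:R by rewrite mulr_gt0 ?ltr0n.
  have hh : h * n%:R <= h * n.+1%:R by rewrite ler_wpM2l ?(ltW h0)// ler_nat.
  have [||z] := @MVT_segment _ P profile _ _ hh.
  - by move=> z; rewrite in_itv/= => /andP[z1 _]; apply: dP; exact: lt_trans z1.
  - apply: continuous_in_within => z /andP[z1 _].
    by apply: is_derive_continuous (dP _ _); exact: lt_le_trans z1.
  rewrite in_itv/= => zh ->.
  have -> : h * n.+1%:R - h * n%:R = h by rewrite -natr1; ring.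
  rewrite mulrC -mulrBl normrM (gtr0_norm h0) mulrC ler_wpM2l ?(ltW h0)//.
  rewrite distrC; apply: profile_var => //; rewrite /x; elra.
have riem N : (0 < N)%N ->
   `|h * \sum_(1 <= n < N) profile (h * n%:R) - (P (h * N%:R) - P h)| <=
   (`|e| + 4) * (1 + (x - e)^-1) * h `^ nu.
  move=> N0.
  have -> : P h = P (h * 1%:R) by rewrite mulr1.
  rewrite -(telescope_sumr (fun n => P (h * n%:R)) N0) mulr_sumr -sumrB.
  apply: (le_trans _ (variation_sum N h0)); rewrite mulr_sumr.
  apply: (le_trans (ler_norm_sum _ _ _)).
  rewrite big_nat_cond [X in _ <= X]big_nat_cond.
  by apply: ler_sum => n /andP[/andP[n1 _] _]; exact: cell.
have Ph : 0 <= P h <= (e + 1)^-1 * h `^ nu.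
  have /andP[-> k] /= := P0 h h0; apply: (le_trans k).
  rewrite mul1r mulrC ler_wpM2l ?invr_ge0//; first by elra.
  by apply: ger_powR; [rewrite h0 h1|rewrite /nu; elra].
have e30 : 0 < 3 - e by elra.
have tail : \forall N \near \oo, G - P (h * N%:R) <= h `^ nu.
  pose A := ((h `^ nu * (3 - e)) `^ (- (3 - e)^-1)) / h.
  near=> N.
  have NA : A < N%:R by near: N; exact: nbhs_infty_gtr.
  have A0 : 0 < A by rewrite divr_gt0 ?powR_gt0 ?mulr_gt0.
  have hN : 0 < h * N%:R by rewrite mulr_gt0// (lt_trans A0).
  have /andP[_ k] := PG _ hN; apply: (le_trans k).
  rewrite mul1r; have -> : - (e - 4 + 1) = 3 - e by ring.
  rewrite ler_pdivrMr//.
  have -> : h `^ nu * (3 - e) =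
     ((h `^ nu * (3 - e)) `^ (- (3 - e)^-1)) `^ (- (3 - e)).
    rewrite -powRrM mulrNN mulVf ?gt_eqF// powRr1//.
    by rewrite mulr_ge0 ?ltW.
  have -> : e - 4 + 1 = - (3 - e) by ring.
  apply: le0_ler_powR; first by elra.
    by rewrite powR_gt0 ?mulr_gt0.
  by rewrite (mulrC h) -ler_pdivrMr//; exact: ltW.
near=> N.
have N0 : (0 < N)%N by near: N; exact: nbhs_infty_gt.
have t1 : G - P (h * N%:R) <= h `^ nu by near: N.
have hN : 0 < h * N%:R by rewrite mulr_gt0 ?ltr0n.
have /andP[t0 _] := PG _ hN.
have := riem N N0; have /andP[Ph0 Ph1] := Ph.
rewrite !ler_norml => /andP[k1 k2]; rewrite mulrDl mulrDl mul1r; elra.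
Unshelve. all: by end_near. Qed.

(** Summation by parts: a bounded telescoping factor moves its differences onto the
    profile, whose total variation is small after multiplication by h. *)
Lemma abel_bound (d : nat -> R) D h N : 0 < h -> h <= 1 -> (0 < N)%N ->
  (forall n, `|d n| <= D) ->
  `|h * \sum_(1 <= n < N) ((d n.+1 - d n) * profile (h * n%:R))| <=
  D * (2 + (`|e| + 4) * (1 + (x - e)^-1)) * h `^ nu.
Proof.
move=> h0 h1 N0 dD; have D0 : 0 <= D by apply: le_trans (dD 0%N).
pose f n := profile (h * n%:R).
have -> : \sum_(1 <= n < N) ((d n.+1 - d n) * profile (h * n%:R)) =
    d N * f N - d 1%N * f 1%N - \sum_(1 <= n < N) (d n.+1 * (f n.+1 - f n)).
  rewrite -(telescope_sumr (fun n => d n * f n) N0) -sumrB.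
  by apply: eq_bigr => n _; rewrite /f; ring.
have fN n : (0 < n)%N -> `|h * (d n * f n)| <= D * h `^ nu.
  move=> n0; have hn : 0 < h * n%:R by rewrite mulr_gt0 ?ltr0n.
  rewrite mulrCA normrM ler_pM// normrM (gtr0_norm h0) (ger0_norm (profile_ge0 _)).
  apply: (@le_trans _ _ (h * h `^ (e - x))).
    rewrite ler_wpM2l ?(ltW h0)//; apply: (le_trans (profile_le hn hx)).
    apply: le0_ler_powR => //; first by rewrite /x; elra.
    by rewrite ler_peMr ?(ltW h0)// ler1n.
  rewrite -{1}(powRr1 (ltW h0)) -powRD ?(gt_eqF h0) ?implybT//.
  have -> : 1 + (e - x) = nu by rewrite /x /nu; field.
  exact: lexx.
have s1 : `|h * \sum_(1 <= n < N) (d n.+1 * (f n.+1 - f n))| <=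
    D * ((`|e| + 4) * (1 + (x - e)^-1) * h `^ nu).
  apply: (@le_trans _ _ (D * (h * \sum_(1 <= n < N) ((`|e| + 4) * (h * n%:R) `^ (e - 1 - x) * h)))).
    rewrite normrM (gtr0_norm h0) mulrCA ler_wpM2l ?(ltW h0)// mulr_sumr.
    apply: (le_trans (ler_norm_sum _ _ _)).
    rewrite big_nat_cond [X in _ <= X]big_nat_cond.
    apply: ler_sum => n /andP[/andP[n1 _] _]; rewrite normrM ler_pM//.
    apply: profile_var => //; first by rewrite /x; elra.
    by rewrite lexx andbT ler_wpM2l ?(ltW h0)// ler_nat.
  by rewrite ler_wpM2l// variation_sum.
rewrite !mulrBr; apply: (le_trans (ler_normB _ _)).
have := ler_normB (h * (d N * f N)) (h * (d 1%N * f 1%N)).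
have := fN N N0; have := fN 1%N isT.
rewrite mulrDr mulrDl -mulrA; elra.
Qed.

(** A factor n^-t is absorbed by trading part of the decay of the profile at 0 for
    a power of h. *)
Lemma remainder_bound t : 0 < t -> exists2 m : R, 0 < m & exists2 C : R, 0 <= C &
  forall h N, 0 < h -> h * \sum_(1 <= n < N) (n%:R `^ (- t) * profile (h * n%:R)) <=
  C * h `^ m.
Proof.
move=> t0; pose m := Num.min (t / 2) (e + 1).
have m0 : 0 < m by rewrite lt_min; apply/andP; split; elra.
have mt : m <= t / 2 by rewrite ge_min lexx.
have me : m <= e + 1 by rewrite ge_min lexx orbT.
exists m => //; exists (1 + (t - m)^-1).
  by rewrite addr_ge0// invr_ge0; elra.
move=> h N h0.
have tm : 1 < 1 + t - m by elra.
apply: (@le_trans _ _ (h `^ m * \sum_(1 <= n < N) n%:R `^ (- (1 + t - m)))); last first.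
  rewrite mulrC ler_wpM2r ?powR_ge0//; apply: (le_trans (zeta_bound N tm)).
  by have -> : 1 + t - m - 1 = t - m by ring.
rewrite !mulr_sumr big_nat_cond [X in _ <= X]big_nat_cond.
apply: ler_sum => n /andP[/andP[n1 _] _].
have n0 : 0 < n%:R :> R by rewrite ltr0n.
have hn : 0 < h * n%:R by rewrite mulr_gt0.
have xm : 0 <= e + 1 - m <= 4 by elra.
have := profile_le hn xm; have -> : e - (e + 1 - m) = m - 1 by ring.
move=> k; apply: (@le_trans _ _ (h * (n%:R `^ (- t) * (h * n%:R) `^ (m - 1)))).
  by rewrite ler_wpM2l ?(ltW h0)// ler_wpM2l ?powR_ge0.
rewrite powRM ?(ltW h0) ?(ltW n0)//.
have -> : h `^ m = h * h `^ (m - 1).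
  by rewrite -{2}(powRr1 (ltW h0)); apply: powR_split => //; ring.
have -> : n%:R `^ (- (1 + t - m)) = n%:R `^ (- t) * n%:R `^ (m - 1) :> R.
  by apply: powR_split => //; ring.
by apply: eqW; ring.
Qed.

(** The three effects combined: only the mean of the weights contributes to the
    limit.  T is a function of h since the terms of the kernel are not exactly
    functions of h n. *)
Theorem profile_sum : exists2 I : R, 0 < I &
  forall (bbar : R) (d : nat -> R) (D t C1 : R) (T : R -> nat -> R),
  (forall n, `|d n| <= D) -> 0 < t -> 0 <= C1 ->
  (forall h n, 0 < h -> h <= 1 -> (0 < n)%N ->
    `|T h n - (bbar + (d n.+1 - d n)) * profile (h * n%:R)| <=
    C1 * (n%:R `^ (- t) * profile (h * n%:R))) ->
  exists2 m : R, 0 < m & exists2 C : R, 0 <= C &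
  forall h, 0 < h -> h <= 1 -> \forall N \near \oo,
    `|h * \sum_(1 <= n < N) T h n - bbar * I| <= C * h `^ m.
Proof.
have [I I0 [Ca Ca0 HI]] := exists_profile_integral; exists I => //.
move=> bbar d D t C1 T dD t0 C10 HT.
have D0 : 0 <= D by apply: le_trans (dD 0%N).
have [m m0 [Cb Cb0 Hr]] := remainder_bound t0.
pose Cd := D * (2 + (`|e| + 4) * (1 + (x - e)^-1)).
have Cd0 : 0 <= Cd.
  rewrite mulr_ge0// addr_ge0// mulr_ge0// ?addr_ge0// invr_ge0 /x; elra.
have nu0 : 0 < nu by rewrite /nu; elra.
pose m' := Num.min nu m.
exists m'; first by rewrite lt_min nu0.
exists (`|bbar| * Ca + Cd + C1 * Cb).
  by rewrite !addr_ge0// mulr_ge0.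
move=> h h0 h1.
have hnu : h `^ nu <= h `^ m' by apply: ger_powR; rewrite ?h0// ge_min lexx.
have hm : h `^ m <= h `^ m' by apply: ger_powR; rewrite ?h0// ge_min lexx orbT.
near=> N.
have N0 : (0 < N)%N by near: N; exact: nbhs_infty_gt.
have k1 : `|h * \sum_(1 <= n < N) profile (h * n%:R) - I| <= Ca * h `^ nu.
  by near: N; exact: HI.
have k2 := abel_bound h0 h1 N0 dD.
have k3 : `|h * \sum_(1 <= n < N) (T h n - (bbar + (d n.+1 - d n)) * profile (h * n%:R))|
    <= C1 * (Cb * h `^ m).
  apply: (@le_trans _ _ (C1 * (h * \sum_(1 <= n < N) (n%:R `^ (- t) * profile (h * n%:R))))).
    rewrite normrM (gtr0_norm h0) mulrCA ler_wpM2l ?(ltW h0)// mulr_sumr.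
    apply: (le_trans (ler_norm_sum _ _ _)).
    rewrite big_nat_cond [X in _ <= X]big_nat_cond.
    by apply: ler_sum => n /andP[/andP[n1 _] _]; exact: HT.
  by rewrite ler_wpM2l// Hr.
have E : h * \sum_(1 <= n < N) T h n - bbar * I =
  bbar * (h * \sum_(1 <= n < N) profile (h * n%:R) - I) +
  h * \sum_(1 <= n < N) ((d n.+1 - d n) * profile (h * n%:R)) +
  h * \sum_(1 <= n < N) (T h n - (bbar + (d n.+1 - d n)) * profile (h * n%:R)).
  have -> : \sum_(1 <= n < N) T h n = bbar * \sum_(1 <= n < N) profile (h * n%:R)
    + \sum_(1 <= n < N) ((d n.+1 - d n) * profile (h * n%:R))
    + \sum_(1 <= n < N) (T h n - (bbar + (d n.+1 - d n)) * profile (h * n%:R)).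
    by rewrite mulr_sumr -!big_split/=; apply: eq_bigr => n _; ring.
  by ring.
rewrite E; apply: (le_trans (ler_normD _ _)); rewrite mulrDl; apply: lerD; last first.
  by apply: (le_trans k3); rewrite -mulrA ler_wpM2l// ler_wpM2l.
apply: (le_trans (ler_normD _ _)); rewrite mulrDl; apply: lerD; last first.
  by apply: (le_trans k2); rewrite ler_wpM2l.
rewrite normrM -mulrA ler_wpM2l//; apply: (le_trans k1).
by rewrite ler_wpM2l.
Unshelve. all: by end_near. Qed.
End Profile.
End Sums.

(** * From the coefficients to the kernel sum *)
Section KernelSum.
Context {R : realType}.
Implicit Types (A B C D q x y z : R).

Lemma natr_powR_le1 n (u : R) : (0 < n)%N -> u <= 0 -> n%:R `^ u <= 1 :> R.
Proof.
move=> n0 u0; apply: (@le_trans _ _ (n%:R `^ 0)); last by rewrite powRr0.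
by apply: ler_powR => //; rewrite ler1n.
Qed.

Lemma powR_ratio_le q (K m n : R) : 0 <= q -> 0 < m -> 0 < n -> n <= K * m ->
  m `^ (- q) <= K `^ q * n `^ (- q).
Proof.
move=> q0 m0 n0 nKm; have K0 : 0 < K by rewrite -(pmulr_lgt0 _ m0) (lt_le_trans n0).
have -> : K `^ q * n `^ (- q) = (n / K) `^ (- q).
  by rewrite powRM ?invr_ge0 ?(ltW n0) ?(ltW K0)// -(powR_inv1 (ltW K0)) -powRrM mulN1r opprK mulrC.
apply: le0_ler_powR; first by rewrite oppr_le0.
  by rewrite divr_gt0.
by rewrite ler_pdivrMr// mulrC.
Qed.

(** Shifting the index by k is a lower order perturbation of n^-q. *)
Lemma powR_step q (k m n : R) : 0 <= q -> 0 <= k -> 1 <= m -> 1 <= n ->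
  `|m - n| <= k ->
  `|m `^ (- q) - n `^ (- q)| <= q * k * (1 + k) `^ (q + 1) * n `^ (- (q + 1)).
Proof.
move=> q0 k0 m1 n1 mn.
have q10 : 0 <= q + 1 by lra.
have key u v : 1 <= u -> u <= v -> v - u <= k ->
    `|u `^ (- q) - v `^ (- q)| <= q * k * u `^ (- (q + 1)).
  move=> u1 uv vuk.
  have u0 : 0 < u by lra.
  have d z : u <= z <= v -> is_derive z 1 (fun x => x `^ (- q)) (- q * z `^ (- (q + 1))).
    move=> /andP[uz _]; have z0 := lt_le_trans u0 uz.
    have := is_derive1_powR (- q) z0.
    by have -> : - q - 1 = - (q + 1) by ring.
  have [||c] := @MVT_segment _ (fun x => x `^ (- q)) (fun z => - q * z `^ (- (q + 1))) _ _ uv.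
  - by move=> z; rewrite in_itv/= => /andP[uz zv]; apply: d; rewrite !ltW.
  - by apply: continuous_in_within => z /d/is_derive_continuous.
  rewrite in_itv/= => /andP[uc cv] E.
  rewrite distrC E !normrM normrN (ger0_norm q0) (ger0_norm (powR_ge0 _ _)).
  rewrite [`|v - u|]ger0_norm ?subr_ge0//.
  rewrite -mulrA [X in _ <= X]mulrAC -[X in _ <= X]mulrA ler_wpM2l//.
  by apply: ler_pM; rewrite ?powR_ge0 ?subr_ge0//; apply: le0_ler_powR => //; lra.
have nm : n <= (1 + k) * m.
  have h1 : n - m <= k by apply: le_trans mn; rewrite distrC ler_norm.
  have : k * 1 <= k * m by rewrite ler_wpM2l.
  by rewrite mulrDl mul1r; lra.
have m0 : 0 < m by lra. have n0 : 0 < n by lra.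
have qk : 0 <= q * k by exact: mulr_ge0.
have [mn'|nm'] := leP m n.
  apply: (le_trans (key _ _ m1 mn' _)); first by apply: le_trans mn; rewrite distrC ler_norm.
  by rewrite -[X in _ <= X]mulrA ler_wpM2l// powR_ratio_le.
rewrite distrC; apply: (le_trans (key _ _ n1 (ltW nm') _)).
  by apply: le_trans mn; rewrite ler_norm.
rewrite -[X in _ <= X]mulrA ler_wpM2l// ler_peMl ?powR_ge0//.
by apply: (@le_trans _ _ ((1 + k) `^ 0)); [rewrite powRr0|apply: ler_powR; lra].
Qed.

Section Sequence.
Variables (k : nat) (A B q d C : R) (a : nat -> R).
Hypotheses (k2 : (2 <= k)%N) (q0 : 0 <= q) (d01 : 0 < d <= 1) (C0 : 0 <= C).
Let th : R := pi / k%:R.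
Local Ltac qlra := move: (q0) => ?; lra.
(** The angle th makes a shift of the index by k a half turn. *)
Definition osc (n : nat) : R := A * sin (n%:R * th) + B * cos (n%:R * th).
Hypothesis ha : forall n, (0 < n)%N ->
  `|a n - n%:R `^ (- q) * osc n| <= C * n%:R `^ (- q - d).

Let kn0 : (k%:R : R) != 0.
Proof. by rewrite pnatr_eq0 -lt0n (leq_trans _ k2). Qed.

Lemma osc_shift m n : m = (n + k)%N \/ n = (m + k)%N -> osc m = - osc n.
Proof.
have E j : (j + k)%:R * th = j%:R * th + pi.
  by rewrite natrD mulrDl; congr (_ + _); rewrite /th mulrCA divff// mulr1.
by move=> [->|->]; rewrite /osc E sinDpi cosDpi; ring.
Qed.

Let r : R := `|A| + `|B|.
Lemma osc_bound n : `|osc n| <= r.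
Proof.
apply: (le_trans (ler_normD _ _)); rewrite !normrM.
by apply: lerD; rewrite -[X in _ <= X]mulr1 ler_wpM2l// ?sin_max ?cos_max.
Qed.

Let r0 : 0 <= r. Proof. by rewrite addr_ge0. Qed.

Let ler_n n (u v : R) : (0 < n)%N -> u <= v -> n%:R `^ u <= n%:R `^ v :> R.
Proof. by move=> n0 uv; apply: ler_powR => //; rewrite ler1n. Qed.

Lemma seq_bound n : (0 < n)%N -> `|a n| <= (r + C) * n%:R `^ (- q).
Proof.
move=> n0; have /andP[d0 d1] := d01.
rewrite -(subrK (n%:R `^ (- q) * osc n) (a n)).
apply: (le_trans (ler_normD _ _)); rewrite addrC mulrDl; apply: lerD.
  by rewrite normrM (ger0_norm (powR_ge0 _ _)) mulrC ler_wpM2r ?powR_ge0// osc_bound.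
apply: (le_trans (ha n0)); rewrite ler_wpM2l// ler_n//; qlra.
Qed.

Let Cs := C * (1 + k%:R) `^ (q + d) + q * k%:R * (1 + k%:R) `^ (q + 1) * r.

(** The neighbours at distance k carry the opposite sign. *)
Lemma shifted_bound m n : (0 < m)%N -> (0 < n)%N -> m = (n + k)%N \/ n = (m + k)%N ->
  `|a m + n%:R `^ (- q) * osc n| <= Cs * n%:R `^ (- q - d).
Proof.
move=> m0 n0 mn; have /andP[d0 d1] := d01.
have m1 : 1 <= m%:R :> R by rewrite ler1n.
have n1 : 1 <= n%:R :> R by rewrite ler1n.
have k0 : 0 <= k%:R :> R by rewrite ler0n.
have mnk : `|m%:R - n%:R| <= k%:R :> R.
  case: mn => ->; first by rewrite natrD addrAC subrr add0r ger0_norm.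
  by rewrite distrC natrD addrAC subrr add0r ger0_norm.
have nm : n%:R <= (1 + k%:R) * m%:R :> R.
  have h1 : n%:R - m%:R <= k%:R :> R by apply: le_trans mnk; rewrite distrC ler_norm.
  have : k%:R * 1 <= k%:R * m%:R :> R by rewrite ler_wpM2l.
  by rewrite mulrDl mul1r; qlra.
have h1 := ha m0; rewrite (osc_shift mn) in h1.
have -> : a m + n%:R `^ (- q) * osc n =
  (a m - m%:R `^ (- q) * - osc n) - (m%:R `^ (- q) - n%:R `^ (- q)) * osc n by ring.
apply: (le_trans (ler_normB _ _)); rewrite /Cs [X in _ <= X]mulrDl; apply: lerD.
  apply: (le_trans h1); rewrite -mulrA ler_wpM2l//.
  have -> : - q - d = - (q + d) by ring.
  by apply: powR_ratio_le; qlra.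
rewrite normrM [X in _ <= X]mulrAC; apply: ler_pM => //; last exact: osc_bound.
apply: (le_trans (powR_step q0 k0 m1 n1 mnk)).
rewrite ler_wpM2l ?mulr_ge0 ?powR_ge0// ler_n//; qlra.
Qed.

Let b n := a n * (a (n + k)%N + (if n != k then a `|n%:Z - k%:Z|%N else 0)).

Let Cs0 : 0 <= Cs.
Proof. by rewrite addr_ge0 ?mulr_ge0 ?powR_ge0. Qed.

Let K : R := r + C.
Let K0 : 0 <= K. Proof. exact: addr_ge0. Qed.

(** For n > k both neighbours are given by the asymptotics of the sequence; the
    finitely many n <= k only affect the constant. *)
Lemma product_asymptotics : exists2 C' : R, 0 <= C' & forall n, (0 < n)%N ->
  `|b n - n%:R `^ (- (2 * q)) * (- 2 * osc n ^+ 2)| <= C' * n%:R `^ (- (2 * q) - d).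
Proof.
have /andP[d0 d1] := d01.
have k0 : (0 < k)%N by apply: leq_trans k2.
pose S := K * (K + K) + 2 * r ^+ 2.
have S0 : 0 <= S by rewrite addr_ge0 ?mulr_ge0 ?addr_ge0 ?sqr_ge0.
exists (S * k%:R `^ (2 * q + d) + (2 * Cs * K + 2 * r * C)).
  by rewrite !addr_ge0 ?mulr_ge0 ?powR_ge0.
move=> n n0.
have nd0 : 0 <= n%:R `^ (- (2 * q) - d) :> R by exact: powR_ge0.
have rq : osc n ^+ 2 <= r ^+ 2.
  by rewrite -real_normK ?num_real// lerXn2r ?nnegrE ?osc_bound.
have n1 : 1 <= n%:R :> R by rewrite ler1n.
have [kn|nk] := ltnP k n.
  apply: (@le_trans _ _ ((2 * Cs * K + 2 * r * C) * n%:R `^ (- (2 * q) - d))); last first.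
    by rewrite ler_wpM2r// lerDr mulr_ge0 ?powR_ge0.
  have nk0 : (0 < n - k)%N by rewrite subn_gt0.
  have nkE : n = (n - k + k)%N by rewrite subnK// ltnW.
  have s1 := shifted_bound (ltn_addr k n0) n0 (or_introl erefl).
  have s2 := shifted_bound nk0 n0 (or_intror nkE).
  have -> : b n = a n * (a (n + k)%N + a (n - k)%N).
    rewrite /b; have -> : n != k by rewrite gtn_eqF.
    by rewrite subzn ?(ltnW kn).
  set p := n%:R `^ (- q) in s1 s2 *.
  have pp : n%:R `^ (- (2 * q)) = p * p :> R.
    by apply: powR_split; rewrite ?(lt_le_trans ltr01 n1)//; ring.
  have pd : n%:R `^ (- (2 * q) - d) = p * n%:R `^ (- q - d) :> R.
    by apply: powR_split; rewrite ?(lt_le_trans ltr01 n1)//; ring.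
  have -> : a n * (a (n + k)%N + a (n - k)%N) - n%:R `^ (- (2 * q)) * (- 2 * osc n ^+ 2) =
    a n * ((a (n + k)%N + p * osc n) + (a (n - k)%N + p * osc n)) +
    - 2 * p * osc n * (a n - p * osc n) by rewrite pp; ring.
  apply: (le_trans (ler_normD _ _)); rewrite mulrDl; apply: lerD; rewrite normrM.
    apply: (@le_trans _ _ (K * p * (Cs * n%:R `^ (- q - d) + Cs * n%:R `^ (- q - d)))).
      apply: ler_pM => //; first exact: seq_bound.
      by apply: (le_trans (ler_normD _ _)); exact: lerD.
    by rewrite pd; apply: eqW; ring.
  apply: (@le_trans _ _ (2 * p * r * (C * n%:R `^ (- q - d)))).
    apply: ler_pM => //; last exact: ha.
    rewrite !normrM normrN (ger0_norm (powR_ge0 _ _)) (ger0_norm (ler0n R 2)).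
    by rewrite ler_wpM2l ?osc_bound// mulr_ge0 ?powR_ge0.
  by rewrite pd; apply: eqW; ring.
apply: (@le_trans _ _ (S * k%:R `^ (2 * q + d) * n%:R `^ (- (2 * q) - d))); last first.
  by rewrite ler_wpM2r// lerDl addr_ge0 ?mulr_ge0.
have -> : - (2 * q) - d = - (2 * q + d) by ring.
have pos2 : 0 <= 2 * q + d by qlra.
rewrite -mulrA.
apply: (@le_trans _ _ S); last first.
  have kn1 : 1 <= k%:R `^ (2 * q + d) * n%:R `^ (- (2 * q + d)) :> R.
    rewrite powRN ler_pdivlMr ?powR_gt0 ?(lt_le_trans ltr01 n1)// mul1r.
    by apply: ge0_ler_powR; rewrite ?nnegrE ?ler0n// ler_nat.
  by rewrite -{1}(mulr1 S) ler_wpM2l.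
have ab m : (0 < m)%N -> `|a m| <= K.
  move=> m0; apply: (le_trans (seq_bound m0)); rewrite ler_piMr//.
  by apply: natr_powR_le1 => //; qlra.
apply: (le_trans (ler_normB _ _)); apply: lerD.
  rewrite /b normrM; apply: ler_pM => //; first exact: ab.
  apply: (le_trans (ler_normD _ _)); apply: lerD; first by apply: ab; rewrite ltn_addr.
  case: ifPn => [nek|_]; last by rewrite normr0.
  by apply: ab; rewrite absz_gt0 subr_eq0 eqz_nat.
rewrite normrM (ger0_norm (powR_ge0 _ _)) normrM normrN (ger0_norm (ler0n R 2)) (ger0_norm (sqr_ge0 _)).
rewrite -[X in _ <= X]mul1r; apply: ler_pM => //.
- by rewrite mulr_ge0 ?sqr_ge0.
- by apply: natr_powR_le1 => //; qlra.
- by rewrite ler_wpM2l.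
Qed.

(** A discrete primitive of the part of frequency 2 th of the squared oscillation.
    It exists because sin th is nonzero, which is where k >= 2 enters. *)
Definition osc_primitive (n : nat) : R :=
  ((A ^+ 2 - B ^+ 2) * sin ((2 * n%:R - 1) * th) +
   2 * A * B * cos ((2 * n%:R - 1) * th)) / (2 * sin th).

Lemma sin_th_gt0 : 0 < sin th.
Proof.
have k0 : 0 < k%:R :> R by rewrite ltr0n (leq_trans _ k2).
apply: sin_gt0_pi; rewrite /th divr_gt0 ?pi_gt0//=.
rewrite ltr_pdivrMr// ltr_pMr ?pi_gt0//.
by rewrite ltr1n.
Qed.

Lemma osc_sqr n : - 2 * osc n ^+ 2 =
  - (A ^+ 2 + B ^+ 2) + (osc_primitive n.+1 - osc_primitive n).
Proof.
have s0 := gt_eqF sin_th_gt0.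
rewrite /osc_primitive -mulrBl.
have -> : (2 * n.+1%:R - 1) * th = (n%:R * th + n%:R * th) + th.
  by rewrite -natr1; ring.
have -> : (2 * n%:R - 1) * th = (n%:R * th + n%:R * th) - th by ring.
rewrite !(sinD, cosD, sinN, cosN) /osc.
set S := sin (n%:R * th); set Co := cos (n%:R * th).
have E : S ^+ 2 + Co ^+ 2 = 1 by rewrite addrC cos2Dsin2.
have -> : - (A ^+ 2 + B ^+ 2) = - (A ^+ 2 + B ^+ 2) * (S ^+ 2 + Co ^+ 2) by rewrite E mulr1.
by field; rewrite s0.
Qed.

Lemma osc_primitive_bound n : `|osc_primitive n| <=
  (`|A ^+ 2 - B ^+ 2| + `|2 * A * B|) / (2 * sin th).
Proof.
have s0 := sin_th_gt0.
have s2 : 0 < 2 * sin th by rewrite mulr_gt0.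
rewrite normrM [`|(2 * _)^-1|]gtr0_norm ?invr_gt0// ler_wpM2r ?invr_ge0 ?(ltW s2)//.
apply: (le_trans (ler_normD _ _)); apply: lerD; rewrite normrM -[X in _ <= X]mulr1 ler_wpM2l//.
  exact: sin_max.
exact: cos_max.
Qed.
End Sequence.

(** The kernel function is phi0 at lambda_{n,k} / w; for s > 0 its linear part z is
    removed, which leaves - phi1. *)
Definition phi0 z := z / (1 + z ^+ 2) : R.
Definition phi1 z := z ^+ 3 / (1 + z ^+ 2) : R.

Lemma one_plus_sqr_gt0 z : 0 < 1 + z ^+ 2 :> R.
Proof. by rewrite ltr_pwDl// sqr_ge0. Qed.

Lemma phi01 z : phi0 z = z - phi1 z.
Proof. by rewrite /phi0 /phi1; field; rewrite gt_eqF// one_plus_sqr_gt0. Qed.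

Lemma one_plus_sqr_le (kap y z : R) : `|z - y| <= kap ->
  1 + y ^+ 2 <= (2 + 2 * kap ^+ 2) * (1 + z ^+ 2).
Proof.
move=> zy; have k0 : 0 <= kap := le_trans (normr_ge0 _) zy.
have h : (z - y) ^+ 2 <= kap ^+ 2.
  by rewrite -[(z - y) ^+ 2]ger0_norm ?sqr_ge0// normrX lerXn2r ?nnegrE.
have : y ^+ 2 <= 2 * z ^+ 2 + 2 * (z - y) ^+ 2.
  rewrite -subr_ge0.
  have -> : 2 * z ^+ 2 + 2 * (z - y) ^+ 2 - y ^+ 2 = (2 * z - y) ^+ 2 by ring.
  exact: sqr_ge0.
have := mulr_ge0 (sqr_ge0 kap) (sqr_ge0 z); have := sqr_ge0 z; nra.
Qed.

Lemma phi0_diff (kap y z : R) : `|z - y| <= kap ->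
  `|phi0 z - phi0 y| <= `|z - y| * ((2 + 2 * kap ^+ 2) / (1 + y ^+ 2)).
Proof.
move=> zy; have := one_plus_sqr_le zy => h.
have y0 := one_plus_sqr_gt0 y; have z0 := one_plus_sqr_gt0 z.
have -> : phi0 z - phi0 y = (z - y) * ((1 - z * y) / ((1 + z ^+ 2) * (1 + y ^+ 2))).
  by rewrite /phi0; field; rewrite !gt_eqF.
rewrite normrM ler_wpM2l// normrM [X in _ * X]gtr0_norm ?invr_gt0 ?mulr_gt0//.
rewrite invfM mulrA ler_wpM2r ?invr_ge0 ?(ltW y0)// ler_pdivrMr//.
have : `|1 - z * y| <= (1 + z ^+ 2) / 2 + (1 + y ^+ 2) / 2.
  by rewrite ler_norml; apply/andP; split; have := sqr_ge0 (z - y); have := sqr_ge0 (z + y); nra.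
have := mulr_ge0 (sqr_ge0 kap) (sqr_ge0 z); have := sqr_ge0 z; have := sqr_ge0 kap; nra.
Qed.

Lemma phi1_diff (kap y z : R) : 0 <= kap -> 0 <= y -> `|z| <= (1 + kap) * y ->
  `|phi1 z - phi1 y| <= `|z - y| * ((1 + (2 + kap) ^+ 2) * y ^+ 2 / (1 + y ^+ 2)).
Proof.
move=> k0 yp zy.
have y0 := one_plus_sqr_gt0 y; have z0 := one_plus_sqr_gt0 z.
have -> : phi1 z - phi1 y =
  (z - y) * ((z ^+ 2 * y ^+ 2 + z ^+ 2 + y ^+ 2 + z * y) / ((1 + z ^+ 2) * (1 + y ^+ 2))).
  by rewrite /phi1; field; rewrite !gt_eqF.
rewrite normrM ler_wpM2l// normrM [X in _ * X]gtr0_norm ?invr_gt0 ?mulr_gt0//.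
rewrite invfM mulrA ler_wpM2r ?invr_ge0 ?(ltW y0)// ler_pdivrMr//.
have z2 : z ^+ 2 <= (1 + kap) ^+ 2 * y ^+ 2.
  rewrite -exprMn -[z ^+ 2]ger0_norm ?sqr_ge0// normrX lerXn2r ?nnegrE//.
  by rewrite mulr_ge0// addr_ge0.
have zy2 : `|z * y| <= (1 + kap) * y ^+ 2.
  by rewrite normrM (ger0_norm yp) expr2 mulrA ler_wpM2r.
have p1 := mulr_ge0 (sqr_ge0 z) (sqr_ge0 y).
have p2 := mulr_ge0 (sqr_ge0 (2 + kap)) p1.
apply: (le_trans (ler_normD _ _)).
have p0 : 0 <= z ^+ 2 * y ^+ 2 + z ^+ 2 + y ^+ 2.
  by have := sqr_ge0 z; have := sqr_ge0 y; lra.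
rewrite (ger0_norm p0).
have := mulr_ge0 k0 (sqr_ge0 y); have := sqr_ge0 y; nra.
Qed.

Definition pair_coef (k : nat) (a : nat -> R) (n : nat) : R :=
  a n * (a (n + k)%N + (if n != k then a `|n%:Z - k%:Z|%N else 0)).

(** lambda_{n,k} / w in the variable h = pi / sqrt w. *)
Definition shifted_level (k : nat) (h : R) (n : nat) : R :=
  (h * n%:R) ^+ 2 - (k%:R * h) ^+ 2 / 2.

Lemma phi0_profile q y : 0 < y -> y `^ (- (2 * q)) * phi0 (y ^+ 2) = profile (2 - 2 * q) y.
Proof.
move=> y0; rewrite /phi0 /profile -exprM mulrA; congr (_ / _).
rewrite -(powR_mulrn 2 (ltW y0)) mulrC; apply/esym; apply: powR_split => //; ring.
Qed.

Lemma phi1_profile q y : 0 < y -> y `^ (- (2 * q)) * phi1 (y ^+ 2) = profile (6 - 2 * q) y.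
Proof.
move=> y0; rewrite /phi1 /profile -!exprM mulrA; congr (_ / _).
rewrite -(powR_mulrn 6 (ltW y0)) mulrC; apply/esym; apply: powR_split => //; ring.
Qed.

Lemma phi0_ge0 z : 0 <= z -> 0 <= phi0 z.
Proof. by move=> z0; rewrite divr_ge0 ?(ltW (one_plus_sqr_gt0 z)). Qed.

Lemma phi1_ge0 z : 0 <= z -> 0 <= phi1 z.
Proof. by move=> z0; rewrite divr_ge0 ?exprn_ge0 ?(ltW (one_plus_sqr_gt0 z)). Qed.

Lemma level_diff (k : nat) h n : 0 < h -> h <= 1 -> (0 < n)%N ->
  let y := (h * n%:R) ^+ 2 in let kap := k%:R ^+ 2 / 2 : R in
  [/\ 0 < y, `|shifted_level k h n - y| = kap * (y * n%:R `^ (-2)),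
      kap * (y * n%:R `^ (-2)) <= kap & `|shifted_level k h n| <= (1 + kap) * y].
Proof.
move=> h0 h1 n0 y kap; have nR : 0 < n%:R :> R by rewrite ltr0n.
have y0 : 0 < y by rewrite exprn_gt0// mulr_gt0.
have kap0 : 0 <= kap by rewrite divr_ge0 ?sqr_ge0.
have E : y * n%:R `^ (-2) = h ^+ 2.
  by rewrite (powR_invn 2 (ltW nR)) /y exprMn mulfK// gt_eqF// exprn_gt0.
have d : `|shifted_level k h n - y| = kap * (y * n%:R `^ (-2)).
  rewrite E /shifted_level -/y addrAC subrr add0r normrN exprMn mulrAC.
  by rewrite ger0_norm// mulr_ge0 ?sqr_ge0.
have n21 : n%:R `^ (-2) <= 1 :> R.
  by rewrite (powR_invn 2 (ltW nR)) invf_le1 ?exprn_gt0// exprn_ege1// ler1n.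
have hh : kap * (y * n%:R `^ (-2)) <= kap.
  by rewrite E -[X in _ <= X]mulr1 ler_wpM2l// expr_le1// ltW.
split => //; rewrite -(subrK y (shifted_level k h n)).
apply: (le_trans (ler_normD _ _)); rewrite d (gtr0_norm y0) addrC mulrDl mul1r lerD2l.
by rewrite ler_wpM2l// ler_piMr// ltW.
Qed.

Lemma phi0_level (k : nat) : exists2 Cp : R, 0 <= Cp & forall h n, 0 < h -> h <= 1 -> (0 < n)%N ->
  `|phi0 (shifted_level k h n) - phi0 ((h * n%:R) ^+ 2)| <=
  Cp * (n%:R `^ (-2) * phi0 ((h * n%:R) ^+ 2)).
Proof.
pose kap : R := k%:R ^+ 2 / 2.
have kap0 : 0 <= kap by rewrite divr_ge0 ?sqr_ge0.
exists (kap * (2 + 2 * kap ^+ 2)).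
  by rewrite mulr_ge0// addr_ge0// mulr_ge0// sqr_ge0.
move=> h n h0 h1 n0; have [y0 d dk _] := level_diff k h0 h1 n0.
rewrite -d in dk; apply: (le_trans (phi0_diff dk)).
by rewrite d /phi0 -/kap; apply: eqW; ring.
Qed.

Lemma phi1_level (k : nat) : exists2 Cp : R, 0 <= Cp & forall h n, 0 < h -> h <= 1 -> (0 < n)%N ->
  `|phi1 (shifted_level k h n) - phi1 ((h * n%:R) ^+ 2)| <=
  Cp * (n%:R `^ (-2) * phi1 ((h * n%:R) ^+ 2)).
Proof.
pose kap : R := k%:R ^+ 2 / 2.
have kap0 : 0 <= kap by rewrite divr_ge0 ?sqr_ge0.
exists (kap * (1 + (2 + kap) ^+ 2)).
  by rewrite mulr_ge0// addr_ge0// sqr_ge0.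
move=> h n h0 h1 n0; have [y0 d _ zy] := level_diff k h0 h1 n0.
apply: (le_trans (phi1_diff kap0 (ltW y0) zy)).
by rewrite d /phi1 -/kap; apply: eqW; ring.
Qed.

(** Replacing lambda_{n,k} by lambda_n costs a factor 1 + O(n^-2), and the product of
    coefficients is known up to a factor n^-d: both are remainders of the Riemann
    sum.  Stated for a general phi so as to serve for both signs of s. *)
Lemma mode_sum (e q : R) (phi : R -> R) : -1 < e -> e < 3 -> 0 <= q ->
  (forall y, 0 < y -> y `^ (- (2 * q)) * phi (y ^+ 2) = profile e y) ->
  (forall z, 0 <= z -> 0 <= phi z) ->
  (forall k : nat, exists2 Cp : R, 0 <= Cp & forall h n, 0 < h -> h <= 1 -> (0 < n)%N ->
    `|phi (shifted_level k h n) - phi ((h * n%:R) ^+ 2)| <=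
    Cp * (n%:R `^ (-2) * phi ((h * n%:R) ^+ 2))) ->
  exists2 I : R, 0 < I & forall (k : nat) A B d C (a : nat -> R),
  (2 <= k)%N -> 0 < d <= 1 -> 0 <= C ->
  (forall n, (0 < n)%N ->
    `|a n - n%:R `^ (- q) * osc k A B n| <= C * n%:R `^ (- q - d)) ->
  exists2 m : R, 0 < m & exists2 C' : R, 0 <= C' &
  forall h, 0 < h -> h <= 1 -> \forall N \near \oo,
    `|h * \sum_(1 <= n < N) (h `^ (- (2 * q)) * (pair_coef k a n * phi (shifted_level k h n)))
      + (A ^+ 2 + B ^+ 2) * I| <= C' * h `^ m.
Proof.
move=> e1 e3 q0 prof phi_ge0 level.
have [I I0 HI] := profile_sum e1 e3; exists I => //.
move=> k A B d C a k2 d01 C0 ha; have /andP[d0 d1] := d01.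
have [Cb Cb0 Hb] := product_asymptotics k2 q0 d01 C0 ha.
have [Cp Cp0 Hp] := level k.
pose r : R := 2 * (`|A| + `|B|) ^+ 2.
have r0 : 0 <= r by rewrite mulr_ge0 ?sqr_ge0.
have beta_r n : `|- 2 * osc k A B n ^+ 2| <= r.
  rewrite normrM normrN (ger0_norm (ler0n R 2)) (ger0_norm (sqr_ge0 _)) ler_wpM2l//.
  rewrite -real_normK ?num_real// lerXn2r ?nnegrE ?addr_ge0//.
  exact: osc_bound.
have [||m m0 [C' C'0 HC]] := HI (- (A ^+ 2 + B ^+ 2)) (osc_primitive k A B)
  _ d (Cb + (r + Cb) * Cp)
  (fun h n => h `^ (- (2 * q)) * (pair_coef k a n * phi (shifted_level k h n)))
  (osc_primitive_bound A B k2) d0.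
- by rewrite addr_ge0// mulr_ge0// addr_ge0.
- move=> h n h0 h1 n0.
  have nR : 0 < n%:R :> R by rewrite ltr0n.
  have n1 : 1 <= n%:R :> R by rewrite ler1n.
  have hn : 0 < h * n%:R by rewrite mulr_gt0.
  rewrite -(osc_sqr A B k2) -(prof _ hn) powRM ?(ltW h0) ?(ltW nR)//.
  have hb := Hb n n0; have hp := Hp h n h0 h1 n0.
  set be := - 2 * _ in hb *; set b := pair_coef k a n in hb *.
  set p := phi ((h * n%:R) ^+ 2) in hp *; set pz := phi _ in hp *.
  have p0 : 0 <= p by rewrite phi_ge0// sqr_ge0.
  set H := h `^ _; set Q := n%:R `^ (- (2 * q)) in hb *.
  have H0 : 0 <= H by exact: powR_ge0.
  have Q0 : 0 <= Q by exact: powR_ge0.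
  have D0 : 0 <= n%:R `^ (- d) :> R by exact: powR_ge0.
  have QD : n%:R `^ (- (2 * q) - d) = Q * n%:R `^ (- d) :> R by exact: powR_split.
  rewrite QD in hb.
  have Dle : n%:R `^ (-2) <= n%:R `^ (- d) :> R by apply: ler_powR => //; lra.
  have D1 : n%:R `^ (- d) <= 1 :> R by apply: natr_powR_le1 => //; lra.
  have hbe : `|be| <= r := beta_r n.
  have bb : `|b| <= (r + Cb) * Q.
    rewrite -(subrK (Q * be) b) addrC; apply: (le_trans (ler_normD _ _)).
    rewrite mulrDl normrM (ger0_norm Q0); apply: lerD.
      by rewrite mulrC ler_wpM2r.
    by apply: (le_trans hb); rewrite ler_wpM2l// ler_piMr.
  have -> : H * (b * pz) - be * (H * Q * p) = H * (b * (pz - p) + (b - Q * be) * p) by ring.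
  rewrite normrM (ger0_norm H0).
  have -> : (Cb + (r + Cb) * Cp) * (n%:R `^ (- d) * (H * Q * p)) =
    H * ((r + Cb) * Q * (Cp * (n%:R `^ (- d) * p)) + Cb * (Q * n%:R `^ (- d)) * p) by ring.
  rewrite ler_wpM2l//; apply: (le_trans (ler_normD _ _)); apply: lerD; rewrite normrM.
    apply: ler_pM => //; apply: (le_trans hp).
    by rewrite ler_wpM2l// ler_wpM2r.
  by rewrite (ger0_norm p0) ler_wpM2r.
exists m => //; exists C' => // h h0 h1.
by apply: filterS (HC h h0 h1) => N; rewrite mulNr opprK.
Qed.
End KernelSum.

(** * Asymptotics of the kernel sum at infinity *)
Section KernelAsymptotics.
Context {R : realType}.
Implicit Types (A B C s w : R).

Lemma kernel_term_level (k n : nat) (w : R) : 0 < w ->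
  let h := pi * w `^ (- 2^-1) in
  (eigval_shift n k / (eigval_shift n k ^+ 2 + w ^+ 2) = w^-1 * phi0 (shifted_level k h n)) /\
  (w * shifted_level k h n = eigval_shift n k).
Proof.
move=> w0 h.
have h2 : h ^+ 2 = pi ^+ 2 / w.
  rewrite /h exprMn -(powR_mulrn 2 (powR_ge0 _ _)) -powRrM.
  have -> : - 2^-1 * 2 = -1 :> R by lra.
  by rewrite powR_inv1// ltW.
have E : w * shifted_level k h n = eigval_shift n k.
  clearbody h; rewrite /shifted_level /eigval_shift /eigval !exprMn h2.
  by field; rewrite gt_eqF.
split=> //; rewrite -E; set z := shifted_level k h n.
have z0 := one_plus_sqr_gt0 z.
rewrite /phi0; have -> : (w * z) ^+ 2 + w ^+ 2 = w ^+ 2 * (1 + z ^+ 2) by ring.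
by field; rewrite !gt_eqF.
Qed.

(** The kernel function is O(n^-2); the finitely many n < k, for which lambda_{n,k}
    may be negative, are put in the constant. *)
Lemma kernel_cvg (k : nat) (q r w : R) (b : nat -> R) : 0 <= q -> (0 < k)%N -> 0 <= r ->
  (forall n, (0 < n)%N -> `|b n| <= r * n%:R `^ (- q)) ->
  cvgn (fun N => \sum_(1 <= n < N) (b n * (eigval_shift n k / (eigval_shift n k ^+ 2 + w ^+ 2)))).
Proof.
move=> q0 k0 r0 hb.
pose g n : R := eigval_shift n k / (eigval_shift n k ^+ 2 + w ^+ 2).
pose S : R := \sum_(1 <= j < k) `|g j * j%:R ^+ 2|.
have S0 : 0 <= S by apply: sumr_ge0.
have pi1 : 1 <= (pi : R) by have := pi_ge2 R; lra.
have hg n : (0 < n)%N -> `|g n| <= (S + 2) * n%:R `^ (- 2).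
  move=> n0; have nR : 0 < n%:R :> R by rewrite ltr0n.
  rewrite (powR_invn 2 (ltW nR)) ler_pdivlMr ?exprn_gt0//.
  have [nk|kn] := ltnP n k.
    rewrite -[X in _ * X]ger0_norm ?sqr_ge0// -normrM.
    apply: (@le_trans _ _ S); last by rewrite lerDl.
    rewrite /S (bigD1_seq n) ?mem_index_iota ?n0 ?nk ?iota_uniq//= lerDl.
    by apply: sumr_ge0.
  apply: (@le_trans _ _ 2); last by rewrite lerDr.
  have L0 : n%:R ^+ 2 / 2 <= eigval_shift n k :> R.
    have kn2 : k%:R ^+ 2 <= n%:R ^+ 2 :> R by rewrite lerXn2r ?nnegrE ?ler0n ?ler_nat.
    have p2 : 1 <= pi ^+ 2 :> R by rewrite exprn_ege1.
    have n2 : 0 <= n%:R ^+ 2 :> R by exact: sqr_ge0.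
    rewrite /eigval_shift /eigval !exprMn.
    have := ler_wpM2r n2 p2; have := ler_wpM2r (le_trans ler01 p2) kn2; nra.
  have L1 : 0 < eigval_shift n k :> R by apply: lt_le_trans L0; rewrite divr_gt0 ?exprn_gt0.
  have den : 0 < eigval_shift n k ^+ 2 + w ^+ 2 :> R.
    by rewrite ltr_pwDl ?sqr_ge0// exprn_gt0.
  rewrite /g ger0_norm ?divr_ge0 ?(ltW L1) ?(ltW den)// mulrAC ler_pdivrMr//.
  have := sqr_ge0 w; nra.
apply: (@is_cvg_sum_from1 _ _ (q + 2) (r * (S + 2))); first by lra.
move=> n n0; rewrite normrM -/(g n).
have -> : - (q + 2) = - q + - 2 by ring.
rewrite (@powR_split _ _ (- q) (- 2))// ?ltr0n// mulrACA.
by apply: ler_pM => //; [exact: hb|exact: hg].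
Qed.

Lemma limn_dist_le (u : nat -> R) (c e : R) : cvgn u ->
  (\forall N \near \oo, `|u N - c| <= e) -> `|limn u - c| <= e.
Proof.
move=> cu ue.
have h : `|u N - c| @[N --> \oo] --> `|limn u - c|.
  by apply: cvg_norm; apply: cvgB; [exact: cu|exact: cvg_cst].
apply: (@le_trans _ _ (limn (fun N => `|u N - c|))); first by rewrite (cvg_lim _ h).
by apply: limr_le => //; exact: cvgP h.
Qed.

(** For s < 0 the terms are summed as they are; for s > 0 the linear part of phi0,
    whose sum tends to 0, is first removed, which leaves - phi1.  Hence kap is
    negative in the first case and positive in the second. *)
Theorem kernel_asymptotics s : -1 <= s <= 1 -> s != 0 ->
  exists2 kap : R, kap != 0 &
  forall (k : nat) A B d C (a : nat -> R),
  (2 <= k)%N -> 0 < d <= 1 -> 0 <= C ->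
  (forall n, (0 < n)%N ->
    `|a n - n%:R `^ (- (s + 3 / 2)) * osc k A B n| <= C * n%:R `^ (- (s + 3 / 2) - d)) ->
  (0 < s -> \sum_(1 <= n < N) (pair_coef k a n * eigval_shift n k) @[N --> \oo] --> 0) ->
  let K w N := \sum_(1 <= n < N)
    (pair_coef k a n * (eigval_shift n k / (eigval_shift n k ^+ 2 + w ^+ 2))) in
  (forall w, cvgn (K w)) /\
  exists2 nu : R, 0 < nu & exists2 C' : R, 0 < C' & \forall w \near +oo,
    `|limn (K w) - kap * (A ^+ 2 + B ^+ 2) / w `^ (2 + s)| <= C' / w `^ (2 + s + nu).
Proof.
move=> /andP[s1 s2] s0.
pose q := s + 3 / 2; have q0 : 0 <= q by rewrite /q; lra.
have pi0 := pi_gt0 R; have pi0' := ltW pi0.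
(* |pair_coef| <= C n^-2q and the kernel function is O(n^-2): absolute convergence. *)
have cvgK k A B d C a : (2 <= k)%N -> 0 < d <= 1 -> 0 <= C ->
  (forall n, (0 < n)%N ->
    `|a n - n%:R `^ (- q) * osc k A B n| <= C * n%:R `^ (- q - d)) ->
  forall w : R, cvgn (fun N => \sum_(1 <= n < N)
    (pair_coef k a n * (eigval_shift n k / (eigval_shift n k ^+ 2 + w ^+ 2)))).
  move=> k2 d01 C0 ha w; have /andP[d0 d1] := d01.
  have [Cb Cb0 Hb] := product_asymptotics k2 q0 d01 C0 ha.
  pose r : R := 2 * (`|A| + `|B|) ^+ 2.
  have r0 : 0 <= r by rewrite mulr_ge0 ?sqr_ge0.
  apply: (@kernel_cvg k (2 * q) (r + Cb)); rewrite ?addr_ge0 ?mulr_ge0//.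
    exact: leq_trans k2.
  move=> n n0; rewrite -(subrK (n%:R `^ (- (2 * q)) * (- 2 * osc k A B n ^+ 2)) (pair_coef k a n)).
  rewrite addrC; apply: (le_trans (ler_normD _ _)); rewrite [X in _ <= X]mulrDl; apply: lerD.
    rewrite normrM (ger0_norm (powR_ge0 _ _)) mulrC ler_wpM2r ?powR_ge0//.
    rewrite normrM normrN (ger0_norm (ler0n R 2)) (ger0_norm (sqr_ge0 _)) ler_wpM2l//.
    rewrite -real_normK ?num_real// lerXn2r ?nnegrE ?addr_ge0//.
    exact: osc_bound.
  apply: (le_trans (Hb n n0)); rewrite ler_wpM2l//; apply: ler_powR; rewrite ?ler1n//; lra.
(* The normalization h^(2q-1) / w of the Riemann sum is the announced power of w. *)
have scale w : 0 < w -> let h := pi * w `^ (- 2^-1) in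
    w^-1 * h `^ (2 * q - 1) = pi `^ (2 * q - 1) / w `^ (2 + s).
  move=> w0 h; rewrite /h powRM ?powR_ge0// -powRrM mulrCA; congr (_ * _).
  rewrite -powRN -(powR_inv1 (ltW w0)) -powRD ?(gt_eqF w0) ?implybT//.
  by congr (_ `^ _); rewrite /q; field.
have hpow w m : 0 < w -> (pi * w `^ (- 2^-1)) `^ m = pi `^ m * w `^ (- (m / 2)).
  by move=> w0; rewrite powRM ?powR_ge0// -powRrM; congr (_ * _ `^ _); field.
have hpos w : 0 < w -> 0 < pi * w `^ (- 2^-1) by move=> w0; rewrite mulr_gt0 ?powR_gt0.
have hle1 w : pi ^+ 2 <= w -> pi * w `^ (- 2^-1) <= 1.
  move=> pw; have w0 : 0 < w by apply: lt_le_trans pw; rewrite exprn_gt0.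
  rewrite powRN ler_pdivrMr ?powR_gt0// mul1r.
  apply: (@le_trans _ _ ((pi ^+ 2) `^ 2^-1)).
    by rewrite -(powR_mulrn 2 pi0') -powRrM mulfV ?pnatr_eq0// powRr1.
  by apply: ge0_ler_powR; rewrite ?nnegrE ?sqr_ge0 ?(ltW w0)//; lra.
have pip : 0 < pi `^ (2 * q - 1) :> R by exact: powR_gt0.
have hsum (w h : R) (u : nat -> R) N : 0 < h -> w^-1 * \sum_(1 <= n < N) u n =
    w^-1 * h `^ (2 * q - 1) * (h * \sum_(1 <= n < N) (h `^ (- (2 * q)) * u n)).
  move=> h0; rewrite -mulr_sumr.
  have E : h `^ (2 * q - 1) * (h * h `^ (- (2 * q))) = 1.
    rewrite -{2}(powRr1 (ltW h0)) -!powRD ?(gt_eqF h0) ?implybT//.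
    have -> : 2 * q - 1 + (1 - 2 * q) = 0 by ring.
    by rewrite powRr0.
  have -> : w^-1 * h `^ (2 * q - 1) * (h * (h `^ (- (2 * q)) * \sum_(1 <= n < N) u n)) =
    w^-1 * (\sum_(1 <= n < N) u n) * (h `^ (2 * q - 1) * (h * h `^ (- (2 * q)))) by ring.
  by rewrite E mulr1.
(* The bound of the Riemann sum, rewritten in terms of w. *)
have approx phi k A B C' m I a : (0 < m) -> 0 <= C' ->
    (forall h, 0 < h -> h <= 1 -> \forall N \near \oo,
    `|h * \sum_(1 <= n < N) (h `^ (- (2 * q)) * (pair_coef k a n * phi (shifted_level k h n)))
      + (A ^+ 2 + B ^+ 2) * I| <= C' * h `^ m) ->
    forall w, pi ^+ 2 <= w -> \forall N \near \oo,
    `|w^-1 * \sum_(1 <= n < N) (pair_coef k a n * phi (shifted_level k (pi * w `^ (- 2^-1)) n))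
      + I * pi `^ (2 * q - 1) * (A ^+ 2 + B ^+ 2) / w `^ (2 + s)| <=
    pi `^ (2 * q - 1) * C' * pi `^ m / w `^ (2 + s + m / 2).
  move=> m0 C'0 H w pw; have w0 : 0 < w by apply: lt_le_trans pw; rewrite exprn_gt0.
  set h := pi * w `^ (- 2^-1); have h0 : 0 < h := hpos _ w0.
  apply: filterS (H h h0 (hle1 _ pw)) => N HN.
  rewrite (hsum w h _ _ h0) scale//; set X := h * _ in HN *.
  have -> : pi `^ (2 * q - 1) / w `^ (2 + s) * X +
    I * pi `^ (2 * q - 1) * (A ^+ 2 + B ^+ 2) / w `^ (2 + s) =
    pi `^ (2 * q - 1) / w `^ (2 + s) * (X + (A ^+ 2 + B ^+ 2) * I) by ring.
  have p0 : 0 <= pi `^ (2 * q - 1) / w `^ (2 + s) by rewrite divr_ge0 ?powR_ge0.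
  rewrite normrM (ger0_norm p0); apply: (le_trans (ler_wpM2l p0 HN)).
  rewrite hpow// -!powRN.
  have -> : w `^ (- (2 + s + m / 2)) = w `^ (- (2 + s)) * w `^ (- (m / 2)).
    by apply: powR_split => //; ring.
  by apply: eqW; ring.
have Cpos (C' m : R) : 0 <= C' -> 0 < pi `^ (2 * q - 1) * C' * pi `^ m + 1.
  by move=> C'0; rewrite ltr_wpDl// !mulr_ge0 ?powR_ge0.
have [sneg|spos|s00] := ltgtP s 0; last by rewrite s00 eqxx in s0.
- have e1 : -1 < 2 - 2 * q by rewrite /q; lra.
  have e3 : 2 - 2 * q < 3 by rewrite /q; lra.
  have [I I0 HI] := mode_sum e1 e3 q0 (@phi0_profile _ q) (@phi0_ge0 _) (@phi0_level _).
  exists (- (I * pi `^ (2 * q - 1))); first by rewrite oppr_eq0 mulf_neq0 ?gt_eqF.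
  move=> k A B d C a k2 d01 C0 ha _ K; split; first exact: cvgK ha.
  have [m m0 [C' C'0 H]] := HI k A B d C a k2 d01 C0 ha.
  exists (m / 2); first by lra.
  exists (pi `^ (2 * q - 1) * C' * pi `^ m + 1); first exact: Cpos.
  near=> w; have pw : pi ^+ 2 <= w by near: w; apply: nbhs_pinfty_ge; exact: num_real.
  have w0 : 0 < w by apply: lt_le_trans pw; rewrite exprn_gt0.
  apply: limn_dist_le; first exact: (cvgK k A B d C a k2 d01 C0 ha w).
  apply: filterS (approx _ _ _ _ _ _ _ _ m0 C'0 H w pw) => N HN.
  have -> : K w N = w^-1 * \sum_(1 <= n < N)
      (pair_coef k a n * phi0 (shifted_level k (pi * w `^ (- 2^-1)) n)).
    rewrite mulr_sumr; apply: eq_bigr => n _.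
    by have [-> _] := kernel_term_level k n w0; rewrite mulrCA.
  rewrite !mulNr opprK; apply: (le_trans HN).
  by rewrite ler_wpM2r ?invr_ge0 ?powR_ge0// lerDl.
have e1 : -1 < 6 - 2 * q by rewrite /q; lra.
have e3 : 6 - 2 * q < 3 by rewrite /q; lra.
have [I I0 HI] := mode_sum e1 e3 q0 (@phi1_profile _ q) (@phi1_ge0 _) (@phi1_level _).
exists (I * pi `^ (2 * q - 1)); first by rewrite mulf_neq0 ?gt_eqF.
move=> k A B d C a k2 d01 C0 ha van0 K; have van := van0 isT.
split; first exact: cvgK ha.
have [m m0 [C' C'0 H]] := HI k A B d C a k2 d01 C0 ha.
exists (m / 2); first by lra.
exists (pi `^ (2 * q - 1) * C' * pi `^ m + 1); first exact: Cpos.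
near=> w; have pw : pi ^+ 2 <= w by near: w; apply: nbhs_pinfty_ge; exact: num_real.
have w0 : 0 < w by apply: lt_le_trans pw; rewrite exprn_gt0.
apply: limn_dist_le; first exact: (cvgK k A B d C a k2 d01 C0 ha w).
(* For fixed w the sum of the linear parts tends to 0 with N, so it is eventually
   smaller than the error term. *)
pose v N := \sum_(1 <= n < N) (pair_coef k a n * eigval_shift n k).
have ep : 0 < w ^+ 2 / w `^ (2 + s + m / 2) by rewrite divr_gt0 ?exprn_gt0 ?powR_gt0.
have /cvgrPdist_le/(_ _ ep) small := van.
apply: filterS2 small (approx _ _ _ _ _ _ _ _ m0 C'0 H w pw) => N.
rewrite sub0r normrN -/(v N) => vN HN.
have -> : K w N = w ^- 2 * v N - w^-1 * \sum_(1 <= n < N)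
    (pair_coef k a n * phi1 (shifted_level k (pi * w `^ (- 2^-1)) n)).
  rewrite !mulr_sumr -sumrB; apply: eq_bigr => n _.
  have [-> <-] := kernel_term_level k n w0; rewrite phi01.
  by field; rewrite gt_eqF.
rewrite -addrA -opprD; apply: (le_trans (ler_normB _ _)).
rewrite [leLHS]addrC [leRHS]mulrDl; apply: lerD => //.
rewrite normrM ger0_norm ?invr_ge0 ?sqr_ge0// mul1r ler_pdivrMl ?exprn_gt0//.
Unshelve. all: by end_near. Qed.
End KernelAsymptotics.

(** * The L2 pairing and the sine functions *)
Section Pairing.
Context {R : realType}.
Implicit Types (f g h F : R -> R) (c t : R).
Notation mu := (@lebesgue_measure R).

Definition L2 f := measurable_fun (`]0, 1[ : set R) f /\
  mu.-integrable `]0, 1[ (fun x => (f x ^+ 2)%:E).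

Lemma L2_bounded f (M : R) : measurable_fun (`]0, 1[ : set R) f ->
  (forall x, 0 < x < 1 -> `|f x| <= M) -> L2 f.
Proof.
move=> mf fM; split => //.
have s1 : sing 0 1 (cst (M ^+ 2)).
  apply: (@sing_bounded _ _ _ _ (M ^+ 2)); rewrite ?sqr_ge0//.
    by move=> x _; exact: cvg_cst.
  by move=> x _; rewrite ger0_norm ?sqr_ge0.
apply: (le_integrable _ _ _ (sing_integrable s1)) => //.
  by apply/measurable_EFinP; exact: measurable_funX.
move=> x; rewrite /= in_itv/= => xab; rewrite lee_fin !ger0_norm ?sqr_ge0//.
rewrite -real_normK ?num_real// lerXn2r ?nnegrE ?fM//.
exact: le_trans (fM _ xab).
Qed.

Lemma L2_continuous f : (forall x : R, {for x, continuous f}) -> L2 f.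
Proof.
move=> cf; split; first by apply: sing_measurable => x _; exact: cf.
have i1 : mu.-integrable `[0, 1] (EFin \o (fun x => f x ^+ 2)).
  by apply: continuous_itv_integrable => x _; apply: cvgM; exact: cf.
by apply: (integrableS _ _ _ i1) => //; exact: subset_itv_oo_cc.
Qed.

Lemma L2_0 : L2 (fun=> 0).
Proof. by apply: L2_continuous => x; exact: cvg_cst. Qed.

Lemma L2_mul f g : L2 f -> L2 g -> mu.-integrable `]0, 1[ (fun x => (f x * g x)%:E).
Proof.
move=> [mf If] [mg Ig].
apply: (le_integrable _ _ _ (integrableD _ If Ig)) => //.
  by apply/measurable_EFinP; exact: measurable_funM.
move=> x _; rewrite /= lee_fin [X in _ <= X]ger0_norm ?addr_ge0 ?sqr_ge0//.
rewrite ler_norml; apply/andP; split.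
  by have := sqr_ge0 (f x + g x); nra.
by have := sqr_ge0 (f x - g x); nra.
Qed.

Lemma L2_lin c f g : L2 f -> L2 g -> L2 (fun x => c * f x + g x).
Proof.
move=> lf lg; have [mf If] := lf; have [mg Ig] := lg.
have mcf : measurable_fun (`]0, 1[ : set R) (fun x => c * f x).
  by apply: measurable_funM => //; exact: measurable_cst.
split; first exact: measurable_funD.
apply: (le_integrable _ _ _ (integrableD _ (integrableZl _ (2 * c ^+ 2) If) (integrableZl _ 2 Ig))) => //.
  by apply/measurable_EFinP; apply: measurable_funX; exact: measurable_funD.
move=> x _; rewrite /= lee_fin.
have h : 0 <= 2 * c ^+ 2 * f x ^+ 2 + 2 * g x ^+ 2.
  by have := mulr_ge0 (sqr_ge0 c) (sqr_ge0 (f x)); have := sqr_ge0 (g x); lra.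
rewrite (ger0_norm h) (ger0_norm (sqr_ge0 _)).
by have := sqr_ge0 (c * f x - g x); nra.
Qed.

Lemma L2_mulb f g (M : R) : L2 f -> measurable_fun (`]0, 1[ : set R) g ->
  (forall x, 0 < x < 1 -> `|g x| <= M) -> L2 (fun x => f x * g x).
Proof.
move=> [mf If] mg gM; split; first exact: measurable_funM.
apply: (le_integrable _ _ _ (integrableZl _ (M ^+ 2) If)) => //.
  by apply/measurable_EFinP; apply: measurable_funX; exact: measurable_funM.
move=> x; rewrite /= in_itv/= => xab; rewrite lee_fin.
rewrite (ger0_norm (mulr_ge0 (sqr_ge0 M) (sqr_ge0 (f x)))) (ger0_norm (sqr_ge0 _)).
rewrite exprMn mulrC ler_wpM2r ?sqr_ge0//.
rewrite -real_normK ?num_real// lerXn2r ?nnegrE ?gM//.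
exact: le_trans (gM _ xab).
Qed.

Lemma pairingC f g : pairing f g = pairing g f.
Proof. by rewrite /pairing; apply: eq_Rintegral => x _; rewrite mulrC. Qed.

Lemma pairing_lin c f g h : L2 f -> L2 g -> L2 h ->
  pairing (fun x => c * f x + g x) h = c * pairing f h + pairing g h.
Proof.
move=> lf lg lh; rewrite /pairing.
have i1 := L2_mul lf lh; have i2 := L2_mul lg lh.
have i1c : mu.-integrable `]0, 1[ (EFin \o (fun x => c * (f x * h x))).
  apply: eq_integrable (integrableZl _ c i1) => //.
rewrite -RintegralZl// -RintegralD//.
by apply: eq_Rintegral => x _; ring.
Qed.

Lemma pairing0l f : pairing (fun=> 0) f = 0.
Proof.
rewrite /pairing; under eq_Rintegral do rewrite mul0r.
by rewrite Rintegral_cst// mul0r.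
Qed.

Lemma pairing_ge0 f : 0 <= pairing f f.
Proof. by apply: Rintegral_ge0 => x _; rewrite -expr2 sqr_ge0. Qed.

Lemma pairing_lin_sqr c f g : L2 f -> L2 g ->
  pairing (fun x => c * f x + g x) (fun x => c * f x + g x) =
  c ^+ 2 * pairing f f + 2 * c * pairing f g + pairing g g.
Proof.
move=> lf lg; have l := L2_lin c lf lg.
rewrite (@pairing_lin c f g _ lf lg l) (pairingC f) (pairingC g).
rewrite (@pairing_lin c f g f lf lg lf) (@pairing_lin c f g g lf lg lg).
by rewrite (pairingC g f); ring.
Qed.

(** The Cauchy-Schwarz inequality in the form given by the nonnegativity of
    (t f + g, t f + g) and (- t f + g, - t f + g); it is applied with small t. *)
Lemma pairing_CS t f g : 0 < t -> L2 f -> L2 g ->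
  `|pairing f g| <= t * pairing f f + t^-1 * pairing g g.
Proof.
move=> t0 lf lg.
have h1 := pairing_ge0 (fun x => t * f x + g x).
have h2 := pairing_ge0 (fun x => (- t) * f x + g x).
rewrite (pairing_lin_sqr t lf lg) in h1; rewrite (pairing_lin_sqr (- t) lf lg) in h2.
have f0 := pairing_ge0 f; have g0 := pairing_ge0 g.
have ti : t * t^-1 = 1 by rewrite divff// gt_eqF.
have ti0 : 0 < t^-1 by rewrite invr_gt0.
rewrite -(ler_pM2l t0) -[t * `|_|]ger0_norm ?mulr_ge0 ?(ltW t0)//.
rewrite normrM normr_id -normrM ler_norml mulrDr (mulrA t t^-1) ti mul1r.
by apply/andP; split; nra.
Qed.

Lemma eq_pairing f f' g g' : (forall x, 0 < x < 1 -> f x = f' x) ->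
  (forall x, 0 < x < 1 -> g x = g' x) -> pairing f g = pairing f' g'.
Proof.
move=> ff gg; rewrite /pairing; apply: eq_Rintegral => x.
by rewrite inE/= in_itv/= => h; rewrite ff// gg.
Qed.

Lemma FTC_unit F f : (forall x : R, is_derive x 1 F (f x)) ->
  (forall x : R, {for x, continuous f}) ->
  (\int[mu]_(x in `]0, 1[) f x)%R = F 1 - F 0.
Proof.
move=> dF cf; have fi : mu.-integrable `[0, 1] (EFin \o f) by apply: continuous_itv_integrable.
have fo : mu.-integrable `]0, 1[ (EFin \o f).
  by apply: integrableS fi => //; exact: subset_itv_oo_cc.
have fc : mu.-integrable `]0, 1] (EFin \o f).
  by apply: integrableS fi => //; apply: subset_itv; rewrite bnd_simp.
by rewrite Rintegral_itv_bndo_bndc// Rintegral_itv_obnd_cbnd// (FTC_closed ler01 (fun x _ => dF x) (fun x _ => cf x)).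
Qed.

Lemma sin_natpi n : sin (n%:R * pi) = 0 :> R.
Proof.
elim: n => [|n IH]; first by rewrite mul0r sin0.
by rewrite -natr1 mulrDl mul1r sinDpi IH oppr0.
Qed.

Lemma is_derive_cos_lin (w x : R) : is_derive x 1 (fun x => cos (w * x)) (- (w * sin (w * x))).
Proof.
have d : is_derive x 1 (fun x => w * x) w by apply: is_derive_eq; rewrite /GRing.scale/=; ring.
have := @is_derive1_comp _ cos (fun x => w * x) _ _ _ (is_derive_cos (w * x)) d.
by rewrite mulNr mulrC.
Qed.

Lemma is_derive_sin_lin (w x : R) : is_derive x 1 (fun x => sin (w * x)) (w * cos (w * x)).
Proof.
have d : is_derive x 1 (fun x => w * x) w by apply: is_derive_eq; rewrite /GRing.scale/=; ring.
have := @is_derive1_comp _ sin (fun x => w * x) _ _ _ (is_derive_sin (w * x)) d.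
by rewrite mulrC.
Qed.

Lemma int_cos_natpi n :
  (\int[mu]_(x in `]0, 1[) cos (n%:R * pi * x))%R = (n == 0%N)%:R.
Proof.
case: n => [|n].
  under eq_Rintegral do rewrite !mul0r cos0.
  rewrite (@FTC_unit id (cst 1)) ?subr0//.
  by move=> x; exact: cvg_cst.
have w0 : n.+1%:R * pi != 0 :> R by rewrite mulf_neq0 ?pnatr_eq0 ?gt_eqF ?pi_gt0.
have dF (x : R) : is_derive x 1 (fun x => (n.+1%:R * pi)^-1 * sin (n.+1%:R * pi * x))
    (cos (n.+1%:R * pi * x)).
  have d := is_derive_sin_lin (n.+1%:R * pi) x.
  by apply: is_derive_eq; rewrite /GRing.scale/= mulrA mulVf// mul1r.
have cf (x : R) : {for x, continuous (fun x => cos (n.+1%:R * pi * x))}.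
  exact: is_derive_continuous (is_derive_cos_lin _ x).
by rewrite (FTC_unit dF cf) mulr1 mulr0 sin_natpi sin0 mulr0 subrr.
Qed.

Lemma is_derive_eigfun n (x : R) :
  is_derive x 1 (eigfun n) (Num.sqrt 2 * (n%:R * pi * cos (n%:R * pi * x))).
Proof.
have d := is_derive_sin_lin (n%:R * pi) x.
by apply: is_derive_eq; rewrite /GRing.scale/=; ring.
Qed.

Lemma derive_eigfun n :
  derive1 (eigfun n) = (fun x : R => Num.sqrt 2 * (n%:R * pi * cos (n%:R * pi * x))).
Proof.
by apply/funext => x; rewrite derive1E; apply: derive_val; exact: is_derive_eigfun.
Qed.

Lemma eigfun_continuous n x : {for x, continuous (eigfun n : R -> R)}.
Proof. exact: is_derive_continuous (is_derive_eigfun n x). Qed.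

Lemma eigfun0 : eigfun 0 = (fun=> 0 : R).
Proof. by apply/funext => x; rewrite /eigfun !mul0r sin0 mulr0. Qed.

Lemma eigfun_bound n x : `|eigfun n x| <= Num.sqrt 2 :> R.
Proof.
rewrite /eigfun normrM ger0_norm ?sqrtr_ge0// -[X in _ <= X]mulr1 ler_wpM2l ?sqrtr_ge0//.
exact: sin_max.
Qed.

Lemma L2_eigfun n : L2 (eigfun n).
Proof. by apply: L2_continuous => x; exact: eigfun_continuous. Qed.

Lemma sqrt2_sqr : Num.sqrt 2 * Num.sqrt 2 = 2 :> R.
Proof. by rewrite -expr2 sqr_sqrtr. Qed.

Lemma eigfun_mul m n x : (m <= n)%N -> eigfun m x * eigfun n x =
  cos ((n - m)%:R * pi * x) - cos ((n + m)%:R * pi * x) :> R.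
Proof.
move=> mn; rewrite /eigfun mulrACA sqrt2_sqr natrB// natrD !mulrDl mulNr mulNr.
by rewrite cosB cosD; ring.
Qed.

Lemma cos_int_integrable (w : R) : mu.-integrable `]0, 1[ (EFin \o (fun x => cos (w * x))).
Proof.
have := @continuous_itv_integrable _ (fun x => cos (w * x)) 0 1.
move=> h; apply: integrableS (h _) => //; first exact: subset_itv_oo_cc.
by move=> x _; exact: is_derive_continuous (is_derive_cos_lin _ x).
Qed.

Lemma eigfun_orthonormal m n : (0 < m)%N -> (0 < n)%N ->
  pairing (eigfun m) (eigfun n) = (m == n)%:R :> R.
Proof.
wlog mn : m n / (m <= n)%N => [H m0 n0|m0 n0].
  by have [mn|/ltnW nm] := leqP m n; [exact: H|rewrite pairingC eq_sym; exact: H].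
rewrite /pairing; under eq_Rintegral do rewrite (eigfun_mul _ mn).
rewrite RintegralB//; [|exact: cos_int_integrable|exact: cos_int_integrable].
rewrite !int_cos_natpi addn_eq0 (gtn_eqF n0)/= subr0 subn_eq0.
by rewrite [m == n]eqn_leq mn.
Qed.
End Pairing.

(** * Bessel residuals and Bernstein operators *)
Section Parseval.
Context {R : realType}.
Implicit Types (f g P : R -> R) (c t x y : R).
Notation mu := (@lebesgue_measure R).

Definition fcoef f (n : nat) : R := pairing f (eigfun n).

(** f minus its N-th partial sine sum, defined so that the sum starts at index 1. *)
Fixpoint residual f (N : nat) : R -> R :=
  if N is n.+1 then
    (if n is 0 then f else fun x => (- fcoef f n) * eigfun n x + residual f n x)
  else f.

Lemma L2_residual f N : L2 f -> L2 (residual f N).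
Proof.
move=> lf; elim: N => [//|[//|n] IH].
by apply: L2_lin; [exact: L2_eigfun|exact: IH].
Qed.

Lemma residual_pairing f g N : L2 f -> L2 g ->
  pairing (residual f N) g = pairing f g - \sum_(1 <= n < N) fcoef f n * fcoef g n.
Proof.
move=> lf lg; elim: N => [|[|n] IH]; [by rewrite big_geq ?subr0|by rewrite big_geq ?subr0|].
rewrite big_nat_recr//= -/(residual f n.+1).
rewrite (pairing_lin _ (L2_eigfun _) (L2_residual _ lf) lg) IH.
by rewrite (pairingC (eigfun _)) -/(fcoef g n.+1); ring.
Qed.

Lemma fcoef_eigfun m n : (0 < m)%N -> (0 < n)%N -> fcoef (eigfun m) n = (m == n)%:R.
Proof. exact: eigfun_orthonormal. Qed.

Lemma sum_delta (u : nat -> R) N n : (0 < n)%N ->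
  \sum_(1 <= j < N) u j * (n == j)%:R = if (n < N)%N then u n else 0.
Proof.
move=> n0; elim: N => [|[|N] IH]; [by rewrite big_geq|by rewrite big_geq// ltnS leqNgt n0|].
rewrite big_nat_recr//= IH; case: (ltngtP n N.+1) => h.
- by rewrite mulr0 addr0 ltnS ltnW.
- by rewrite mulr0 addr0 ltnS leqNgt h.
- by rewrite mulr1 add0r h ltnSn.
Qed.

(** Bessel's inequality, one eigenfunction at a time. *)
Lemma residual_norm f N : L2 f -> pairing (residual f N) (residual f N) <= pairing f f.
Proof.
move=> lf; elim: N => [//|[//|n] IH].
have -> : residual f n.+2 = (fun x => - fcoef f n.+1 * eigfun n.+1 x + residual f n.+1 x) by [].
have lr := L2_residual n.+1 lf; have le := @L2_eigfun R n.+1.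
rewrite (pairing_lin_sqr _ le lr) (eigfun_orthonormal _ _)// eqxx.
have -> : pairing (eigfun n.+1) (residual f n.+1) = fcoef f n.+1.
  rewrite pairingC (residual_pairing _ lf le) -/(fcoef f n.+1).
  have E : \sum_(1 <= j < n.+1) fcoef f j * fcoef (eigfun n.+1) j = 0.
    rewrite big_nat_cond big1// => j /andP[/andP[j1 jn] _].
    by rewrite fcoef_eigfun// gtn_eqF// mulr0.
  by rewrite E subr0.
by rewrite mulr1; have := sqr_ge0 (fcoef f n.+1); lra.
Qed.

(** The index 0 is allowed, so that multiplication by cos (pi x) needs no case
    distinction on the neighbouring indices. *)
Inductive sine_sum : (R -> R) -> Prop :=
| sine_sum0 : sine_sum (fun=> 0)
| sine_sumD c n g : sine_sum g -> sine_sum (fun x => c * eigfun n x + g x).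

Lemma L2_sine_sum g : sine_sum g -> L2 g.
Proof.
by elim=> [|c n h _ lh]; [exact: L2_0|apply: L2_lin => //; exact: L2_eigfun].
Qed.

Lemma sine_sum_lin c g h : sine_sum g -> sine_sum h -> sine_sum (fun x => c * g x + h x).
Proof.
move=> sg sh; elim: sg => [|c' n g' _ IH].
  by have -> : (fun x => c * 0 + h x) = h by apply/funext => x; rewrite mulr0 add0r.
have -> : (fun x => c * (c' * eigfun n x + g' x) + h x) =
    (fun x => (c * c') * eigfun n x + (c * g' x + h x)) by apply/funext => x; ring.
exact: sine_sumD.
Qed.

Lemma sine_sum_cos g : sine_sum g -> sine_sum (fun x => cos (pi * x) * g x).
Proof.
elim=> [|c n h _ IH].
  have -> : (fun x => cos (pi * x) * 0) = (fun=> 0 : R) by apply/funext => x; rewrite mulr0.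
  exact: sine_sum0.
case: n => [|n].
  have -> : (fun x => cos (pi * x) * (c * eigfun 0 x + h x)) = (fun x => cos (pi * x) * h x).
    by apply/funext => x; rewrite eigfun0 mulr0 add0r.
  exact: IH.
have -> : (fun x => cos (pi * x) * (c * eigfun n.+1 x + h x)) =
    (fun x => (c / 2) * eigfun n.+2 x + ((c / 2) * eigfun n x + cos (pi * x) * h x)).
  apply/funext => x; rewrite /eigfun.
  have -> : n.+2%:R * pi * x = n.+1%:R * pi * x + pi * x by rewrite -natr1; ring.
  have -> : n%:R * pi * x = n.+1%:R * pi * x - pi * x by rewrite -natr1; ring.
  by rewrite sinB sinD; field.
by do 2 apply: sine_sumD.
Qed.

(** The error of the partial sum of products is the pairing of the residual of f
    with g.  A fixed sine sum is eventually orthogonal to the residual, so g may be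
    replaced by its distance to the sine sums, and the residual stays bounded. *)
Lemma parseval_of_approx f g : L2 f -> L2 g ->
  (forall e : R, 0 < e -> exists2 P, sine_sum P &
     pairing (fun x => (-1) * P x + g x) (fun x => (-1) * P x + g x) <= e) ->
  \sum_(1 <= n < N) fcoef f n * fcoef g n @[N --> \oo] --> pairing f g.
Proof.
move=> lf lg ap.
have fin P : sine_sum P -> \forall N \near \oo, pairing (residual f N) P = 0.
  elim=> [|c n h sh IH].
    by apply: nearW => N; rewrite pairingC pairing0l.
  near=> N.
  have IHN : pairing (residual f N) h = 0 by near: N.
  have lh := L2_sine_sum sh.
  rewrite pairingC (pairing_lin c (L2_eigfun n) lh (L2_residual N lf)).
  rewrite (pairingC h) IHN addr0 pairingC (residual_pairing N lf (L2_eigfun n)).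
  have [->|n0] := posnP n.
    rewrite eigfun0 (pairingC f) pairing0l sub0r big_nat_cond big1 ?oppr0 ?mulr0// => j _.
    by rewrite /fcoef pairing0l mulr0.
  have -> : \sum_(1 <= j < N) fcoef f j * fcoef (eigfun n) j =
      \sum_(1 <= j < N) fcoef f j * (n == j)%:R.
    rewrite big_nat_cond [RHS]big_nat_cond; apply: eq_bigr => j /andP[/andP[j1 _] _].
    by rewrite fcoef_eigfun.
  rewrite sum_delta//; have -> : (n < N)%N by near: N; exact: nbhs_infty_gt.
  by rewrite subrr mulr0.
apply/cvgrPdist_le => e e0.
pose F := pairing f f; have F0 : 0 <= F := pairing_ge0 f.
pose t := e / 2 / (F + 1).
have t0 : 0 < t by rewrite divr_gt0 ?divr_gt0//; lra.
have te0 : 0 < t * (e / 2) by rewrite mulr_gt0// divr_gt0.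
have [P sP hP] := ap _ te0.
near=> N.
have zero : pairing (residual f N) P = 0 by near: N; exact: fin.
have lP := L2_sine_sum sP; have lr := L2_residual N lf.
have ld : L2 (fun x => (-1) * P x + g x) by exact: L2_lin.
rewrite -(residual_pairing N lf lg).
have -> : pairing (residual f N) g = pairing (residual f N) (fun x => (-1) * P x + g x).
  rewrite [RHS]pairingC (pairing_lin (-1) lP lg lr) (pairingC P) zero mulr0 add0r.
  exact: pairingC.
apply: (le_trans (pairing_CS t0 lr ld)).
have h1 : t * pairing (residual f N) (residual f N) <= t * F.
  by rewrite ler_wpM2l ?(ltW t0)// residual_norm.
have h2 : t^-1 * pairing (fun x => (-1) * P x + g x) (fun x => (-1) * P x + g x) <= e / 2.
  by rewrite ler_pdivrMl.
have h3 : t * F <= e / 2.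
  rewrite /t mulrAC ler_pdivrMr; last by lra.
  by rewrite ler_wpM2l ?divr_ge0 ?(ltW e0)//; lra.
lra.
Unshelve. all: by end_near. Qed.

(** The Bernstein polynomial of degree n, as the expectation of phi over the number
    of successes in n trials; the recursion conditions on the first trial and gives
    positivity and the first two moments by induction. *)
Fixpoint bern (n : nat) (phi : nat -> R) (x : R) : R :=
  if n is m.+1 then x * bern m (phi \o succn) x + (1 - x) * bern m phi x else phi 0%N.

Lemma bern_le n (phi psi : nat -> R) x : 0 <= x <= 1 ->
  (forall j, phi j <= psi j) -> bern n phi x <= bern n psi x.
Proof.
move=> /andP[x0 x1]; elim: n phi psi => [|n IH] phi psi le; first exact: le.
rewrite /=; apply: lerD; rewrite ler_wpM2l ?subr_ge0//; apply: IH => // j; exact: le.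
Qed.

Lemma bern_quad n (al be ga x : R) :
  bern n (fun j => al + be * j%:R + ga * j%:R ^+ 2) x =
  al + be * (n%:R * x) + ga * (n%:R * x * (1 - x) + (n%:R * x) ^+ 2).
Proof.
elim: n al be ga => [|n IH] al be ga; first by rewrite /=; ring.
rewrite /= IH.
have -> : (fun j : nat => al + be * j%:R + ga * j%:R ^+ 2) \o succn =
    (fun j => (al + be + ga) + (be + 2 * ga) * j%:R + ga * j%:R ^+ 2).
  by apply/funext => j; rewrite /= -natr1; ring.
by rewrite IH -natr1; ring.
Qed.

Lemma bern_bound n (phi : nat -> R) M x : 0 <= x <= 1 ->
  (forall j, `|phi j| <= M) -> `|bern n phi x| <= M.
Proof.
move=> hx le.
have cM c : bern n (fun=> c) x = c.
  have := bern_quad n c 0 0 x.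
  have -> : (fun j : nat => c + 0 * j%:R + 0 * j%:R ^+ 2) = (fun=> c).
    by apply/funext => j; ring.
  by move=> ->; ring.
rewrite ler_norml; apply/andP; split.
  by rewrite -(cM (- M)); apply: bern_le => // j; have := le j; rewrite ler_norml => /andP[].
by rewrite -(cM M); apply: bern_le => // j; have := le j; rewrite ler_norml => /andP[].
Qed.

(** Chebyshev's argument: G differs from G y by at most a constant plus K (z - y)^2,
    and the variance of j/n is y (1 - y)/n. *)
Lemma bern_cvg (G : R -> R) M y : 0 < y < 1 -> (forall z, `|G z| <= M) ->
  {for y, continuous G} -> bern n (fun j => G (j%:R / n%:R)) y @[n --> \oo] --> G y.
Proof.
move=> /andP[y0 y1] GM cG; apply/cvgrPdist_le => e e0.
have M0 : 0 <= M := le_trans (normr_ge0 _) (GM 0).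
have e2 : 0 < e / 2 by rewrite divr_gt0.
have /cvgrPdist_le/(_ _ e2) := cG; move=> /nbhs_ballP[d /= d0 hd].
pose K := 2 * M / d ^+ 2.
have K0 : 0 <= K by rewrite divr_ge0 ?sqr_ge0// mulr_ge0.
have loc z : `|G z - G y| <= e / 2 + K * (z - y) ^+ 2.
  have [zy|zy] := ltP `|y - z| d.
    have := hd z zy; rewrite distrC => /le_trans; apply.
    by rewrite lerDl mulr_ge0// sqr_ge0.
  apply: (@le_trans _ _ (2 * M)).
    by apply: (le_trans (ler_normB _ _)); have := GM z; have := GM y; lra.
  have : d ^+ 2 <= (z - y) ^+ 2.
    by rewrite -[(z - y) ^+ 2]real_normK ?num_real// distrC lerXn2r ?nnegrE// ltW.
  move=> h; apply: (@le_trans _ _ (K * (z - y) ^+ 2)); last by rewrite lerDr ltW.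
  by rewrite /K mulrAC ler_pdivlMr ?exprn_gt0// ler_wpM2l// mulr_ge0.
near=> n.
have n0 : 0 < n%:R :> R by rewrite ltr0n; near: n; exact: nbhs_infty_gt.
have nK : K / (e / 2) <= n%:R by near: n; exact: nbhs_infty_ger.
have yy : 0 <= y <= 1 by rewrite !ltW.
pose q (s : R) (j : nat) : R := (G y + s * (e / 2 + K * y ^+ 2)) +
   (s * (- 2 * K * y / n%:R)) * j%:R + (s * (K / n%:R ^+ 2)) * j%:R ^+ 2.
have qE s j : q s j = G y + s * (e / 2 + K * (j%:R / n%:R - y) ^+ 2).
  by rewrite /q; field; rewrite gt_eqF.
have up : bern n (fun j => G (j%:R / n%:R)) y <= bern n (q 1) y.
  apply: bern_le => // j; rewrite qE mul1r -lerBlDl.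
  by apply: le_trans (loc _); rewrite ler_norm.
have lo : bern n (q (-1)) y <= bern n (fun j => G (j%:R / n%:R)) y.
  apply: bern_le => // j; rewrite qE mulN1r lerBlDr -lerBlDl.
  by apply: le_trans (loc (j%:R / n%:R)); rewrite distrC ler_norm.
have bE s : bern n (q s) y = G y + s * (e / 2 + K * (y * (1 - y)) / n%:R).
  by rewrite /q bern_quad; field; rewrite gt_eqF.
rewrite bE mul1r in up; rewrite bE mulN1r in lo.
have Kn : K * (y * (1 - y)) / n%:R <= e / 2.
  rewrite ler_pdivrMr//; move: nK; rewrite ler_pdivrMr// => h.
  have yy1 : y * (1 - y) <= 1 by nra.
  by have := ler_wpM2l K0 yy1; lra.
by rewrite ler_norml; apply/andP; split; lra.
Unshelve. all: by end_near. Qed.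

(** Each step of the recursion multiplies by a polynomial of degree 1 in
    cos (pi x). *)
Lemma sine_sum_bern n (phi : nat -> R) g : sine_sum g ->
  sine_sum (fun x => bern n phi ((1 - cos (pi * x)) / 2) * g x).
Proof.
elim: n phi g => [|n IH] phi g sg /=.
  have -> : (fun x => phi 0%N * g x) = (fun x => phi 0%N * g x + 0) by apply/funext => x; rewrite addr0.
  by apply: sine_sum_lin => //; exact: sine_sum0.
set y := fun x => (1 - cos (pi * x)) / 2.
have s1 := sine_sum_cos sg.
have a1 := IH (phi \o succn) _ sg; have a2 := IH (phi \o succn) _ s1.
have b1 := IH phi _ sg; have b2 := IH phi _ s1.
have := sine_sum_lin (2^-1) a1 (sine_sum_lin (- 2^-1) a2 (sine_sum_lin 2^-1 b1 (sine_sum_lin 2^-1 b2 sine_sum0))).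
set h1 := (fun _ => _); set h2 := (fun _ => _); suff -> : h1 = h2 by [].
apply/funext => x; rewrite /h1 /h2.
have -> : cos (pi * x) = 1 - 2 * y x by rewrite /y; field.
by rewrite /comp; field.
Qed.
End Parseval.

(** * Completeness of the sine functions *)
Section Completeness.
Context {R : realType}.
Implicit Types (f g P : R -> R) (c t x y u v : R).
Notation mu := (@lebesgue_measure R).

Lemma dominated_small (g_ : nat -> R -> R) (h : R -> R) x1 e :
  (forall n, measurable_fun (`]0, 1[ : set R) (g_ n)) ->
  mu.-integrable `]0, 1[ (EFin \o h) ->
  (forall n x, 0 < x < 1 -> 0 <= g_ n x <= h x) ->
  (forall x, 0 < x < 1 -> x != x1 -> g_ n x @[n --> \oo] --> (0 : R)) ->
  0 < e -> exists n, (\int[mu]_(x in `]0, 1[) g_ n x)%R <= e.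
Proof.
move=> mg ih gh g0 e0.
have mg' n : measurable_fun (`]0, 1[ : set R) (fun x => (g_ n x)%:E) by exact/measurable_EFinP.
have ae1 : \forall x \ae mu, (`]0, 1[%classic : set R) x -> (g_ n x)%:E @[n --> \oo] --> (0 : R)%:E.
  exists [set x1]; split; [by []|exact: lebesgue_measure_set1|].
  move=> x /= /not_implyP[]; rewrite in_itv/= => hx; apply: contra_notP => /eqP x1x.
  by apply: cvg_EFin; [exact: nearW|exact: g0].
have ae2 : \forall x \ae mu, forall n, (`]0, 1[%classic : set R) x -> (`|(g_ n x)%:E| <= (h x)%:E)%E.
  apply: aeW => x n; rewrite /= in_itv/= => hx; rewrite lee_fin.
  by have /andP[h0 h1] := gh n x hx; rewrite ger0_norm.
have [_ _] := @dominated_convergence _ _ _ mu _ (measurable_itv _) (fun n x => (g_ n x)%:E)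
  (cst 0%E) _ mg' (measurable_cst _) ae1 ih ae2.
rewrite integral0 => /fine_cvg/cvgrPdist_le/(_ _ e0)[n _ /(_ n (leqnn n))/= hn].
exists n; move: hn; rewrite sub0r normrN; exact: le_trans (ler_norm _).
Qed.

Definition supported u v f := forall x, 0 < x < 1 -> ~~ (u <= x <= v) -> f x = 0.
Definition continuous_off x1 f := forall x, 0 < x < 1 -> x != x1 -> {for x, continuous f}.

Lemma sin_pi_lower u v : 0 < u -> u <= v -> v < 1 ->
  exists2 m : R, 0 < m & forall x, u <= x <= v -> m <= sin (pi * x).
Proof.
move=> u0 uv v1.
have cs : {within `[u, v], continuous (fun x : R => sin (pi * x))}.
  by apply: continuous_in_within => x _; exact: is_derive_continuous (is_derive_sin_lin _ x).
have [c cuv hc] := EVT_min uv cs; exists (sin (pi * c)).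
  move: cuv; rewrite in_itv/= => /andP[uc cv]; apply: sin_gt0_pi.
  rewrite mulr_gt0 ?pi_gt0//=; last exact: lt_le_trans uc.
  by rewrite -[ltRHS]mulr1 ltr_pM2l ?pi_gt0// (le_lt_trans cv).
by move=> x hx; apply: hc; rewrite in_itv.
Qed.

(** Dividing by sin (pi x) is harmless on the support, and (1 - cos (pi x))/2 is a
    coordinate on ]0, 1[.  The Bernstein polynomials of the quotient in that
    coordinate are bounded and converge off one point, hence in L2. *)
Lemma L2_approx_bounded f u v x1 M e : 0 < u -> u <= v -> v < 1 ->
  measurable_fun (`]0, 1[ : set R) f -> (forall x, `|f x| <= M) ->
  supported u v f -> continuous_off x1 f -> 0 < e ->
  exists2 P, sine_sum P &
    pairing (fun x => (-1) * P x + f x) (fun x => (-1) * P x + f x) <= e.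
Proof.
move=> u0 uv v1 mf fM sf cf e0.
have [m m0 hm] := sin_pi_lower u0 uv v1.
have M0 : 0 <= M := le_trans (normr_ge0 _) (fM 0).
pose ka x := if u <= x <= v then f x / sin (pi * x) else 0.
have kaM x : `|ka x| <= M / m.
  rewrite /ka; case: ifP => [hx|_]; last by rewrite normr0 divr_ge0// ltW.
  have s0 := hm x hx; have s1 : 0 < sin (pi * x) by exact: lt_le_trans s0.
  rewrite normrM normfV (gtr0_norm s1) ler_pdivrMr// mulrAC ler_pdivlMr//.
  by apply: ler_pM => //; exact: ltW.
have sx0 x : 0 < x < 1 -> 0 < sin (pi * x).
  move=> /andP[x0 x1']; apply: sin_gt0_pi; rewrite mulr_gt0 ?pi_gt0//=.
  by rewrite -[ltRHS]mulr1 ltr_pM2l ?pi_gt0.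
have kaE x : 0 < x < 1 -> ka x = f x / sin (pi * x).
  by move=> hx; rewrite /ka; case: ifP => // /negbT h; rewrite sf// mul0r.
have cka x : 0 < x < 1 -> x != x1 -> {for x, continuous ka}.
  move=> hx xx1.
  have c1 : {for x, continuous (fun x => f x / sin (pi * x))}.
    apply: cvgM; first exact: cf.
    apply: cvgV; first by rewrite gt_eqF// sx0.
    exact: is_derive_continuous (is_derive_sin_lin _ x).
  rewrite /prop_for /continuous_at kaE//; apply: cvg_trans c1; apply: near_eq_cvg.
  by apply: filterS (near_open_itv hx) => y hy; rewrite kaE.
pose G y := ka (acos (1 - 2 * y) / pi).
have GM z : `|G z| <= M / m by exact: kaM.
pose Y x : R := (1 - cos (pi * x)) / 2.
have pix x : 0 < x < 1 -> (0 < pi * x < pi).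
  move=> /andP[h0 h1]; rewrite mulr_gt0 ?pi_gt0//=.
  by rewrite -[ltRHS]mulr1 ltr_pM2l ?pi_gt0.
have acY x : 0 < x < 1 -> acos (1 - 2 * Y x) / pi = x.
  move=> hx; have -> : 1 - 2 * Y x = cos (pi * x) by rewrite /Y; field.
  rewrite cosK; first by rewrite mulrAC divff ?mul1r// gt_eqF ?pi_gt0.
  by rewrite in_itv/=; have /andP[h0 h1] := pix x hx; rewrite !ltW.
have cosb x : 0 < x < 1 -> -1 < cos (pi * x) < 1.
  move=> hx; have /andP[h0 h1] := pix x hx.
  have := sin_gt0_pi (pix x hx); have := cos2Dsin2 (pi * x); nra.
have Y01 x : 0 < x < 1 -> 0 < Y x < 1.
  by move=> /cosb/andP[h0 h1]; rewrite /Y; apply/andP; split; lra.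
have cG x : 0 < x < 1 -> x != x1 -> {for Y x, continuous G}.
  move=> hx xx1; rewrite /G.
  apply: (@continuous_comp _ _ _ (fun y => acos (1 - 2 * y) / pi) ka); last first.
    by rewrite acY//; exact: cka.
  apply: cvgM; last exact: cvg_cst.
  apply: (@continuous_comp _ _ _ (fun y : R => 1 - 2 * y) acos).
    apply: cvgB; first exact: cvg_cst.
    by apply: cvgM; [exact: cvg_cst|exact: cvg_id].
  apply: continuous_acos; have -> : 1 - 2 * Y x = cos (pi * x) by rewrite /Y; field.
  exact: cosb.
pose P n x := bern n (fun j => G (j%:R / n%:R)) (Y x) * ((Num.sqrt 2)^-1 * eigfun 1 x + 0).
have s2 : (Num.sqrt 2)^-1 * Num.sqrt 2 = 1 :> R by rewrite mulVf// gt_eqF ?sqrtr_gt0.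
have PE n x : P n x = bern n (fun j => G (j%:R / n%:R)) (Y x) * sin (pi * x).
  by rewrite /P /eigfun addr0 [_^-1 * (_ * _)]mulrA s2 !mul1r.
have sP n : sine_sum (P n).
  by apply: (sine_sum_bern n (fun j => G (j%:R / n%:R))); do 2 constructor.
have PM n x : 0 < x < 1 -> `|P n x| <= M / m.
  move=> hx; rewrite PE normrM -[leRHS]mulr1; apply: ler_pM => //; last exact: sin_max.
  by apply: bern_bound => [|j//]; have /andP[h0 h1] := Y01 x hx; rewrite !ltW.
pose g_ n x := ((-1) * P n x + f x) * ((-1) * P n x + f x).
have [||||n hn] := @dominated_small g_ (cst ((M / m + M) ^+ 2)) x1 e _ _ _ _ e0.
- move=> n; have [mP _] := L2_sine_sum (sP n).
  have m1 : measurable_fun (`]0, 1[ : set R) (fun x => (-1) * P n x + f x).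
    by apply: measurable_funD => //; apply: measurable_funM => //; exact: measurable_cst.
  exact: measurable_funM.
- have s1 : sing 0 1 (cst ((M / m + M) ^+ 2)).
    apply: (@sing_bounded _ _ _ _ ((M / m + M) ^+ 2)); rewrite ?sqr_ge0//.
      by move=> x _; exact: cvg_cst.
    by move=> x _; rewrite ger0_norm ?sqr_ge0.
  exact: sing_integrable s1.
- move=> n x hx; rewrite /g_ -expr2 sqr_ge0/= -real_normK ?num_real//.
  rewrite lerXn2r ?nnegrE ?addr_ge0 ?divr_ge0 ?(ltW m0)//.
  apply: (le_trans (ler_normD _ _)); rewrite mulN1r normrN; apply: lerD => //; exact: PM.
- move=> x hx xx1.
  have hb : bern n (fun j => G (j%:R / n%:R)) (Y x) @[n --> \oo] --> G (Y x).
    exact: bern_cvg (Y01 x hx) GM (cG x hx xx1).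
  have hP : P n x @[n --> \oo] --> f x.
    have -> : f x = G (Y x) * sin (pi * x).
      by rewrite /G acY// kaE// divfK// gt_eqF// sx0.
    under eq_fun do rewrite PE.
    by apply: cvgM => //; exact: cvg_cst.
  have h1 : ((-1) * P n x + f x) @[n --> \oo] --> (0 : R).
    rewrite -(subrr (f x)).
    under eq_fun do rewrite mulN1r addrC.
    by apply: cvgB => //; exact: cvg_cst.
  by have := cvgM h1 h1; rewrite mulr0; apply.
by exists (P n) => //; exact: sP.
Qed.

Definition clamp m f x := Num.max (- m) (Num.min (f x) m).

Lemma clamp_bound m f x : 0 <= m -> `|clamp m f x| <= m.
Proof.
move=> m0; rewrite /clamp ler_norml le_max lexx/= ge_max ge_min lexx orbT andbT.
by lra.
Qed.

Lemma clamp_dist m f x : 0 <= m -> `|(-1) * clamp m f x + f x| <= `|f x|.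
Proof.
move=> m0; rewrite /clamp /Num.max /Num.min.
case: (ltP (f x) m) => h1; case: ifP => h2.
- by rewrite mulN1r addNr normr0.
- move: h2 => /negbT; rewrite -leNgt => h2.
  rewrite ler0_norm; last by lra.
  by rewrite ler0_norm; lra.
- by rewrite ger0_norm; [rewrite ger0_norm; lra|lra].
- move: h2 => /negbT; rewrite -leNgt => h2.
  by rewrite ger0_norm; [rewrite ger0_norm; lra|lra].
Qed.

Lemma clamp_id m f x : `|f x| <= m -> clamp m f x = f x.
Proof.
rewrite ler_norml => /andP[h1 h2]; rewrite /clamp.
by rewrite (min_idPl h2) (max_idPr h1).
Qed.

Lemma clamp_continuous m f x : {for x, continuous f} -> {for x, continuous (clamp m f)}.
Proof.
move=> cf; have -> : clamp m f =
    fun x => (- m + (f x + m - `|f x - m|) / 2 + `|- m - (f x + m - `|f x - m|) / 2|) / 2.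
  by apply/funext => y; rewrite /clamp maxr_absE minr_absE.
have c1 : {for x, continuous (fun x => (f x + m - `|f x - m|) / 2)}.
  apply: cvgM; last exact: cvg_cst.
  apply: cvgB; first by apply: cvgD => //; exact: cvg_cst.
  by apply: cvg_norm; apply: cvgB => //; exact: cvg_cst.
apply: cvgM; last exact: cvg_cst.
apply: cvgD; first by apply: cvgD => //; exact: cvg_cst.
by apply: cvg_norm; apply: cvgB => //; exact: cvg_cst.
Qed.

(** An unbounded function is first truncated. *)
Lemma L2_approx f u v x1 e : 0 < u -> u <= v -> v < 1 -> L2 f ->
  supported u v f -> continuous_off x1 f -> 0 < e ->
  exists2 P, sine_sum P &
    pairing (fun x => (-1) * P x + f x) (fun x => (-1) * P x + f x) <= e.
Proof.
move=> u0 uv v1 lf sf cf e0; have [mf If] := lf.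
have e4 : 0 < e / 4 by rewrite divr_gt0.
have mc m : measurable_fun (`]0, 1[ : set R) (clamp m f).
  apply: measurable_maxr; first exact: measurable_cst.
  by apply: measurable_minr => //; exact: measurable_cst.
pose d m x := (-1) * clamp m f x + f x.
have md m : measurable_fun (`]0, 1[ : set R) (d m).
  by apply: measurable_funD => //; apply: measurable_funM => //; exact: measurable_cst.
have [||||n hn] := @dominated_small (fun n x => d n%:R x * d n%:R x) (fun x => f x ^+ 2) x1 (e / 4) _ _ _ _ e4.
- by move=> n; exact: measurable_funM.
- exact: If.
- move=> n x hx; rewrite -expr2 sqr_ge0/= -real_normK ?num_real// -[leRHS]real_normK ?num_real//.
  by rewrite lerXn2r ?nnegrE// clamp_dist.
- move=> x hx xx1; apply: cvg_near_cst; near=> n.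
  rewrite /d clamp_id; first by rewrite mulN1r addNr mul0r.
  by near: n; exact: nbhs_infty_ger.
have n0 : 0 <= n%:R :> R by [].
have lc : L2 (clamp n%:R f) by apply: (@L2_bounded _ _ n%:R) => // x _; exact: clamp_bound.
have [|||P sP hP] := @L2_approx_bounded (clamp n%:R f) u v x1 n%:R (e / 4) u0 uv v1 (mc _) _ _ _ e4.
- by move=> x; exact: clamp_bound.
- by move=> x hx hn'; rewrite clamp_id sf// normr0.
- by move=> x hx xx1; apply: clamp_continuous; exact: cf.
exists P => //.
have lP := L2_sine_sum sP.
have l1 : L2 (fun x => (-1) * P x + clamp n%:R f x) by exact: L2_lin.
have l2 : L2 (d n%:R) by exact: L2_lin.
set p1 := (fun x => (-1) * P x + clamp n%:R f x) in hP l1 *.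
have -> : (fun x => (-1) * P x + f x) = (fun x => 1 * p1 x + d n%:R x).
  by apply/funext => x; rewrite /p1 /d; ring.
have := pairing_ge0 (fun x => (-1) * p1 x + d n%:R x).
rewrite !(pairing_lin_sqr _ l1 l2).
move: hn; rewrite -/(pairing (d n%:R) (d n%:R)); lra.
Unshelve. all: by end_near. Qed.

Lemma parseval f g u v x1 : 0 < u -> u <= v -> v < 1 -> L2 f -> L2 g ->
  supported u v g -> continuous_off x1 g ->
  \sum_(1 <= n < N) fcoef f n * fcoef g n @[N --> \oo] --> pairing f g.
Proof.
move=> u0 uv v1 lf lg sg cg; apply: parseval_of_approx => // e e0.
exact: L2_approx u0 uv v1 lg sg cg e0.
Qed.
End Completeness.

(** * The leading term and the second orthogonality condition *)
Section SecondOrder.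
Context {R : realType}.
Implicit Types (f : R -> R) (m a : nat -> R) (k n N : nat).
Notation mu := (@lebesgue_measure R).

(** The product formula for cos (k pi x) sin (n pi x) produces the coefficients of
    index n + k and n - k; the latter is extended to n < k as an odd sequence. *)
Definition shift_mean m k n : R :=
  (m (n + k)%N + (if (k < n)%N then m (n - k)%N else if (n < k)%N then - m (k - n)%N else 0)) / 2.

Lemma fcoef_mul_cos f k n : L2 f ->
  fcoef (fun x => f x * cos (k%:R * pi * x)) n = shift_mean (fcoef f) k n.
Proof.
move=> lf; rewrite /shift_mean.
pose r := if (k < n)%N then 1 else if (n < k)%N then -1 else 0 : R.
have -> : (if (k < n)%N then fcoef f (n - k) else if (n < k)%N then - fcoef f (k - n) else 0)
  = r * fcoef f (`|n - k|%N).
  rewrite /r; case: ifP => [h|_]; first by rewrite mul1r distnEl// ltnW.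
  case: ifP => [h|_]; last by rewrite mul0r.
  by rewrite mulN1r distnC distnEl// ltnW.
have E x : cos (k%:R * pi * x) * eigfun n x =
   2^-1 * eigfun (n + k) x + ((r / 2) * eigfun `|n - k|%N x + 0).
  rewrite /eigfun natrD !mulrDl sinD /r; case: (ltngtP k n) => h.
  - rewrite (distnEl (ltnW h)) (natrB _ (ltnW h))// !mulrBl sinB; set S := Num.sqrt _.
    by move: (sin _) (sin _) (cos _) (cos _) => a b c d; field.
  - rewrite distnC (distnEl (ltnW h)) (natrB _ (ltnW h))// !mulrBl sinB; set S := Num.sqrt _.
    by move: (sin _) (sin _) (cos _) (cos _) => a b c d; field.
  - rewrite h; set S := Num.sqrt _.
    by move: (sin _) (cos _) => a b; field.
have l0 := @L2_0 R.
have l1 := L2_lin (r / 2) (L2_eigfun `|n - k|%N) l0.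
rewrite /fcoef; transitivity (pairing (fun x => 2^-1 * eigfun (n + k) x +
   ((r / 2) * eigfun `|n - k|%N x + 0)) f).
  by rewrite /pairing; apply: eq_Rintegral => x _; rewrite -mulrA E mulrC.
rewrite (pairing_lin _ (L2_eigfun _) l1 lf) (pairing_lin _ (L2_eigfun _) l0 lf).
by rewrite pairing0l !(pairingC (eigfun _)); field.
Qed.

(** The weight n^2 - k^2/2 of the kernel sum does not match the weight n (n + k) of
    Parseval's sum; the mismatch of the pair (n, n + k) shows up with opposite
    signs at n and at n + k. *)
Definition defect m k (j : nat) : R :=
  m j * m (j + k)%N / (j%:R * (j + k)%:R) * (j%:R * k%:R + k%:R ^+ 2 / 2).

Lemma defect_bound m k C j : (forall n, `|m n| <= C) -> (0 < j)%N ->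
  `|defect m k j| <= C ^+ 2 * k%:R / j%:R.
Proof.
move=> mC j0; have C0 : 0 <= C := le_trans (normr_ge0 _) (mC 0%N).
have j1 : 0 < j%:R :> R by rewrite ltr0n.
have k1 : 0 <= k%:R :> R by [].
have -> : defect m k j = (m j * m (j + k)%N) * (k%:R / j%:R * ((j%:R + k%:R / 2) / (j%:R + k%:R))).
  rewrite /defect natrD; field; rewrite !gt_eqF//; lra.
have h0 : 0 <= (j%:R + k%:R / 2) / (j%:R + k%:R) :> R by rewrite divr_ge0//; lra.
have h1 : (j%:R + k%:R / 2) / (j%:R + k%:R) <= 1 :> R by rewrite ler_pdivrMr; lra.
have h2 : 0 <= k%:R / j%:R :> R by rewrite divr_ge0// ltW.
rewrite normrM (ger0_norm (mulr_ge0 h2 h0)) -mulrA.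
apply: ler_pM; [exact: normr_ge0|exact: mulr_ge0| |].
  by rewrite normrM expr2; apply: ler_pM.
by rewrite -[leRHS]mulr1 ler_wpM2l.
Qed.

Lemma pair_coef_level m k n : (0 < k)%N -> (0 < n)%N ->
  pair_coef k (fun i => m i / i%:R) n * eigval_shift n k - (2 * pi ^+ 2) * (m n * shift_mean m k n) =
  pi ^+ 2 * (- defect m k n + (if (k < n)%N then defect m k (n - k)
    else if (n < k)%N then m n * m (k - n)%N / (n%:R * (k - n)%:R) * (n%:R * k%:R - k%:R ^+ 2 / 2) else 0)).
Proof.
move=> k0 n0; rewrite /pair_coef /eigval_shift /eigval /shift_mean.
have n1 : n%:R != 0 :> R by rewrite pnatr_eq0 -lt0n.
have nk1 : n%:R + k%:R != 0 :> R by rewrite -natrD pnatr_eq0 -lt0n addn_gt0 n0.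
case: (ltngtP k n) => h.
- have h1 : n%:R - k%:R != 0 :> R by rewrite -(natrB _ (ltnW h)) pnatr_eq0 -lt0n subn_gt0.
  rewrite (distnEl (ltnW h))/= /defect (subnK (ltnW h)) natrD (natrB _ (ltnW h)).
  move: n1 nk1 h1; move: (n%:R : R) (k%:R : R) (m n) (m (n + k)%N) (m (n - k)%N) => y z a b c n1 nk1 h1.
  by field; rewrite n1 nk1 h1.
- have h1 : k%:R - n%:R != 0 :> R by rewrite -(natrB _ (ltnW h)) pnatr_eq0 -lt0n subn_gt0.
  rewrite distnC (distnEl (ltnW h))/= /defect natrD (natrB _ (ltnW h)).
  move: n1 nk1 h1; move: (n%:R : R) (k%:R : R) (m n) (m (n + k)%N) (m (k - n)%N) => y z a b c n1 nk1 h1.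
  by field; rewrite n1 nk1 h1.
- rewrite /defect -h/= natrD; rewrite -h in nk1 n1.
  move: n1 nk1; move: (k%:R : R) (m k) (m (k + k)%N) => y a b n1 nk1.
  by field; rewrite n1 nk1.
Qed.

(** The mismatches of the pairs (n, k - n), for n < k, are antisymmetric and cancel;
    the others telescope over steps of length k. *)
Lemma sum_defect m k M : (0 < k)%N ->
  \sum_(1 <= n < M.+1 + k) (- defect m k n + (if (k < n)%N then defect m k (n - k)
    else if (n < k)%N then m n * m (k - n)%N / (n%:R * (k - n)%:R) * (n%:R * k%:R - k%:R ^+ 2 / 2) else 0))
  = - \sum_(0 <= i < k) defect m k (i + M.+1).
Proof.
move=> k0; rewrite big_split/= sumrN.
set S2 := (X in _ + X); set S1 := (X in - X + _).
have -> : S2 = \sum_(1 <= j < M.+1) defect m k j.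
  rewrite /S2 (@big_cat_nat _ _ _ k)//=; last exact: leq_addl.
  set T := (X in X + _).
  have T0 : T = 0.
    have TT : T = - T.
      rewrite {1}/T big_nat_rev/= /T -sumrN big_nat_cond [RHS]big_nat_cond; apply: eq_bigr => i /andP[/andP[i1 ik] _].
      have e1 : (1 + k - i.+1)%N = (k - i)%N by rewrite addnC addn1 subSS.
      rewrite e1 subKn; last exact: ltnW.
      have -> : (k < k - i)%N = false by rewrite ltnNge leq_subr.
      have -> : (k - i < k)%N by rewrite ltn_subrL i1.
      rewrite [(k < i)%N]ltnNge (ltnW ik)/= ik.
      have : (k - i)%:R != 0 :> R by rewrite pnatr_eq0 -lt0n subn_gt0.
      have i0 : i%:R != 0 :> R by rewrite pnatr_eq0 -lt0n.
      by rewrite natrB ?(ltnW ik)// => h1; field; rewrite ?h1 ?i0.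
    lra.
  rewrite T0 add0r big_ltn; last by rewrite -[ltnLHS]add0n ltn_add2r.
  rewrite ltnn add0r -add1n big_addn addnK big_nat_cond [RHS]big_nat_cond.
  apply: eq_bigr => i /andP[/andP[i1 _] _].
  by rewrite addnK leq_add2r i1.
rewrite /S1 (@big_cat_nat _ _ _ M.+1)//=; last exact: leq_addr.
have -> : \sum_(M.+1 <= i < M.+1 + k) defect m k i = \sum_(0 <= i < k) defect m k (i + M.+1).
  by rewrite -{1}[M.+1]add0n big_addn addnC addnK.
by ring.
Qed.

(** The k surviving mismatches tend to 0, so the kernel sum and Parseval's sum have
    proportional limits. *)
Lemma pair_coef_level_cvg0 m k C : (0 < k)%N -> (forall n, `|m n| <= C) ->
  \sum_(1 <= n < N) (m n * shift_mean m k n) @[N --> \oo] --> (0 : R) ->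
  \sum_(1 <= n < N) (pair_coef k (fun i => m i / i%:R) n * eigval_shift n k) @[N --> \oo] --> (0 : R).
Proof.
move=> k0 mC h.
rewrite -(@cvg_shiftn k.+1).
have hs : (2 * pi ^+ 2) * (\sum_(1 <= n < N + k.+1) (m n * shift_mean m k n)) @[N --> \oo] --> (0 : R).
  move: h; rewrite -(@cvg_shiftn k.+1) => h.
  have h2 : (2 * pi ^+ 2 : R) @[N --> \oo] --> (2 * pi ^+ 2 : R) by exact: cvg_cst.
  by have := cvgM h2 h; rewrite mulr0; apply.
have hd : - (pi ^+ 2 * \sum_(0 <= i < k) defect m k (i + N.+1)) @[N --> \oo] --> (0 : R).
  have dc i : defect m k (i + N.+1) @[N --> \oo] --> (0 : R).
    have b0 : C ^+ 2 * k%:R * N.+1%:R^-1 @[N --> \oo] --> (0 : R).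
      have h2 : (C ^+ 2 * k%:R : R) @[N --> \oo] --> (C ^+ 2 * k%:R : R) by exact: cvg_cst.
      by have := cvgM h2 (@cvg_harmonic R); rewrite mulr0; apply.
    apply/cvgr0Pnorm_le => e e0; move/cvgr0Pnorm_le: b0 => /(_ _ e0).
    apply: filterS => N; apply: le_trans.
    have := @defect_bound m k C (i + N.+1) mC; rewrite addnS => /(_ isT) /le_trans; apply.
    apply: le_trans (ler_norm _); rewrite ler_wpM2l ?(mulr_ge0 (sqr_ge0 C) (ler0n _ _))//.
    by rewrite lef_pV2 ?posrE ?ltr0n// ler_nat ltnS leq_addl.
  have fin K : \sum_(0 <= i < K) defect m k (i + N.+1) @[N --> \oo] --> (0 : R).
    elim: K => [|K IH]; first by under eq_fun do rewrite big_geq//; exact: cvg_cst.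
    under eq_fun do rewrite big_nat_recr//=.
    by have := cvgD IH (dc K); rewrite addr0; apply.
  have h2 : (pi ^+ 2 : R) @[N --> \oo] --> (pi ^+ 2 : R) by exact: cvg_cst.
  by have := cvgN (cvgM h2 (fin k)); rewrite mulr0 oppr0; apply.
have E N : (2 * pi ^+ 2) * (\sum_(1 <= n < N + k.+1) (m n * shift_mean m k n)) +
    - (pi ^+ 2 * \sum_(0 <= i < k) defect m k (i + N.+1)) =
  \sum_(1 <= n < N + k.+1) (pair_coef k (fun i => m i / i%:R) n * eigval_shift n k).
  rewrite -mulrN -sum_defect// !mulr_sumr addnS -addSn -big_split/= big_nat_cond [RHS]big_nat_cond.
  apply: eq_bigr => n /andP[/andP[n1 _] _].
  by rewrite -(pair_coef_level m k0 n1) addrC subrK.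
have hsd := cvgD hs hd; rewrite addr0 in hsd.
suff <- : (fun N => (2 * pi ^+ 2) * (\sum_(1 <= n < N + k.+1) (m n * shift_mean m k n)) +
    - (pi ^+ 2 * \sum_(0 <= i < k) defect m k (i + N.+1))) =
  (fun N => \sum_(1 <= n < N + k.+1) (pair_coef k (fun i => m i / i%:R) n * eigval_shift n k)) by exact: hsd.
by apply/funext.
Qed.
End SecondOrder.

(** * Smooth functions on the unit interval *)
Section SmoothFunctions.
Context {R : realType}.
Implicit Types (f g phi chi : R -> R) (a b c x s : R) (n k : nat).
Notation mu := (@lebesgue_measure R).

Lemma near_right_ex a (P : R -> Prop) : (\forall x \near a^'+, P x) ->
  exists2 d : R, 0 < d & forall x, a < x < a + d -> P x.
Proof.
move=> [d /= d0 hd]; exists d => // x /andP[ax xd]; apply: hd => //=.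
by rewrite ltr0_norm ?subr_lt0//; lra.
Qed.

Lemma near_left_ex a (P : R -> Prop) : (\forall x \near a^'-, P x) ->
  exists2 d : R, 0 < d & forall x, a - d < x < a -> P x.
Proof.
move=> [d /= d0 hd]; exists d => // x /andP[ax xd]; apply: hd => //=.
by rewrite gtr0_norm ?subr_gt0//; lra.
Qed.

Lemma near_ball_ex a (P : R -> Prop) : (\forall x \near a, P x) ->
  exists2 d : R, 0 < d & forall x, a - d < x < a + d -> P x.
Proof.
move=> /nbhs_ballP[d /= d0 hd]; exists d => // x /andP[ax xd]; apply: hd => //=.
by rewrite /ball/= ltr_norml; apply/andP; split; lra.
Qed.

(** Near the ends by the existence of limits, in between by compactness. *)
Lemma bounded_of_cvg_ends g a b : a < b ->
  (forall x, a < x < b -> {for x, continuous g}) ->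
  cvg (g x @[x --> a^'+]) -> cvg (g x @[x --> b^'-]) ->
  exists2 M : R, 0 <= M & forall x, a < x < b -> `|g x| <= M.
Proof.
move=> ab cg /cvg_ex[/= l hl] /cvg_ex[/= l' hl'].
have /near_right_ex[d d0 hd] : \forall x \near a^'+, `|l - g x| <= 1.
  by move/cvgrPdist_le : hl; apply.
have /near_left_ex[e e0 he] : \forall x \near b^'-, `|l' - g x| <= 1.
  by move/cvgrPdist_le : hl'; apply.
pose d' := Num.min d ((b - a) / 3); pose e' := Num.min e ((b - a) / 3).
have d'0 : 0 < d' by rewrite lt_min d0; lra.
have e'0 : 0 < e' by rewrite lt_min e0; lra.
have d'd : d' <= d by rewrite ge_min lexx.
have e'e : e' <= e by rewrite ge_min lexx.
have d'3 : d' <= (b - a) / 3 by rewrite ge_min lexx orbT.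
have e'3 : e' <= (b - a) / 3 by rewrite ge_min lexx orbT.
have le1 : a + d' / 2 <= b - e' / 2 by lra.
have cin : {within `[a + d' / 2, b - e' / 2], continuous (fun x => `|g x|)}.
  apply: continuous_in_within => x /andP[h1 h2]; apply: cvg_norm; apply: cg.
  by apply/andP; split; lra.
have [c _ hc] := EVT_max le1 cin.
exists (`|l| + 1 + (`|l'| + 1) + `|g c|); first by rewrite !addr_ge0.
have n1 := normr_ge0 l; have n2 := normr_ge0 l'; have n3 := normr_ge0 (g c).
move=> x /andP[ax xb].
have [h1|h1] := ltP x (a + d' / 2).
  have h : `|l - g x| <= 1 by apply: hd; rewrite ax/=; lra.
  by have := ler_normB l (l - g x); rewrite subKr; lra.
have [h2|h2] := ltP (b - e' / 2) x.
  have h : `|l' - g x| <= 1 by apply: he; rewrite xb andbT; lra.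
  by have := ler_normB l' (l' - g x); rewrite subKr; lra.
by have := hc x; rewrite in_itv/= h1 h2 => /(_ isT); lra.
Qed.

Lemma smooth_is_derive f n x : smooth01 f -> 0 < x < 1 ->
  is_derive x 1 (derive1n n f) (derive1n n.+1 f x).
Proof.
move=> [sf _ _] hx; have hx' : `]0, 1[%classic x by rewrite /= in_itv.
have d1 := sf n x hx'; apply: DeriveDef; first exact: d1.
by rewrite derive1nS derive1E.
Qed.

Lemma smooth_bounded f n : smooth01 f ->
  exists2 M : R, 0 <= M & forall x, 0 < x < 1 -> `|derive1n n f x| <= M.
Proof.
move=> sf; have [_ _ ends] := sf; have [e0 e1] := ends n.
apply: (bounded_of_cvg_ends ltr01 _ e0 e1) => x hx.
exact: is_derive_continuous (smooth_is_derive n sf hx).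
Qed.

Lemma locally_constant_derive1 f (l : R) x : (\forall y \near x, f y = l) -> derive1 f x = 0.
Proof.
move=> h; rewrite derive1E.
rewrite (@near_eq_derive _ _ _ f (cst l))// derive_cst//.
Qed.

Lemma smooth_cutoff chi a : 0 < a < 1 -> smooth01 chi ->
  (\forall x \near a, chi x = 1) ->
  (\forall x \near (1 : R), x \in `[0, 1] -> chi x = 0) ->
  exists c M, cutoff a 1 c chi (derive1n 1 chi) (derive1n 2 chi) M.
Proof.
move=> /andP[a0 a1] sc /near_ball_ex[d d0 hd] /near_ball_ex[e e0 he].
have [M0 p0 h0] := smooth_bounded 0 sc.
have [M1 p1 h1] := smooth_bounded 1 sc.
have [M2 p2 h2] := smooth_bounded 2 sc.
pose d' := Num.min d ((1 - a) / 2).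
have d'0 : 0 < d' by rewrite lt_min d0; lra.
have d'd : d' <= d by rewrite ge_min lexx.
have d'3 : d' <= (1 - a) / 2 by rewrite ge_min lexx orbT.
have in01 x : a < x < 1 -> 0 < x < 1 by move=> /andP[h ->]; rewrite (lt_trans a0).
have z1 x : a < x < a + d' -> derive1n 1 chi x = 0.
  move=> hx; apply: (@locally_constant_derive1 _ 1); apply: filterS (near_open_itv hx) => y /andP[hy1 hy2].
  by apply: hd; apply/andP; split; lra.
exists (a + d'), (M0 + M1 + M2); constructor.
- by rewrite ltrDl.
- lra.
- by rewrite !addr_ge0.
- by move=> x /in01; exact: (smooth_is_derive 0).
- by move=> x /in01; exact: (smooth_is_derive 1).
- by move=> x /in01 hx; exact: is_derive_continuous (smooth_is_derive 2 sc hx).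
- move=> x hx; have /andP[x1 x2] := hx; split.
  + by apply: hd; apply/andP; split; lra.
  + exact: z1.
  + apply: (@locally_constant_derive1 _ 0); apply: filterS (near_open_itv hx) => y; exact: z1.
- pose e' := Num.min e 1.
  have e'0 : 0 < e' by rewrite lt_min e0/=.
  have e'e : e' <= e by rewrite ge_min lexx.
  have e'1 : e' <= 1 by rewrite ge_min lexx orbT.
  have z x : 1 - e' < x < 1 -> chi x = 0.
    by move=> /andP[x1 x2]; apply: he; rewrite ?in_itv/=; apply/andP; split; lra.
  near=> x.
  have hx : 1 - e' < x < 1.
    apply/andP; split; near: x; last exact: nbhs_left_lt.
    by apply: nbhs_left_gt; rewrite ltrBlDr ltrDl.
  split; first exact: z.
  by apply: (@locally_constant_derive1 _ 0); apply: filterS (near_open_itv hx) => y; exact: z.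
- move=> x /in01 hx; have k0 := h0 x hx; have k1 := h1 x hx; have k2 := h2 x hx.
  by rewrite derive1n0 in k0; split; lra.
Unshelve. all: by end_near. Qed.

Lemma smooth_lipschitz f : smooth01 f ->
  exists2 K : R, 0 <= K & forall x y, 0 < x -> x <= y -> y < 1 -> `|f y - f x| <= K * (y - x).
Proof.
move=> sf; have [K K0 hK] := smooth_bounded 1 sf; exists K => // x y x0 xy y1.
have df z : x <= z <= y -> is_derive z 1 f (derive1n 1 f z).
  by move=> /andP[h1 h2]; apply: (smooth_is_derive 0) => //; apply/andP; split; lra.
have cf : {within `[x, y], continuous f}.
  by apply: continuous_in_within => z hz; exact: is_derive_continuous (df z hz).
have [|c hc E] := @MVT_segment _ f (derive1n 1 f) x y xy _ cf.
  move=> z; rewrite in_itv/= => /andP[h1 h2]; apply: df; lra.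
rewrite E normrM (ger0_norm (_ : 0 <= y - x)) ?subr_ge0//; apply: ler_wpM2r; first by rewrite subr_ge0.
by apply: hK; move: hc; rewrite in_itv/= => /andP[h1 h2]; apply/andP; split; lra.
Qed.
End SmoothFunctions.

(** * Finite parts *)
Section FinitePart.
Context {R : realType}.
Implicit Types (f g phi chi : R -> R) (a b c x s p : R) (n k : nat).
Notation mu := (@lebesgue_measure R).

(** The distribution is defined piecewise on ]0, 1[; this moves its integrals to the
    interval where the singular calculus applies. *)
Lemma restrict_unit a f g : 0 <= a < 1 -> (forall x, 0 < x <= a -> f x = 0) ->
  (forall x, a < x < 1 -> f x = g x) -> sing a 1 g ->
  mu.-integrable `]0, 1[ (EFin \o f) /\
  (\int[mu]_(x in `]0, 1[) f x = \int[mu]_(x in `]a, 1[) g x)%R.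
Proof.
move=> /andP[a0 a1] f0 fg sg.
have E x : x \in (`]0, 1[%classic : set R) -> (g \_ `]a, 1[%classic) x = f x.
  rewrite inE/= in_itv/= => /andP[x0 x1]; rewrite patchE.
  have [ax|xa] := ltP a x; first by rewrite mem_set ?fg ?ax//= in_itv/= ax.
  rewrite memNset ?f0 ?x0//= in_itv/= => /andP[ax _].
  by move: xa; rewrite leNgt ax.
have I := sing_integrable sg; split.
  have : mu.-integrable setT ((EFin \o g) \_ `]a, 1[).
    by have := proj1 (@integrable_mkcond _ _ _ mu `]a, 1[%classic (EFin \o g) (measurable_itv _)) I.
  rewrite restrict_EFin => J.
  have J1 : mu.-integrable `]0, 1[ (EFin \o g \_ `]a, 1[).
    by apply: (integrableS _ _ _ J) => //; exact: subsetT.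
  by apply: eq_integrable J1 => // x hx; rewrite /= -(E x hx).
have -> : (\int[mu]_(x in `]0, 1[) f x = \int[mu]_(x in `]0, 1[) (g \_ `]a, 1[) x)%R.
  by apply: eq_Rintegral => x hx; rewrite E.
rewrite -Rintegral_mkcondr; congr (Rintegral _ _ _).
apply/seteqP; split => x /=; rewrite !in_itv/=; first by case.
by move=> /andP[h1 h2]; rewrite h1 h2 (le_lt_trans a0).
Qed.

Lemma cvg_shift_right f a (l : R) : f x @[x --> a^'+] --> l -> f (a + e) @[e --> 0^'+] --> l.
Proof.
apply: cvg_comp => P [d /= d0 hd]; exists d => // e /=.
rewrite sub0r normrN => h e0; apply: hd; rewrite /=; last by rewrite ltrDl.
by rewrite opprD addrA subrr sub0r normrN.
Qed.

Lemma Rintegral_open_right f a b : (forall x, a < x < b -> {for x, continuous f}) ->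
  (\int[mu]_(x in `[a, b]) f x = \int[mu]_(x in `]a, b[) f x)%R.
Proof.
move=> cf; rewrite /Rintegral; congr fine.
have m1 : measurable_fun (`]a, b[ : set R) (EFin \o f).
  by apply/measurable_EFinP; exact: sing_measurable.
have [ab|ba] := ltP a b; last first.
  move: ba; rewrite le_eqVlt => /predU1P[->|ba].
    by rewrite set_itv1 integral_set1 set_itv_ge ?integral_set0// bnd_simp ltxx.
  by rewrite !set_itv_ge// bnd_simp -?leNgt -?ltNge ?ltW.
rewrite -integral_itv_obnd_cbnd; last first.
  by apply/measurable_EFinP/measurable_fun_itv_bndo_bndcP; exact: sing_measurable.
rewrite -integral_itv_bndo_bndc//.
Qed.

Lemma sing_sub f a a' b : a <= a' -> a' < b -> sing a b f -> sing a' b f.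
Proof.
move=> aa ab [cf [C C0 [r r1 fC]]].
have sub x : a' < x < b -> a < x < b by move=> /andP[h1 ->]; rewrite (le_lt_trans aa).
have [r0|r0] := leP 0 r.
  apply: (@sing_bounded _ _ _ _ (C * (b - a) `^ r)) => [x /sub/cf//||x hx].
    by rewrite mulr_ge0// powR_ge0.
  have /andP[h1 h2] := sub x hx; rewrite (le_trans (fC x (sub x hx)))// ler_wpM2l//.
  by apply: ge0_ler_powR; rewrite ?nnegrE; lra.
apply: (@singW _ _ _ _ C r) => // [x /sub/cf//|x hx].
rewrite (le_trans (fC x (sub x hx)))// ler_wpM2l//; have /andP[h1 h2] := hx.
by apply: le0_ler_powR; rewrite ?(ltW r0)//; lra.
Qed.

Variables (a c : R) (h h1 h2 : R -> R) (M : R).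
Hypothesis H : cutoff a 1 c h h1 h2 M.

(** The difference phi - phi a restores integrability, and for the constant phi a
    one integration by parts produces exactly the compensating boundary term, since
    h = 1 near a. *)
Lemma fp_limit p phi K : -2 < p -> p < -1 -> 0 <= K ->
  (forall x, a < x < 1 -> {for x, continuous phi}) ->
  (forall x, a < x < 1 -> `|phi x - phi a| <= K * (x - a)) ->
  (\int[mu]_(x in `[a + e, 1]) ((x - a) `^ p * h x * phi x))%R
    + phi a * e `^ (p + 1) / (p + 1) @[e --> 0^'+] -->
  (\int[mu]_(x in `]a, 1[) ((x - a) `^ p * (h x * (phi x - phi a))))%R + phi a * fp_int a 1 p h1.
Proof.
move=> p2 p1 K0 cphi lip; have ac := cut_ac H; have c1 := cut_cb H.
have a1 : a < 1 by exact: lt_trans c1.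
have p10 : p + 1 != 0 by rewrite lt_eqF//; lra.
pose f1 x := (x - a) `^ p * (h x * (phi x - phi a)).
pose f2 x := (x - a) `^ (p + 1) * h1 x.
have s1 : sing a 1 f1.
  apply: (@sing_powM _ a 1 p 1 _ (M * K)); [by rewrite mulr_ge0 ?(cut_M H)|lra| |].
    move=> x hx; apply: cvgM; first exact: (cutoff_continuous H).
    by apply: cvgB; [exact: cphi|exact: cvg_cst].
  move=> x hx; have /andP[ax _] := hx; rewrite powRr1 ?subr_ge0 ?(ltW ax)// normrM -mulrA.
  by apply: ler_pM => //; [have [] := cut_bound H hx|exact: lip].
have s2 : sing a 1 f2.
  apply: (@sing_powM _ a 1 (p + 1) 0 _ M); [exact: (cut_M H)|lra| |].
    exact: (cutoff1_continuous H).
  by move=> x hx; rewrite powRr0 mulr1; have [] := cut_bound H hx.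
have l1 := cvg_shift_right (sing_cvg a1 s1).
have l2 := cvg_shift_right (sing_cvg a1 s2).
have kc : phi a * (- (p + 1)^-1) @[e --> (0:R)^'+] --> phi a * (- (p + 1)^-1) by exact: cvg_cst.
have L : (\int[mu]_(x in `]a + e, 1[) f1 x)%R + phi a * (- (p + 1)^-1) * (\int[mu]_(x in `]a + e, 1[) f2 x)%R @[e --> 0^'+] -->
   (\int[mu]_(x in `]a, 1[) f1 x)%R + phi a * (- (p + 1)^-1) * (\int[mu]_(x in `]a, 1[) f2 x)%R.
  by apply: cvgD => //; exact: cvgM.
have -> : phi a * fp_int a 1 p h1 = phi a * (- (p + 1)^-1) * (\int[mu]_(x in `]a, 1[) f2 x)%R.
  by rewrite /fp_int /f2; ring.
apply: cvg_trans L; apply: near_eq_cvg; near=> e.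
have e0 : 0 < e by near: e; exact: nbhs_right_gt.
have ec : a + e < c.
  by rewrite addrC -ltrBrDr; near: e; apply: nbhs_right_lt; rewrite subr_gt0.
have sub g x : (forall x, a < x < 1 -> {for x, continuous g}) -> a + e < x < 1 -> {for x, continuous g}.
  move=> cg /andP[h3 h4]; apply: cg; apply/andP; split; lra.
have c0 x : a < x < 1 -> {for x, continuous (fun x => (x - a) `^ p * h x)}.
  move=> hx; have /andP[ax _] := hx; apply: cvgM; first exact: powR_shift_continuous.
  exact: (cutoff_continuous H).
have ae : a < a + e by rewrite ltrDl.
have e1 : a + e < 1 by lra.
have I g : sing a 1 g -> sing (a + e) 1 g by apply: sing_sub; lra.
pose f3 x := (x - a) `^ p * h x.
have M0 := cut_M H.
have s3 : sing (a + e) 1 f3.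
  apply: (@sing_bounded _ _ _ _ (e `^ p * M)).
  - by move=> x hx; apply: (sub f3) => // z hz; exact: c0.
  - by rewrite mulr_ge0 ?powR_ge0.
  move=> x /andP[h3 h4]; rewrite normrM ger0_norm ?powR_ge0//; apply: ler_pM => //; first exact: powR_ge0.
    by apply: le0_ler_powR => //; [lra|rewrite lerBrDl ltW].
  by have [] // := cut_bound H (_ : a < x < 1); apply/andP; split; lra.
have J3 : (\int[mu]_(x in `]a + e, 1[) (f3 x + (p + 1)^-1 * f2 x))%R = 0 - e `^ (p + 1) / (p + 1).
  pose F x := (p + 1)^-1 * ((x - a) `^ (p + 1) * h x).
  have cF x : a < x < 1 -> is_derive x 1 F (f3 x + (p + 1)^-1 * f2 x).
    move=> hx; have /andP[ax _] := hx.
    have d1 := is_derive_powR_shift (p + 1) ax; have d2 := cut_d H hx.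
    apply: is_derive_eq; rewrite /GRing.scale/= addrK /f3 /f2.
    by field.
  have [ha1 _ _] : [/\ h (a + e) = 1, h1 (a + e) = 0 & h2 (a + e) = 0].
    by apply: (cut_left H); rewrite ae.
  apply: (@FTC_sing _ F); [exact: e1| | | |].
  - apply: singD; first exact: s3;
    apply: singZ; exact: I.
  - by move=> x /andP[h3 h4]; apply: cF; apply/andP; split; lra.
  - have -> : e `^ (p + 1) / (p + 1) = F (a + e).
      by rewrite /F ha1 mulr1 addrAC subrr add0r mulrC.
    apply: cvg_at_right_filter; apply: is_derive_continuous (cF _ _).
    by rewrite ae.
  - apply: cvg_near_cst; apply: filterS (cut_right H) => x [hx _].
    by rewrite /F hx !mulr0.
rewrite Rintegral_open_right; last first.
  by move=> x hx; apply: (sub (fun x => (x - a) `^ p * h x * phi x)) => // z hz; apply: cvgM; [exact: c0|exact: cphi].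
have J2 := RintegralZ_sing (p + 1)^-1 (I _ s2).
have sz2 := singZ (p + 1)^-1 (I _ s2).
have J := RintegralD_sing s3 sz2.
rewrite J3 J2 in J.
have -> : (\int[mu]_(x in `]a + e, 1[) ((x - a) `^ p * h x * phi x) =
   \int[mu]_(x in `]a + e, 1[) (f1 x + phi a * f3 x))%R.
  by apply: eq_Rintegral => x _; rewrite /f1 /f3; ring.
rewrite (RintegralD_sing (I _ s1) (singZ _ s3)) (RintegralZ_sing _ s3).
have -> : (\int[mu]_(x in `]a + e, 1[) f3 x)%R =
  0 - e `^ (p + 1) / (p + 1) - (p + 1)^-1 * (\int[mu]_(x in `]a + e, 1[) f2 x)%R by rewrite J addrK.
by ring.
Unshelve. all: by end_near. Qed.
End FinitePart.

(** * Coefficients of the singular distribution *)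
Section Coefficients.
Context {R : realType}.
Implicit Types (f g phi chi psi : R -> R) (a b c x s p : R) (n k : nat).
Notation mu := (@lebesgue_measure R).

Lemma eigfun_shift n a x : eigfun n x = Num.sqrt 2 *
  (sin (n%:R * pi * a) * cos (n%:R * pi * (x - a)) + cos (n%:R * pi * a) * sin (n%:R * pi * (x - a))) :> R.
Proof.
rewrite /eigfun; congr (_ * _); rewrite -[in LHS](subrK a x) mulrDr addrC sinD.
by ring.
Qed.

Lemma eigfun_lipschitz n x y : x <= y -> `|eigfun n y - eigfun n x| <= Num.sqrt 2 * (n%:R * pi) * (y - x) :> R.
Proof.
move=> xy.
have cf : {within `[x, y], continuous (eigfun n : R -> R)}.
  by apply: continuous_in_within => z _; exact: eigfun_continuous n z.
have [z _ E] := MVT_segment xy (fun z _ => is_derive_eigfun n z) cf.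
have np : 0 <= n%:R * pi :> R by rewrite mulr_ge0// pi_ge0.
rewrite E normrM (ger0_norm (_ : 0 <= y - x)) ?subr_ge0//; apply: ler_wpM2r; first by rewrite subr_ge0.
rewrite normrM ger0_norm ?sqrtr_ge0// ler_wpM2l ?sqrtr_ge0// normrM (ger0_norm np).
by rewrite -[leRHS]mulr1 ler_wpM2l// cos_max.
Qed.

Section Fixed.
Variables (s : R) (k : nat) (chi : R -> R) (c M : R).
Hypotheses (k2 : (2 <= k)%N) (H : cutoff (k%:R^-1) 1 c chi (derive1n 1 chi) (derive1n 2 chi) M).
Let a : R := k%:R^-1.
Let p := s - 2^-1.

Lemma inv_nat01 : 0 < a < 1.
Proof.
rewrite /a invr_gt0 ltr0n (leq_trans _ k2)//= invf_lt1 ?ltr1n//.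
by rewrite ltr0n (leq_trans _ k2).
Qed.

Lemma fsing_on x : a < x < 1 -> fsing s k chi x = (x - a) `^ p * chi x.
Proof. by move=> /andP[ax _]; rewrite /fsing leNgt ax. Qed.

Lemma fsing_off x : 0 < x <= a -> fsing s k chi x = 0.
Proof. by move=> /andP[_ xa]; rewrite /fsing xa. Qed.

Lemma sing_fsing_mul g B : -1 < p -> 0 <= B ->
  (forall x, a < x < 1 -> {for x, continuous g}) ->
  (forall x, a < x < 1 -> `|g x| <= B) ->
  sing a 1 (fun x => (x - a) `^ p * (chi x * g x)).
Proof.
move=> p1 B0 cg gB; apply: (@sing_powM _ a 1 p 0 _ (M * B)).
- by rewrite mulr_ge0// (cut_M H).
- by rewrite addr0.
- by move=> x hx; apply: cvgM; [exact: (cutoff_continuous H)|exact: cg].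
- move=> x hx; rewrite powRr0 mulr1 normrM; apply: ler_pM => //; last exact: gB.
  by have [] := cut_bound H hx.
Qed.

Lemma fsing_integrable : - 2^-1 < s -> mu.-integrable `]0%R, 1%R[ (EFin \o fsing s k chi).
Proof.
move=> s1; have p1 : -1 < p by rewrite /p; lra.
have /andP[a0 a1] := inv_nat01.
have a01 : 0 <= a < 1 by rewrite a1 ltW.
have sg1 : sing a 1 (fun x => (x - a) `^ p * (chi x * cst 1 x)).
  by apply: (sing_fsing_mul p1 ler01) => x _; [exact: cvg_cst|rewrite /= normr1].
have [] // := restrict_unit a01 fsing_off _ sg1.
by move=> x hx; rewrite fsing_on//= mulr1.
Qed.

Lemma fp_approx_cvg phi K : s < - 2^-1 -> -1 <= s -> 0 <= K ->
  (forall x, a < x < 1 -> {for x, continuous phi}) ->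
  (forall x, a < x < 1 -> `|phi x - phi a| <= K * (x - a)) ->
  fp_approx s k chi phi e @[e --> 0^'+] -->
  (\int[mu]_(x in `]a, 1[) ((x - a) `^ p * (chi x * (phi x - phi a))))%R
     + phi a * fp_int a 1 p (derive1n 1 chi).
Proof.
move=> s1 s2 K0 cphi lip.
have p2 : -2 < p by rewrite /p; lra.
have p1 : p < -1 by rewrite /p; lra.
have := fp_limit H p2 p1 K0 cphi lip.
by rewrite /fp_approx -/a -/p; have -> : p + 1 = s + 2^-1 by rewrite /p; lra.
Qed.

(** The addition formula for n pi x = n pi a + n pi (x - a) splits the coefficient
    into a cosine and a sine integral centred at the singularity.  In the finite
    part, subtracting the value at a replaces cos by cos - 1. *)
Lemma dsing_eigfun n : -1 <= s -> s != - 2^-1 -> (0 < n)%N ->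
  dsing s k chi (eigfun n) = Num.sqrt 2 *
   (sin (n%:R * pi * a) * fp_cos_int a 1 p chi (derive1n 1 chi) (n%:R * pi) +
    cos (n%:R * pi * a) * sin_int a 1 p chi (n%:R * pi)).
Proof.
move=> s1 sN n0; have /andP[a0 a1] := inv_nat01.
have N0 : 0 < n%:R * pi :> R by rewrite mulr_gt0 ?ltr0n ?pi_gt0.
have p2 : -2 < p by rewrite /p; lra.
have p3 : -3 < p by rewrite /p; lra.
rewrite /dsing /fp_cos_int; have [hs|hs] := ltP (- 2^-1) s.
  have p1 : -1 < p by rewrite /p; lra.
  rewrite p1.
  have sg : sing a 1 (fun x => (x - a) `^ p * (chi x * eigfun n x)).
    apply: (sing_fsing_mul p1 (sqrtr_ge0 2)) => x _; first exact: eigfun_continuous.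
    exact: eigfun_bound.
  have a01 : 0 <= a < 1 by rewrite a1 ltW.
  have [||_ E] := @restrict_unit _ a (fun x => fsing s k chi x * eigfun n x) _ a01 _ _ sg.
  - by move=> x hx; rewrite fsing_off// mul0r.
  - by move=> x hx; rewrite fsing_on// mulrA.
  rewrite /pairing E /cos_int /sin_int.
  have sc := sing_co H (n%:R * pi) p1; have ss := sing_si H N0 p2.
  rewrite -(RintegralZ_sing _ sc) -(RintegralZ_sing _ ss).
  rewrite -(RintegralD_sing (singZ _ sc) (singZ _ ss)) -(RintegralZ_sing _ (singD (singZ _ sc) (singZ _ ss))).
  by apply: eq_Rintegral => x _; rewrite (eigfun_shift n a); ring.
have s3 : s < - 2^-1 by rewrite lt_neqAle sN.
have p1 : p < -1 by rewrite /p; lra.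
have -> : (-1 < p) = false by apply/negbTE; rewrite -leNgt ltW.
have L := @fp_approx_cvg (eigfun n) (Num.sqrt 2 * (n%:R * pi)) s3 s1.
have {L}L : fp_approx s k chi (eigfun n) e @[e --> 0^'+] -->
  (\int[mu]_(x in `]a, 1[) ((x - a) `^ p * (chi x * (eigfun n x - eigfun n a))))%R
     + eigfun n a * fp_int a 1 p (derive1n 1 chi).
  apply: L => [|x _|x /andP[ax _]].
  - by rewrite mulr_ge0 ?sqrtr_ge0// ltW.
  - exact: eigfun_continuous.
  - by apply: eigfun_lipschitz; exact: ltW.
rewrite (cvg_lim _ L)//.
have ss := sing_si H N0 p2; have so := sing_omc H N0 p3.
have -> : (\int[mu]_(x in `]a, 1[) ((x - a) `^ p * (chi x * (eigfun n x - eigfun n a))))%R =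
  (\int[mu]_(x in `]a, 1[) ((Num.sqrt 2 * cos (n%:R * pi * a)) * ((x - a) `^ p * (chi x * sin (n%:R * pi * (x - a)))) +
    (- (Num.sqrt 2 * sin (n%:R * pi * a))) * ((x - a) `^ p * (chi x * (1 - cos (n%:R * pi * (x - a)))))))%R.
  by apply: eq_Rintegral => x _; rewrite (eigfun_shift n a x) /eigfun; ring.
rewrite (RintegralD_sing (singZ _ ss) (singZ _ so)) (RintegralZ_sing _ ss) (RintegralZ_sing _ so).
by rewrite /sin_int /omc_int /eigfun; ring.
Qed.
End Fixed.
End Coefficients.

(** * Membership in the weighted space *)
Section Membership.
Context {R : realType}.
Implicit Types (f g phi chi psi : R -> R) (a b c x s p t : R) (n k m j : nat).
Notation mu := (@lebesgue_measure R).

Lemma eigval_powR j t : (0 < j)%N -> eigval j `^ (t / 2) = (j%:R * pi) `^ t :> R.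
Proof.
move=> j0; rewrite /eigval -powR_mulrn; last by rewrite mulr_ge0// pi_ge0.
by rewrite -powRrM; congr (_ `^ _); field.
Qed.

Fixpoint sine_partial (v : nat -> R) (m : nat) : R -> R :=
  if m is n.+1 then (fun x => v n * eigfun n x + sine_partial v n x) else fun=> 0.

Lemma sine_sum_partial v m : sine_sum (sine_partial v m).
Proof. by elim: m => [|m IH] /=; constructor. Qed.

Lemma pairing_sine_partial v m j : (0 < j)%N ->
  pairing (sine_partial v m) (eigfun j) = if (j < m)%N then v j else 0.
Proof.
move=> j0; elim: m => [|m IH] /=.
  exact: pairing0l.
rewrite (pairing_lin _ (L2_eigfun m) (L2_sine_sum (sine_sum_partial v m)) (L2_eigfun j)) IH.
case: m {IH} => [|m].
  by rewrite eigfun0 pairing0l mulr0 add0r ltnS leqNgt j0.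
rewrite (eigfun_orthonormal _ j0)//; case: (ltngtP j m.+1) => h.
- by rewrite mulr0 add0r ltnS ltnW.
- by rewrite mulr0 add0r ltnS leqNgt h.
- by rewrite h mulr1 addr0 ltnSn.
Qed.

Lemma dom_infty_sine_partial v m : dom_infty (sine_partial v m).
Proof.
move=> n; have [ms Is] := L2_sine_sum (sine_sum_partial v m); split => //.
set F := fun j => (eigval j ^+ n * pairing (sine_partial v m) (eigfun j) ^+ 2)%:E.
have F0 j : (0 <= F j)%E by rewrite lee_fin mulr_ge0 ?sqr_ge0// exprn_ge0// sqr_ge0.
have Fz j : (0 < j)%N -> (m <= j)%N -> F j = 0%E.
  by move=> j0 mj; rewrite /F pairing_sine_partial// ltnNge mj expr0n/= mulr0.
apply: (@le_lt_trans _ _ (\sum_(1 <= j < m.+1) F j)%E); last first.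
  by rewrite /F sumEFin ltry.
apply: lime_le; first by apply: is_cvg_nneseries => j _ _; exact: F0.
apply: nearW => N; have [Nm|mN] := leqP N m.+1.
  by apply: lee_sum_nneg_natr => // j _ _; exact: F0.
have Z : (\sum_(m.+1 <= j < N) F j = 0)%E.
  rewrite big_nat_cond big1// => j /andP[/andP[mj _] _].
  by apply: Fz; [exact: leq_ltn_trans mj|exact: ltnW].
by rewrite (@big_cat_nat _ _ _ m.+1)//= ?(ltnW mN)// -/F Z adde0.
Qed.

(** The truncated sine series have coefficients equal to those of the distribution
    or to 0, so they inherit the bound, and each coefficient is eventually
    constant. *)
Lemma in_H_infty_of_bound t (T : distr) (B : R) :
  (forall j, (1 <= j)%N -> `|eigval j `^ (t / 2) * T (eigfun j)| <= B) -> in_H_infty t T.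
Proof.
move=> TB; have B0 : 0 <= B := le_trans (normr_ge0 _) (TB 1%N isT).
have nb (T' : distr) : (forall j, (1 <= j)%N -> `|eigval j `^ (t / 2) * T' (eigfun j)| <= B) ->
    (normH_infty t T' <= B%:E)%E.
  by move=> h; apply: ub_ereal_sup => _ [j /= j1 <-]; rewrite lee_fin h.
split; first by apply: le_lt_trans (nb _ TB) _; rewrite ltry.
exists (sine_partial (fun j => T (eigfun j))); split.
- by move=> m; exact: dom_infty_sine_partial.
- exists B => m; apply: nb => j j1; rewrite /distr_of pairing_sine_partial//.
  by case: ifP => _; [exact: TB|rewrite mulr0 normr0].
- move=> j j1; apply: cvg_near_cst; near=> m.
  rewrite pairing_sine_partial//; suff -> : (j < m)%N by [].
  by near: m; exact: nbhs_infty_gt.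
Unshelve. all: by end_near. Qed.

(** Here N = n pi, and the powers of pi go into the constants, which therefore do
    not depend on k or on the cut-off. *)
Theorem dsing_asymptotics s : -1 <= s <= 1 -> s != - 2^-1 ->
  exists A B d : R, [/\ A != 0 \/ B != 0, 0 < d <= 1 &
  forall k chi c M, (2 <= k)%N -> cutoff (k%:R^-1) 1 c chi (derive1n 1 chi) (derive1n 2 chi) M ->
  exists2 C : R, 0 <= C & forall n, (0 < n)%N ->
    `|dsing s k chi (eigfun n) - n%:R `^ (- (s + 2^-1)) * osc k A B n| <= C * n%:R `^ (- (s + 2^-1) - d)].
Proof.
move=> /andP[s1 s2] sN; pose p := s - 2^-1.
have hp : - (3 / 2) <= p <= 1 / 2 by rewrite /p; apply/andP; split; lra.
have pN : p != -1 by apply: contra sN => /eqP; rewrite /p => h; apply/eqP; lra.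
have [A0 [B0 [d [AB d01 HH]]]] := coef_asymptotics hp pN.
have E1 : - (p + 1) = - (s + 2^-1) by rewrite /p; lra.
have pw : 0 < pi `^ (- (s + 2^-1)) :> R by rewrite powR_gt0 ?pi_gt0.
have s20 : 0 < Num.sqrt 2 :> R by rewrite sqrtr_gt0.
pose W : R := Num.sqrt 2 * pi `^ (- (s + 2^-1)).
have W0 : W != 0 by rewrite gt_eqF// mulr_gt0.
exists (W * A0), (W * B0), d; split => //.
  by case: AB => h; [left|right]; rewrite mulf_neq0.
move=> k chi c M k2 H; have [C C0 HC] := HH _ _ _ _ _ _ _ H.
pose V : R := pi `^ (- (s + 2^-1) - d).
have V0 : 0 <= V by exact: powR_ge0.
exists (Num.sqrt 2 * (2 * (C * V))); first by rewrite !mulr_ge0 ?sqrtr_ge0.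
move=> n n0; have n1 : 0 < n%:R :> R by rewrite ltr0n.
have N1 : 1 <= n%:R * pi :> R.
  have := pi_ge2 R; have : 1 <= n%:R :> R by rewrite ler1n.
  nra.
rewrite (dsing_eigfun k2 H s1 sN n0) -/p.
have [hX hY] := HC _ N1; rewrite E1 in hX hY.
have P1 : (n%:R * pi) `^ (- (s + 2^-1)) = n%:R `^ (- (s + 2^-1)) * pi `^ (- (s + 2^-1)) :> R.
  by rewrite powRM ?(ltW n1) ?pi_ge0.
have P2 : (n%:R * pi) `^ (- (s + 2^-1) - d) = n%:R `^ (- (s + 2^-1) - d) * V :> R.
  by rewrite powRM ?(ltW n1) ?pi_ge0.
rewrite P1 P2 in hX hY.
set X := fp_cos_int _ _ _ _ _ _ in hX *; set Y := sin_int _ _ _ _ _ in hY *.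
rewrite /osc; have -> : n%:R * (pi / k%:R) = n%:R * pi * k%:R^-1 :> R by rewrite mulrA.
set S := sin _; set Co := cos _.
set u := n%:R `^ (- (s + 2^-1)) in hX hY *; set w := n%:R `^ _ in hX hY *.
set q := pi `^ _ in hX hY P1 P2 pw W W0 *.
have -> : Num.sqrt 2 * (S * X + Co * Y) - u * (W * A0 * S + W * B0 * Co) =
  Num.sqrt 2 * (S * (X - A0 * (u * q)) + Co * (Y - B0 * (u * q))) by rewrite /W; ring.
rewrite normrM (ger0_norm (sqrtr_ge0 2)) -mulrA ler_wpM2l ?sqrtr_ge0//.
apply: (le_trans (ler_normD _ _)).
have b1 : `|S * (X - A0 * (u * q))| <= C * (w * V).
  by rewrite normrM -[leRHS]mul1r ler_pM// sin_max.
have b2 : `|Co * (Y - B0 * (u * q))| <= C * (w * V).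
  by rewrite normrM -[leRHS]mul1r ler_pM// cos_max.
lra.
Qed.

Lemma dsing_in_H s k chi c M : -1 <= s <= 1 -> s != - 2^-1 -> (2 <= k)%N ->
  cutoff (k%:R^-1) 1 c chi (derive1n 1 chi) (derive1n 2 chi) M ->
  in_H_infty (s + 2^-1) (dsing s k chi).
Proof.
move=> hs sN k2 H; have [A [B [d [_ d01 HH]]]] := dsing_asymptotics hs sN.
have [C C0 HC] := HH _ _ _ _ k2 H; have /andP[d0 d1] := d01.
set t := s + 2^-1 in HC *.
apply: (@in_H_infty_of_bound _ _ (pi `^ t * (`|A| + `|B| + C))) => j j1.
have j0 : 0 < j%:R :> R by rewrite ltr0n.
rewrite eigval_powR// powRM ?pi_ge0// ?(ltW j0)//.
have hj : `|dsing s k chi (eigfun j)| <= (`|A| + `|B| + C) * j%:R `^ (- t).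
  rewrite -(subrK (j%:R `^ (- t) * osc k A B j) (dsing _ _ _ _)) (le_trans (ler_normD _ _))//.
  rewrite addrC mulrDl; apply: lerD.
    rewrite normrM (ger0_norm (powR_ge0 _ _)) mulrC ler_wpM2r ?powR_ge0//.
    rewrite /osc (le_trans (ler_normD _ _))// !normrM.
    by apply: lerD; rewrite -[leRHS]mulr1 ler_wpM2l ?sin_max ?cos_max.
  apply: (le_trans (HC j j1)); rewrite ler_wpM2l//.
  by apply: ler_powR; rewrite ?ler1n//; lra.
rewrite normrM ger0_norm ?mulr_ge0 ?powR_ge0//.
have -> : pi `^ t * (`|A| + `|B| + C) = j%:R `^ t * pi `^ t * ((`|A| + `|B| + C) * j%:R `^ (- t)).
  have E : j%:R `^ t * j%:R `^ (- t) = 1 :> R.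
    by rewrite -powRD ?subrr ?powRr0// (gt_eqF j0) implybT.
  rewrite [RHS](_ : _ = j%:R `^ t * j%:R `^ (- t) * (pi `^ t * (`|A| + `|B| + C))); last by ring.
  by rewrite E mul1r.
by rewrite ler_wpM2l// mulr_ge0 ?powR_ge0.
Qed.
End Membership.

(** * Test functions *)
Section TestFunctions.
Context {R : realType}.
Implicit Types (f g phi chi psi : R -> R) (a b c x s p t u v : R) (n k m j : nat).
Notation mu := (@lebesgue_measure R).

Lemma test_is_derive psi n x : test_function01 psi ->
  is_derive x 1 (derive1n n psi) (derive1n n.+1 psi x).
Proof.
move=> [sf _ _]; have d1 := sf n x I; apply: DeriveDef; first exact: d1.
by rewrite derive1nS derive1E.
Qed.

Lemma test_continuous psi n x : test_function01 psi -> {for x, continuous (derive1n n psi)}.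
Proof. by move=> t; exact: is_derive_continuous (test_is_derive n x t). Qed.

Lemma test_continuous0 psi x : test_function01 psi -> {for x, continuous psi}.
Proof. by move=> t; exact: is_derive_continuous (test_is_derive 0 x t). Qed.

Lemma test_zero_near psi x : test_function01 psi -> ~ (0 < x < 1) -> \forall y \near x, psi y = 0.
Proof.
move=> [_ _ sub] hx.
have : ~ closure [set x | psi x != 0] x by move/sub; rewrite /= in_itv.
move/existsNP => [B] /not_implyP[nB] hB.
apply: filterS nB => y By; apply: contrapT => /eqP py.
by apply: hB; exists y.
Qed.

(** The complement of the closed support is a neighbourhood of 0 and of 1. *)
Lemma test_support psi : test_function01 psi ->
  exists u v : R, [/\ 0 < u, u <= v, v < 1 & forall x, ~~ (u <= x <= v) -> 0 < x < 1 -> psi x = 0].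
Proof.
move=> t.
have n0 : ~ (0 < (0 : R) < 1) by rewrite ltxx.
have n1 : ~ (0 < (1 : R) < 1) by rewrite ltxx andbF.
have /near_ball_ex[d d0 hd] := test_zero_near t n0.
have /near_ball_ex[e e0 he] := test_zero_near t n1.
exists (Num.min d (1 / 2)), (Num.max (1 - e) (1 / 2)); split.
- by rewrite lt_min d0; lra.
- by rewrite le_max !ge_min lexx !orbT.
- by rewrite gt_max; apply/andP; split; lra.
move=> x; rewrite ge_min le_max !negb_and !negb_or -!ltNge.
by move=> /orP[/andP[h1 h2]|/andP[h1 h2]] /andP[h3 h4]; [apply: hd|apply: he]; apply/andP; split; lra.
Qed.

Lemma test_smooth01 psi : test_function01 psi -> smooth01 psi.
Proof.
move=> t; have [sf _ _] := t; split.
- by move=> n x _; exact: sf.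
- by apply: continuous_in_within => x _; exact: test_continuous0.
- move=> n; split; apply: (cvgP (derive1n n psi _)).
    by apply: cvg_at_right_filter; exact: test_continuous.
  by apply: cvg_at_left_filter; exact: test_continuous.
Qed.

Lemma test_L2 psi : test_function01 psi -> L2 psi.
Proof.
by move=> t; apply: L2_continuous => x; exact: test_continuous0.
Qed.

Lemma test_zero_ends psi n x : test_function01 psi -> ~ (0 < x < 1) -> derive1n n psi x = 0.
Proof.
move=> t hx; have h : \forall y \near x, derive1n n psi y = 0.
  elim: n => [|n IH]; first exact: test_zero_near.
  have [d d0 hd] := near_ball_ex IH.
  have hx' : x - d < x < x + d by apply/andP; split; lra.
  apply: filterS (near_open_itv hx') => y hy; rewrite derive1nS.
  apply: (@locally_constant_derive1 _ _ 0); apply: filterS (near_open_itv hy) => z hz; exact: hd.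
exact: nbhs_singleton h.
Qed.

(** Two integrations by parts, without boundary terms. *)
Lemma test_coef psi : test_function01 psi ->
  exists2 C : R, 0 <= C & forall n, (0 < n)%N -> `|pairing psi (eigfun n)| <= C * n%:R `^ (- 2).
Proof.
move=> t; have [M M0 hM] := smooth_bounded 2 (test_smooth01 t).
exists (Num.sqrt 2 * M); first by rewrite mulr_ge0 ?sqrtr_ge0.
move=> n n0; have n1 : 0 < n%:R :> R by rewrite ltr0n.
set N : R := n%:R * pi; have N0 : N != 0 by rewrite /N mulf_neq0 ?gt_eqF ?pi_gt0.
pose psi1 := derive1n 1 psi; pose psi2 := derive1n 2 psi.
pose F x := - (N^-1 * (psi x * cos (N * x))) + N ^- 2 * (psi1 x * sin (N * x)).
have dF (x : R) : is_derive x 1 F (psi x * sin (N * x) + N ^- 2 * (psi2 x * sin (N * x))).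
  have d0 := test_is_derive 0 x t; have d1 := test_is_derive 1 x t.
  have ds := is_derive_sin_lin N x; have dc := is_derive_cos_lin N x.
  rewrite derive1n0 in d0; rewrite -/psi1 in d0 d1; rewrite -/psi2 in d1.
  by apply: is_derive_eq; rewrite /GRing.scale/=; field.
have cs (x : R) : {for x, continuous (fun x => sin (N * x))}.
  exact: is_derive_continuous (is_derive_sin_lin N x).
have c1 (x : R) : {for x, continuous (fun x => psi x * sin (N * x))}.
  by apply: cvgM; [exact: test_continuous0|exact: cs].
have c2 (x : R) : {for x, continuous (fun x => psi2 x * sin (N * x))}.
  by apply: cvgM; [exact: is_derive_continuous (test_is_derive 2 x t)|exact: cs].
have cf (x : R) : {for x, continuous (fun x => psi x * sin (N * x) + N ^- 2 * (psi2 x * sin (N * x)))}.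
  by apply: cvgD; [exact: c1|apply: cvgM; [exact: cvg_cst|exact: c2]].
have E := FTC_unit dF cf.
have h0 : ~ (0 < (0 : R) < 1) by rewrite ltxx.
have h1 : ~ (0 < (1 : R) < 1) by rewrite ltxx andbF.
have Fz x : ~ (0 < x < 1) -> F x = 0.
  move=> hx; have p0 : psi x = 0 by exact: (test_zero_ends 0 t hx).
  by rewrite /F p0 /psi1 (test_zero_ends 1 t hx) !mul0r !mulr0 oppr0 addr0.
rewrite (Fz _ h1) (Fz _ h0) subrr in E.
have s1 : sing 0 1 (fun x => psi x * sin (N * x)).
  have [M' M'0 hM'] := smooth_bounded 0 (test_smooth01 t).
  apply: (@sing_bounded _ _ _ _ (M' * 1)) => [x _||x hx]; [exact: c1|by rewrite mulr1|].
  by rewrite normrM; apply: ler_pM => //; [exact: hM'|exact: sin_max].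
have s2 : sing 0 1 (fun x => psi2 x * sin (N * x)).
  apply: (@sing_bounded _ _ _ _ (M * 1)) => [x _||x hx]; [exact: c2|by rewrite mulr1|].
  by rewrite normrM; apply: ler_pM => //; [exact: hM|exact: sin_max].
rewrite (RintegralD_sing s1 (singZ _ s2)) (RintegralZ_sing _ s2) in E.
have -> : pairing psi (eigfun n) = Num.sqrt 2 * - (N ^- 2 * (\int[mu]_(x in `]0, 1[) (psi2 x * sin (N * x)))%R).
  move/eqP: E; rewrite addr_eq0 => /eqP <-.
  rewrite -(RintegralZ_sing _ s1); apply: eq_Rintegral => x _; rewrite /eigfun -/N; ring.
have b : `|(\int[mu]_(x in `]0, 1[) (psi2 x * sin (N * x)))%R| <= M.
  have := @Rintegral_norm_le_powR _ 0 1 (fun x => psi2 x * sin (N * x)) M 0.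
  rewrite subr0 add0r powR1 divr1 mulr1; apply => //; first exact: sing_integrable.
  move=> x hx; rewrite powRr0 mulr1 normrM -[leRHS]mulr1.
  by apply: ler_pM => //; [exact: hM|exact: sin_max].
have pb : N ^- 2 <= n%:R `^ (- 2).
  rewrite powRN powR_mulrn ?(ltW n1)// lef_pV2 ?posrE ?exprn_gt0 ?mulr_gt0 ?pi_gt0//.
  rewrite /N exprMn ler_peMr ?sqr_ge0// expr_ge1 ?pi_ge0//; have := pi_ge2 R; lra.
rewrite normrM (ger0_norm (sqrtr_ge0 2)) -mulrA ler_wpM2l ?sqrtr_ge0// normrN normrM.
rewrite mulrC; apply: ler_pM => //.
by rewrite ger0_norm// invr_ge0 sqr_ge0.
Qed.
End TestFunctions.

(** * The kernel of the perturbed distribution *)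
Section Perturbed.
Context {R : realType}.
Implicit Types (f g phi chi psi : R -> R) (a b c x p t u v : R) (n k m j : nat).
Notation mu := (@lebesgue_measure R).

Section Square.
Variables (s : R) (k : nat) (chi : R -> R) (c M : R).
Hypotheses (s0 : 0 < s) (k2 : (2 <= k)%N)
  (H : cutoff (k%:R^-1) 1 c chi (derive1n 1 chi) (derive1n 2 chi) M).
Let a : R := k%:R^-1.

Lemma fsing_L2 : L2 (fsing s k chi).
Proof.
have /andP[a0 a1] := @inv_nat01 R k k2; have a01 : 0 <= a < 1 by rewrite /a a1 ltW.
have hp : -1 < s - 2^-1 by move: (s0) => ?; lra.
have sg : sing a 1 (fun x => (x - a) `^ (s - 2^-1) * (chi x * cst 1 x)).
  by apply: (sing_fsing_mul H hp ler01) => x _; [exact: cvg_cst|rewrite /= normr1].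
split.
  have [I _] := @restrict_unit _ a (fsing s k chi) _ a01 (@fsing_off _ s k chi)
    (fun x hx => etrans (fsing_on s chi hx) (esym (congr1 (fun z => _ * z) (mulr1 (chi x))))) sg.
  by apply/measurable_EFinP; exact: measurable_int I.
have sg2 : sing a 1 (fun x => (x - a) `^ (2 * (s - 2^-1)) * (chi x ^+ 2)).
  apply: (@sing_powM _ a 1 (2 * (s - 2^-1)) 0 _ (M ^+ 2)); rewrite ?sqr_ge0 ?addr0//.
  - by move: (s0) => ?; lra.
  - by move=> x hx; apply: cvgM; exact: (cutoff_continuous H).
  - move=> x hx; rewrite powRr0 mulr1 normrX lerXn2r ?nnegrE ?(cut_M H)//.
    by have [] := cut_bound H hx.
have [||I _] := @restrict_unit _ a (fun x => fsing s k chi x ^+ 2) _ a01 _ _ sg2; last exact: I.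
  by move=> x hx; rewrite fsing_off// expr0n.
move=> x hx; rewrite fsing_on// exprMn; congr (_ * _).
by rewrite -powR_mulrn ?powR_ge0// -powRrM mulrC.
Qed.

Lemma fsing_continuous_off : continuous_off a (fsing s k chi).
Proof.
move=> x hx xa; rewrite /prop_for /continuous_at.
have [xlt|xgt|E] := ltgtP x a; last by rewrite E eqxx in xa.
  have -> : fsing s k chi x = 0 by rewrite /fsing ltW.
  apply: cvg_near_cst; have hx' : -1 < x < a by rewrite xlt andbT; case/andP: hx => h _; lra.
  by apply: filterS (near_open_itv hx') => y /andP[_ ya]; rewrite /fsing ltW.
have hx' : a < x < 1 by rewrite xgt; case/andP: hx.
rewrite (fsing_on s chi hx').
have c1 : {for x, continuous (fun x => (x - a) `^ (s - 2^-1) * chi x)}.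
  by apply: cvgM; [exact: powR_shift_continuous|exact: (cutoff_continuous H)].
apply: cvg_trans c1; apply: near_eq_cvg.
by apply: filterS (near_open_itv hx') => y hy; rewrite (fsing_on s chi hy).
Qed.

Lemma fsing_support : exists2 v : R, a <= v < 1 & supported a v (fsing s k chi).
Proof.
have ac := cut_ac H; have c1 := cut_cb H.
have /near_left_ex[d d0 hd] := cut_right H.
exists (Num.max a (1 - d)).
  by rewrite le_max lexx gt_max; apply/andP; split => //; apply/andP; split; rewrite /a; lra.
move=> x /andP[x0 x1]; rewrite negb_and -!ltNge gt_max => /orP[h|/andP[h1 h2]].
  by rewrite /fsing (ltW h).
rewrite fsing_on ?h1//; have hx : 1 - d < x < 1 by rewrite h2.
by have [-> _] := hd x hx; rewrite mulr0.
Qed.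
End Square.

(** Parseval's identity for mu and mu cos (k pi x), the pairing of which is, up to a
    factor, the pairing of mu^2 with the derivative of the k-th eigenfunction. *)
Lemma parseval_cos s k chi c M psi : 0 < s -> (2 <= k)%N ->
  cutoff (k%:R^-1) 1 c chi (derive1n 1 chi) (derive1n 2 chi) M ->
  test_function01 psi ->
  pairing (fun x => (fsing s k chi x + psi x) ^+ 2) (derive1 (eigfun k)) = 0 ->
  let f x := 1 * fsing s k chi x + psi x in
  \sum_(1 <= n < N) fcoef f n * shift_mean (fcoef f) k n @[N --> \oo] --> (0 : R).
Proof.
move=> s0 k2 H tp orth f.
have lp := test_L2 tp; have ls := fsing_L2 s0 k2 H.
have lf : L2 f by exact: L2_lin.
have /andP[a0 a1] := @inv_nat01 R k k2.
have [v /andP[av v1] sv] := fsing_support s H.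
have [u' [v' [u0 uv v'1 sp]]] := test_support tp.
pose g x := f x * cos (k%:R * pi * x).
have cc (x : R) : {for x, continuous (fun x => cos (k%:R * pi * x))}.
  exact: is_derive_continuous (is_derive_cos_lin _ x).
have lg : L2 g.
  apply: (@L2_mulb _ _ _ 1) => //; last by move=> x _; exact: cos_max.
  by apply: sing_measurable => x _; exact: cc.
have h := @parseval _ f g (Num.min k%:R^-1 u') (Num.max v v') (k%:R^-1) _ _ _ lf lg _ _.
have {h}h : \sum_(1 <= n < N) fcoef f n * fcoef g n @[N --> \oo] --> pairing f g.
  apply: h.
  - by rewrite lt_min a0.
  - by rewrite ge_min le_max av.
  - by rewrite gt_max v1.
  - move=> x hx hn; rewrite /g /f sv ?sp ?mulr0 ?addr0 ?mul0r//.
    + by apply: contra hn => /andP[h1 h2]; rewrite ge_min le_max h1 h2 !orbT.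
    + by apply: contra hn => /andP[h1 h2]; rewrite ge_min le_max h1 h2.
  - move=> x hx xa; apply: cvgM; last exact: cc.
    apply: cvgD; last exact: test_continuous0.
    by apply: cvgM; [exact: cvg_cst|exact: (fsing_continuous_off H)].
have fg : pairing f g = 0.
  have K0 : Num.sqrt 2 * (k%:R * pi) != 0 :> R.
    rewrite mulf_neq0 ?mulf_neq0 ?sqrtr_eq0 -?ltNge// ?gt_eqF ?pi_gt0//.
    by rewrite ltr0n (leq_trans _ k2).
  apply: (mulfI K0); rewrite mulr0 -orth /pairing -RintegralZl//; last exact: L2_mul.
  apply: eq_Rintegral => x _; rewrite /g /f mul1r.
  rewrite derive_eigfun.
  by ring.
rewrite fg in h; apply: cvg_trans h; apply: near_eq_cvg; apply: nearW => N.
by apply: eq_bigr => n _; rewrite (fcoef_mul_cos k n lf).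
Qed.

(** The coefficients of a test function are O(n^-2), which is smaller than the
    leading term n^-(s+1/2) since s <= 1; the exponent d is lowered to 1/2 to keep
    this inside the error. *)
Theorem perturbed_kernel s : -1 <= s <= 1 -> s != - 2^-1 -> s != 0 ->
  exists alpha : R, alpha != 0 /\
  forall k chi c M psi, (2 <= k)%N ->
  cutoff (k%:R^-1) 1 c chi (derive1n 1 chi) (derive1n 2 chi) M ->
  test_function01 psi -> orthogonality s k chi psi ->
  (forall w : R, cvgn (fun N =>
           \sum_(1 <= n < N) quad_kernel_term (dsing_plus s k chi psi) k w n)) /\
  exists2 nu : R, 0 < nu & exists2 C : R, 0 < C & \forall w \near +oo,
    `|quad_kernel (dsing_plus s k chi psi) k w - alpha / w `^ (2 + s)| <= C / w `^ (2 + s + nu).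
Proof.
move=> hs sN s0; have /andP[s1 s2] := hs.
have [A [B [d [AB /andP[d0 d1] HH]]]] := dsing_asymptotics hs sN.
have [kap kap0 HK] := kernel_asymptotics hs s0.
have AB0 : A ^+ 2 + B ^+ 2 != 0.
  rewrite paddr_eq0 ?sqr_ge0// !expf_eq0/= negb_and.
  by case: AB => h; rewrite h ?orbT.
exists (kap * (A ^+ 2 + B ^+ 2)); split; first by rewrite mulf_neq0.
move=> k chi c M psi k2 H tp orth.
have [C1 C10 hC1] := HH _ _ _ _ k2 H.
have [C2 C20 hC2] := test_coef tp.
pose d' := Num.min d (1 / 2).
have d'0 : 0 < d' by rewrite lt_min d0; lra.
have d'd : d' <= d by rewrite ge_min lexx.
have d'h : d' <= 1 / 2 by rewrite ge_min lexx orbT.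
have d'01 : 0 < d' <= 1 by rewrite d'0; lra.
pose m n := dsing_plus s k chi psi (eigfun n).
have C120 : 0 <= C1 + C2 by rewrite addr_ge0.
have hm n : (0 < n)%N -> `|m n - n%:R `^ (- (s + 2^-1)) * osc k A B n| <=
    (C1 + C2) * n%:R `^ (- (s + 2^-1) - d').
  move=> n0; have n1 : 1 <= n%:R :> R by rewrite ler1n.
  rewrite /m /dsing_plus addrAC mulrDl; apply: (le_trans (ler_normD _ _)); apply: lerD.
    by apply: (le_trans (hC1 _ n0)); rewrite ler_wpM2l//; apply: ler_powR => //; lra.
  by apply: (le_trans (hC2 _ n0)); rewrite ler_wpM2l//; apply: ler_powR => //; lra.
pose a n := m n / n%:R.
have ha n : (0 < n)%N -> `|a n - n%:R `^ (- (s + 3 / 2)) * osc k A B n| <=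
    (C1 + C2) * n%:R `^ (- (s + 3 / 2) - d').
  move=> n0; have n1 : 0 < n%:R :> R by rewrite ltr0n.
  have E u v : u = v - 1 -> n%:R `^ u = n%:R `^ v / n%:R :> R.
    by move=> E; rewrite (powR_split n1 E) powRN powRr1 ?ltW.
  rewrite (E _ (- (s + 2^-1))); last by lra.
  rewrite (E (_ - d') (- (s + 2^-1) - d')); last by lra.
  have ni0 : 0 <= n%:R^-1 :> R by rewrite invr_ge0 ltW.
  rewrite /a mulrAC -mulrBl normrM (ger0_norm ni0).
  by rewrite [leRHS]mulrA ler_wpM2r ?hm.
have van : 0 < s -> \sum_(1 <= n < N) (pair_coef k a n * eigval_shift n k) @[N --> \oo] --> 0.
  move=> sp; have [_ /(_ sp)[_ orth2]] := orth.
  pose K := `|m 0%N| + (`|A| + `|B| + (C1 + C2)).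
  apply: (@pair_coef_level_cvg0 _ m k K); first exact: leq_trans k2.
    case=> [|n]; first by rewrite /K lerDl !addr_ge0.
    apply: (@le_trans _ _ (`|A| + `|B| + (C1 + C2))); last by rewrite /K lerDr.
    have n1 : 1 <= n.+1%:R :> R by rewrite ler1n.
    rewrite -(subrK (n.+1%:R `^ (- (s + 2^-1)) * osc k A B n.+1) (m n.+1)) (le_trans (ler_normD _ _))//.
    rewrite addrC; apply: lerD.
      rewrite normrM (ger0_norm (powR_ge0 _ _)) -[leRHS]mul1r.
      apply: ler_pM; rewrite ?powR_ge0//.
        by apply: natr_powR_le1 => //; lra.
      rewrite /osc (le_trans (ler_normD _ _))// !normrM.
      by apply: lerD; rewrite -[leRHS]mulr1 ler_wpM2l ?sin_max ?cos_max.
    apply: (le_trans (hm n.+1 isT)); rewrite -[leRHS]mulr1 ler_wpM2l//.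
    by apply: natr_powR_le1 => //; lra.
  have := parseval_cos sp k2 H tp orth2.
  suff E : fcoef (fun x => 1 * fsing s k chi x + psi x) = m by rewrite /= E.
  apply/funext => n; rewrite /fcoef /m /dsing_plus /dsing.
  have -> : - 2^-1 < s by lra.
  by rewrite (pairing_lin _ (fsing_L2 sp k2 H) (test_L2 tp) (L2_eigfun n)) mul1r.
exact: HK k A B d' (C1 + C2) a k2 d'01 C120 ha van.
Qed.
End Perturbed.

(** * An algebra of smooth functions *)
Section SmoothAlgebra.
Context {R : realType}.
Implicit Types (f g h : R -> R) (c x al ga : R) (n : nat).
Notation mu := (@lebesgue_measure R).

(** Smoothness of sums, products and affine rescalings of smooth functions is
    obtained at once: this class is closed under differentiation, and its members
    are differentiable. *)
Inductive smooth_alg : (R -> R) -> Prop :=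
| sa_base f al ga : smooth_on setT f -> smooth_alg (fun x => f (al * x + ga))
| sa_cst c : smooth_alg (fun=> c)
| sa_add f g : smooth_alg f -> smooth_alg g -> smooth_alg (fun x => f x + g x)
| sa_mul f g : smooth_alg f -> smooth_alg g -> smooth_alg (fun x => f x * g x).

Lemma smooth_on_derive f : smooth_on setT f -> smooth_on setT (derive1 f).
Proof. by move=> sf n x _; have := sf n.+1 x I; rewrite /derive1n iterSr. Qed.

Lemma smooth_alg_derive h : smooth_alg h ->
  exists2 h', smooth_alg h' & forall x, is_derive x 1 h (h' x).
Proof.
elim=> [f al ga sf|c|f g sf [f' sf' df] sg [g' sg' dg]|f g sf [f' sf' df] sg [g' sg' dg]].
- exists (fun x => al * derive1 f (al * x + ga)).
    by apply: sa_mul; [exact: sa_cst|apply: sa_base; exact: smooth_on_derive].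
  move=> x; have d1 : is_derive (al * x + ga) 1 f (derive1 f (al * x + ga)).
    by apply: DeriveDef; [exact: (sf 0%N)|rewrite derive1E].
  have d2 : is_derive x 1 (fun x => al * x + ga) al.
    by apply: is_derive_eq; rewrite /GRing.scale/=; ring.
  have := @is_derive1_comp _ f (fun x => al * x + ga) _ _ _ d1 d2.
  by rewrite mulrC.
- by exists (fun=> 0); [exact: sa_cst|move=> x; exact: is_derive_cst].
- exists (fun x => f' x + g' x); first exact: sa_add.
  by move=> x; have d1 := df x; have d2 := dg x; apply: is_derive_eq.
- exists (fun x => f x * g' x + f' x * g x).
    by apply: sa_add; exact: sa_mul.
  move=> x; have d1 := df x; have d2 := dg x; apply: is_derive_eq.
  by rewrite /GRing.scale/=; ring.
Qed.

Lemma smooth_alg_smooth h : smooth_alg h -> smooth_on setT h.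
Proof.
move=> sh n; elim: n h sh => [|n IH] h sh x _; have [h' sh' dh] := smooth_alg_derive sh.
  exact: (@ex_derive _ _ _ _ _ _ _ (dh x)).
rewrite /derive1n iterSr; have -> : derive1 h = h'.
  by apply/funext => y; rewrite derive1E; apply: derive_val.
exact: IH.
Qed.

Lemma near_eq_derive1n f g x n : (\forall y \near x, f y = g y) ->
  \forall y \near x, derive1n n f y = derive1n n g y.
Proof.
move=> fg; elim: n => [//|n IH].
have [d d0 hd] := near_ball_ex IH.
have hx : x - d < x < x + d by apply/andP; split; lra.
apply: filterS (near_open_itv hx) => y hy; rewrite !derive1nS !derive1E.
by apply: near_eq_derive; apply: filterS (near_open_itv hy) => z hz; exact: hd.
Qed.

Lemma near_smooth f g x n : (\forall y \near x, g y = f y) ->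
  derivable (derive1n n g) x 1 -> derivable (derive1n n f) x 1.
Proof. by move=> fg; apply: near_eq_derivable; exact: near_eq_derive1n. Qed.

(** The cut-off extended by constants on both sides: a globally smooth function
    which is not constant, from which compactly supported ones are made. *)
Definition step a (chi : R -> R) x : R := if x <= a then 1 else if x < 1 then chi x else 0.

Lemma step_right (a : R) (chi : R -> R) (x : R) :
  (\forall x \near (1 : R), x \in `[0, 1] -> chi x = 0) ->
  a < x -> 1 <= x -> \forall y \near x, 0 = step a chi y.
Proof.
move=> /near_ball_ex[e e0 he] ax x1.
have hx : Num.max 0 (Num.max a (1 - e)) < x < x + 1.
  by rewrite !gt_max; apply/andP; split; [apply/and3P; split; lra|lra].
apply: filterS (near_open_itv hx) => y.
rewrite !gt_max /step => /andP[/and3P[y0 y1 y2] _]; rewrite leNgt y1/=; case: ifP => // y3.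
by rewrite he// ?in_itv/=; apply/andP; split; lra.
Qed.

Lemma smooth_step (a : R) (chi : R -> R) : 0 < a < 1 -> smooth01 chi ->
  (\forall x \near a, chi x = 1) ->
  (\forall x \near (1 : R), x \in `[0, 1] -> chi x = 0) -> smooth_on setT (step a chi).
Proof.
move=> /andP[a0 a1] [sc _ _] /near_ball_ex[d d0 hd] chi0 n x _.
have sk c : smooth_on setT (fun=> c) by exact: smooth_alg_smooth (sa_cst c).
have [xa|ax] := leP x a.
  have hx : x - 1 < x < Num.min (a + d) 1.
    by rewrite lt_min; apply/andP; split; [lra|apply/andP; split; lra].
  apply: near_smooth (sk 1 n x I); apply: filterS (near_open_itv hx) => y.
  rewrite lt_min /step => /and3P[_ y2 y3]; have [//|ay] := leP y a.
  by rewrite y3 hd//; apply/andP; split; lra.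
have [x1|x1] := ltP x 1.
  have hx : a < x < 1 by rewrite ax.
  have hx' : `]0, 1[%classic x by rewrite /= in_itv/= x1 (lt_trans a0).
  apply: near_smooth (sc n x hx'); apply: filterS (near_open_itv hx) => y /andP[y1 y2].
  by rewrite /step leNgt y1 y2.
by apply: near_smooth (sk 0 n x I); apply: filterS (step_right chi0 ax x1) => y.
Qed.

Lemma Rintegral_gt0 f x0 : (forall x, {for x, continuous f}) ->
  (forall x, 0 < x < 1 -> 0 <= f x) -> 0 < x0 < 1 -> 0 < f x0 ->
  0 < (\int[mu]_(x in `]0%R, 1%R[) f x)%R.
Proof.
move=> cf f0 /andP[x00 x01] fx.
have e0 : 0 < f x0 / 2 by rewrite divr_gt0.
have /near_ball_ex[d d0 hd] : \forall y \near x0, `|f x0 - f y| <= f x0 / 2.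
  by have := cf x0; move/cvgrPdist_le; apply.
pose u := Num.max 0 (x0 - d); pose v := Num.min 1 (x0 + d).
have uv : u < v.
  by rewrite gt_max !lt_min; apply/andP; split; apply/andP; split; lra.
have u0 : 0 <= u by rewrite le_max lexx.
have v1 : v <= 1 by rewrite ge_min lexx.
have ud : x0 - d <= u by rewrite le_max lexx orbT.
have vd : v <= x0 + d by rewrite ge_min lexx orbT.
have fi : mu.-integrable `]0, 1[ (EFin \o f).
  have i1 : mu.-integrable `[0, 1] (EFin \o f).
    by apply: continuous_itv_integrable => x _; exact: cf.
  by apply: (integrableS _ _ _ i1) => //; exact: subset_itv_oo_cc.
have sub : `]u, v[%classic `<=` (`]0, 1[%classic : set R).
  by move=> x /=; rewrite !in_itv/= => /andP[h1 h2]; apply/andP; split; lra.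
have ci : mu.-integrable `]u, v[ (EFin \o cst (f x0 / 2)).
  have i1 : mu.-integrable `[0, 1] (EFin \o cst (f x0 / 2)).
    by apply: continuous_itv_integrable => x _; exact: cvg_cst.
  apply: (integrableS _ _ _ i1) => //.
  by apply: subset_trans sub _; exact: subset_itv_oo_cc.
apply: (@lt_le_trans _ _ (\int[mu]_(x in `]u, v[) (cst (f x0 / 2) x))%R).
  have -> : (\int[mu]_(x in `]u, v[) (cst (f x0 / 2) x))%R = f x0 / 2 * (v - u).
    have dl (x : R) : is_derive x 1 (fun x => f x0 / 2 * x) (cst (f x0 / 2) x).
      by apply: is_derive_eq; rewrite /GRing.scale/=; ring.
    have c0 (x : R) : {for x, continuous (cst (f x0 / 2))} by exact: cvg_cst.
    rewrite -(Rintegral_open_right (fun x _ => c0 x)).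
    by rewrite (FTC_closed (ltW uv) (fun x _ => dl x) (fun x _ => c0 x)); ring.
  by rewrite mulr_gt0// subr_gt0.
apply: (@le_trans _ _ (\int[mu]_(x in `]u, v[) f x)%R).
  apply: le_Rintegral => //; first exact: (integrableS _ _ _ fi).
  move=> x /=; rewrite in_itv/= => /andP[h1 h2].
  have := hd x; rewrite (le_lt_trans ud h1) (lt_le_trans h2 vd)/= => /(_ isT).
  by rewrite ler_norml => /andP[_ h3]; lra.
have If : (\int[mu]_(x in `]0%R, 1%R[) (f x)%:E)%E \is a fin_num.
  exact: integrable_fin_num.
have Iuv : (\int[mu]_(x in `]u, v[) (f x)%:E)%E \is a fin_num.
  by apply: integrable_fin_num => //; apply: integrableS fi.
apply: fine_le => //; apply: ge0_subset_integral => //.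
by case/integrableP: fi.
Qed.
End SmoothAlgebra.

(** * A linear and a quadratic condition on a bump function *)
Section Orthogonalization.
Context {R : realType}.
Implicit Types (f g psi : R -> R) (x y : R) (n i j : nat).
Notation mu := (@lebesgue_measure R).

Lemma smooth_alg_continuous f : smooth_alg f -> forall x : R, {for x, continuous f}.
Proof. by move=> /smooth_alg_derive[f' _ df] x; exact: is_derive_continuous (df x). Qed.

Lemma smooth_alg_test psi (u v : R) : 0 < u -> v < 1 -> smooth_alg psi ->
  (forall x, ~~ (u <= x <= v) -> psi x = 0) -> test_function01 psi.
Proof.
move=> u0 v1 sp psi0.
have sub : closure [set x | psi x != 0] `<=` `[u, v]%classic.
  rewrite [X in _ `<=` X](closure_id _).1; last exact: interval_closed.
  apply: closureS => x /= px; rewrite in_itv/=; apply: contraT => h.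
  by rewrite psi0// eqxx in px.
split; first exact: smooth_alg_smooth.
  by apply: subclosed_compact sub; [exact: closed_closure|exact: segment_compact].
move=> x /sub /=; rewrite !in_itv/= => /andP[h1 h2].
by rewrite (lt_le_trans u0 h1) (le_lt_trans h2 v1).
Qed.

Section Bumps.
Variables (a : R) (B : R -> R) (y0 : R).
Hypotheses (a0 : 0 < a) (a1 : a < 1) (sB : smooth_on setT B)
  (B0 : forall y, ~~ (0 < y < 1) -> B y = 0) (By0 : B y0 != 0).

(** Supported in the i-th of eight equal cells of [0, a].  The square makes it
    nonnegative whatever the sign of B. *)
Definition cell_bump (i : nat) (x : R) : R := B (8 / a * x + - i%:R) * B (8 / a * x + - i%:R).

Lemma smooth_cell_bump i : smooth_alg (cell_bump i).
Proof. by apply: sa_mul; exact: sa_base. Qed.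

Lemma cell_coord x i : 8 / a * x + - i%:R = 8 * (x / a) - i%:R.
Proof. by ring. Qed.

Lemma cell_bump_out i x : ~~ (i%:R * (a / 8) < x < i.+1%:R * (a / 8)) -> cell_bump i x = 0.
Proof.
move=> h; rewrite /cell_bump B0 ?mulr0//; apply: contra h => /andP[h1 h2].
have xa : x = (x / a) * a by rewrite divfK// gt_eqF.
have h3 : i%:R / 8 < x / a by move: h1; rewrite cell_coord; lra.
have h4 : x / a < (i%:R + 1) / 8 by move: h2; rewrite cell_coord; lra.
rewrite -(ltr_pM2r a0) -xa in h3; rewrite -(ltr_pM2r a0) -xa in h4.
by rewrite -[i.+1%:R]natr1; apply/andP; split; lra.
Qed.

Lemma cell_bump_disjoint i j x : i != j -> cell_bump i x * cell_bump j x = 0.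
Proof.
move=> ij; have [hi|/cell_bump_out->] := boolP (i%:R * (a / 8) < x < i.+1%:R * (a / 8)); last by rewrite mul0r.
rewrite (@cell_bump_out j) ?mulr0//; apply: contra ij => hj.
have a8 : 0 < a / 8 by rewrite divr_gt0.
move: hi hj => /andP[h1 h2] /andP[h3 h4].
have : (i < j.+1)%N by rewrite -(ltr_nat R) -(ltr_pM2r a8) (lt_trans h1).
have : (j < i.+1)%N by rewrite -(ltr_nat R) -(ltr_pM2r a8) (lt_trans h3).
by rewrite !ltnS => h5 h6; rewrite eqn_leq h5 h6.
Qed.

Lemma cell_bump_ge0 i x : 0 <= cell_bump i x.
Proof. by rewrite /cell_bump -expr2 sqr_ge0. Qed.

Lemma cell_bump_peak i : exists2 x, i%:R * (a / 8) < x < i.+1%:R * (a / 8) & 0 < cell_bump i x.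
Proof.
pose x := (y0 + i%:R) * (a / 8).
have E : 0 < cell_bump i x.
  rewrite /cell_bump; have -> : 8 / a * x + - i%:R = y0.
    by rewrite /x; field; rewrite gt_eqF.
  by rewrite -expr2 exprn_even_gt0.
exists x => //; apply: contraT => h.
by rewrite cell_bump_out// ltxx in E.
Qed.

Lemma cell_pairing_gt0 f i : (i < 8)%N -> (forall x : R, {for x, continuous f}) ->
  (forall x, i%:R * (a / 8) < x < i.+1%:R * (a / 8) -> 0 < f x) ->
  0 < pairing (cell_bump i) f /\ 0 < pairing (fun x => cell_bump i x ^+ 2) f.
Proof.
move=> i8 cf f0; have [x hx bx] := cell_bump_peak i.
have cb (z : R) : {for z, continuous (cell_bump i)} by exact: smooth_alg_continuous (smooth_cell_bump i) z.
have a8 : 0 < a / 8 by rewrite divr_gt0.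
have hx01 : 0 < x < 1.
  have /andP[h1 h2] := hx; apply/andP; split.
    by apply: le_lt_trans h1; rewrite mulr_ge0// ltW.
  apply: (lt_le_trans h2); apply: (@le_trans _ _ (8 * (a / 8))).
    by rewrite ler_wpM2r ?(ltW a8)// (ler_nat R _ 8).
  by rewrite mulrC divfK//; exact: ltW.
have nn z : 0 <= cell_bump i z * f z.
  have [h|/cell_bump_out->] := boolP (i%:R * (a / 8) < z < i.+1%:R * (a / 8)); last by rewrite mul0r.
  by rewrite mulr_ge0 ?cell_bump_ge0// ltW// f0.
split; apply: (@Rintegral_gt0 _ _ x) => //.
- by move=> z; apply: cvgM; [exact: cb|exact: cf].
- by rewrite mulr_gt0// f0.
- by move=> z; apply: cvgM; [apply: cvgM; exact: cb|exact: cf].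
- by move=> z _; rewrite expr2 -mulrA mulr_ge0// cell_bump_ge0.
- by rewrite mulr_gt0 ?exprn_gt0// f0.
Qed.

Lemma cell_le i x : (i < 8)%N -> x < i.+1%:R * (a / 8) -> x < a.
Proof.
move=> i8 hx; have a8 : 0 < a / 8 by rewrite divr_gt0.
apply: (lt_le_trans hx); apply: (@le_trans _ _ (8 * (a / 8))).
  by rewrite ler_wpM2r ?(ltW a8)// (ler_nat R _ 8).
by rewrite mulrC divfK.
Qed.

Variables (L G : R -> R).
Hypotheses (cL : forall x : R, {for x, continuous L}) (cG : forall x : R, {for x, continuous G})
  (Lpos : forall x, 0 < x < a -> 0 < L x)
  (Gpos : forall x, 0 < x < a / 2 -> 0 < G x) (Gneg : forall x, a / 2 < x < a -> G x < 0).

Lemma cell_L i : (i < 8)%N -> 0 < pairing (cell_bump i) L.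
Proof.
move=> i8; have [] // := cell_pairing_gt0 i8 cL.
move=> x /andP[h1 h2]; apply: Lpos; rewrite (cell_le i8 h2) andbT.
by apply: le_lt_trans h1; rewrite mulr_ge0// ltW// divr_gt0.
Qed.

Lemma cell_G_left i : (i < 4)%N -> 0 < pairing (fun x => cell_bump i x ^+ 2) G.
Proof.
move=> i4; have i8 : (i < 8)%N by exact: leq_trans i4 _.
have [] // := cell_pairing_gt0 i8 cG.
move=> x /andP[h1 h2]; apply: Gpos; apply/andP; split.
  by apply: le_lt_trans h1; rewrite mulr_ge0// ltW// divr_gt0.
apply: (lt_le_trans h2); apply: (@le_trans _ _ (4 * (a / 8))); last by lra.
by rewrite ler_wpM2r ?(ler_nat R _ 4)// ltW// divr_gt0.
Qed.

Lemma cell_G_right i : (4 <= i)%N -> (i < 8)%N -> pairing (fun x => cell_bump i x ^+ 2) G < 0.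
Proof.
move=> i4 i8; rewrite -oppr_gt0.
have cN (x : R) : {for x, continuous (fun x => - G x)} by apply: cvgN; exact: cG.
have [|_ h] := cell_pairing_gt0 i8 cN.
  move=> x /andP[h1 h2]; rewrite oppr_gt0; apply: Gneg; rewrite (cell_le i8 h2) andbT.
  apply: le_lt_trans h1; apply: (@le_trans _ _ (4 * (a / 8))); first by lra.
  by rewrite ler_wpM2r ?(ler_nat R 4)// ltW// divr_gt0.
suff <- : pairing (fun x => cell_bump i x ^+ 2) (fun x => - G x) =
  - pairing (fun x => cell_bump i x ^+ 2) G by [].
have lb : L2 (fun x => cell_bump i x ^+ 2).
  have cb := smooth_alg_continuous (smooth_cell_bump i).
  by apply: L2_continuous => x; apply: cvgM; exact: cb.
rewrite /pairing -[RHS]mulN1r -RintegralZl//; last exact: L2_mul lb (L2_continuous cG).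
by apply: eq_Rintegral => x _; rewrite mulN1r mulrN.
Qed.

Lemma L2_cell i : L2 (cell_bump i).
Proof. exact: L2_continuous (smooth_alg_continuous (smooth_cell_bump i)). Qed.

Lemma L2_cell_sqr i : L2 (fun x => cell_bump i x ^+ 2).
Proof.
have cb := smooth_alg_continuous (smooth_cell_bump i).
by apply: L2_continuous => x; apply: cvgM; exact: cb.
Qed.

Definition cell_comb (c1 c2 c3 : R) (i j : nat) (x : R) : R :=
  c1 * cell_bump 3 x + (c2 * cell_bump i x + (c3 * cell_bump j x + 0)).

Lemma cell_comb_L c1 c2 c3 i j : pairing (cell_comb c1 c2 c3 i j) L =
  c1 * pairing (cell_bump 3) L + c2 * pairing (cell_bump i) L + c3 * pairing (cell_bump j) L.
Proof.
have lL := L2_continuous cL.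
have l1 := L2_lin c3 (L2_cell j) (@L2_0 R); have l2 := L2_lin c2 (L2_cell i) l1.
rewrite (pairing_lin _ (L2_cell 3) l2 lL) (pairing_lin _ (L2_cell i) l1 lL).
by rewrite (pairing_lin _ (L2_cell j) (@L2_0 R) lL) pairing0l addr0 addrA.
Qed.

Lemma cell_comb_G c1 c2 c3 i j : i != j -> i != 3%N -> j != 3%N ->
  pairing (fun x => cell_comb c1 c2 c3 i j x ^+ 2) G =
  c1 ^+ 2 * pairing (fun x => cell_bump 3 x ^+ 2) G +
  c2 ^+ 2 * pairing (fun x => cell_bump i x ^+ 2) G + c3 ^+ 2 * pairing (fun x => cell_bump j x ^+ 2) G.
Proof.
move=> ij i3 j3; have lG := L2_continuous cG.
have l1 := L2_lin (c3 ^+ 2) (L2_cell_sqr j) (@L2_0 R); have l2 := L2_lin (c2 ^+ 2) (L2_cell_sqr i) l1.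
transitivity (pairing (fun x => c1 ^+ 2 * cell_bump 3 x ^+ 2 + (c2 ^+ 2 * cell_bump i x ^+ 2 +
    (c3 ^+ 2 * cell_bump j x ^+ 2 + 0))) G).
  apply: eq_pairing => // x _; rewrite /cell_comb.
  have e1 := cell_bump_disjoint x ij; have e2 := cell_bump_disjoint x i3.
  have e3 := cell_bump_disjoint x j3.
  move: (cell_bump 3 x) (cell_bump i x) (cell_bump j x) e1 e2 e3 => u v w e1 e2 e3.
  have -> : (c1 * u + (c2 * v + (c3 * w + 0))) ^+ 2 = c1 ^+ 2 * u ^+ 2 + (c2 ^+ 2 * v ^+ 2 +
     (c3 ^+ 2 * w ^+ 2 + 0)) + 2 * (c1 * c2 * (v * u) + c1 * c3 * (w * u) + c2 * c3 * (v * w)) by ring.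
  by rewrite e1 e2 e3 !mulr0 !addr0 mulr0 addr0.
rewrite (pairing_lin _ (L2_cell_sqr 3) l2 lG) (pairing_lin _ (L2_cell_sqr i) l1 lG).
by rewrite (pairing_lin _ (L2_cell_sqr j) (@L2_0 R) lG) pairing0l addr0 addrA.
Qed.

Lemma cell_comb_out c1 c2 c3 i j x : (0 < i < 7)%N -> (0 < j < 7)%N ->
  ~~ (a / 8 <= x <= 7 * (a / 8)) -> cell_comb c1 c2 c3 i j x = 0.
Proof.
move=> hi hj hx; have a8 : 0 < a / 8 by rewrite divr_gt0.
have z n : (0 < n < 7)%N -> cell_bump n x = 0.
  move=> /andP[n0 n7]; apply: cell_bump_out; apply: contra hx => /andP[h1 h2]; apply/andP; split.
    by apply: le_trans (ltW h1); rewrite -[leLHS]mul1r ler_wpM2r ?(ltW a8)// ler1n.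
  by apply: le_trans (ltW h2) _; rewrite ler_wpM2r ?(ltW a8)// (ler_nat R _ 7).
by rewrite /cell_comb !z// !mulr0 !addr0.
Qed.

Lemma cell_comb_test c1 c2 c3 i j : (0 < i < 7)%N -> (0 < j < 7)%N ->
  test_function01 (cell_comb c1 c2 c3 i j) /\ (forall x, a <= x -> cell_comb c1 c2 c3 i j x = 0).
Proof.
move=> hi hj; have a8 : 0 < a / 8 by rewrite divr_gt0.
split; last first.
  move=> x ax; apply: cell_comb_out => //; rewrite negb_and -!ltNge; apply/orP; right.
  by move: (a0) => ?; lra.
apply: (@smooth_alg_test _ (a / 8) (7 * (a / 8))) => //; first by move: (a0) (a1) => ? ?; lra.
  have sc c n : smooth_alg (fun x => c * cell_bump n x).
    by apply: sa_mul; [exact: sa_cst|exact: smooth_cell_bump].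
  by do 3 (apply: sa_add; first exact: sc); exact: sa_cst.
by move=> x; exact: cell_comb_out.
Qed.

(** Bump 3 is scaled to meet the linear condition.  Bumps 1 and 2, or 5 and 6, with
    coefficients in the ratio that makes the pair orthogonal to L, then contribute
    any nonnegative, or nonpositive, amount to the quadratic condition: disjoint
    supports make the contributions additive. *)
Lemma exists_test_quadratic (t q : R) : exists psi,
  [/\ test_function01 psi, forall x, a <= x -> psi x = 0, pairing psi L = t &
      pairing (fun x => psi x ^+ 2) G = q].
Proof.
pose sg i := pairing (cell_bump i) L; pose rh i := pairing (fun x => cell_bump i x ^+ 2) G.
have s3 : 0 < sg 3%N by exact: cell_L.
pose z := t / sg 3%N; pose q' := q - z ^+ 2 * rh 3%N.
have main i j : i != j -> i != 3%N -> j != 3%N -> (0 < i < 7)%N -> (0 < j < 7)%N ->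
    let Q := sg j ^+ 2 * rh i + sg i ^+ 2 * rh j in Q != 0 -> 0 <= q' / Q ->
    exists psi, [/\ test_function01 psi, forall x, a <= x -> psi x = 0, pairing psi L = t &
      pairing (fun x => psi x ^+ 2) G = q].
  move=> ij i3 j3 hi hj Q Q0 qQ; pose r := Num.sqrt (q' / Q).
  have r2 : r ^+ 2 = q' / Q by rewrite sqr_sqrtr.
  have [tt tz] := cell_comb_test z (r * sg j) (- (r * sg i)) hi hj.
  exists (cell_comb z (r * sg j) (- (r * sg i)) i j); split => //.
    rewrite cell_comb_L -/(sg 3%N) -/(sg i) -/(sg j) /z divfK ?(gt_eqF s3)//; ring.
  rewrite cell_comb_G// -/(rh 3%N) -/(rh i) -/(rh j) sqrrN [(r * sg j) ^+ 2]exprMn [(r * sg i) ^+ 2]exprMn r2.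
  have -> : z ^+ 2 * rh 3%N + q' / Q * sg j ^+ 2 * rh i + q' / Q * sg i ^+ 2 * rh j =
    z ^+ 2 * rh 3%N + q' / Q * Q by rewrite /Q; ring.
  by rewrite divfK// /q'; ring.
have sq i : (i < 8)%N -> 0 < sg i ^+ 2 by move=> h; rewrite exprn_gt0// cell_L.
have [q0|q0] := leP 0 q'.
  have Qp : 0 < sg 2%N ^+ 2 * rh 1%N + sg 1%N ^+ 2 * rh 2%N.
    by rewrite addr_gt0// mulr_gt0 ?sq// cell_G_left.
  by apply: (main 1%N 2%N) => //; [rewrite gt_eqF|rewrite divr_ge0// ltW].
have Qn : sg 6%N ^+ 2 * rh 5%N + sg 5%N ^+ 2 * rh 6%N < 0.
  have g5 : sg 6%N ^+ 2 * rh 5%N < 0 by rewrite pmulr_rlt0 ?sq// cell_G_right.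
  have g6 : sg 5%N ^+ 2 * rh 6%N < 0 by rewrite pmulr_rlt0 ?sq// cell_G_right.
  by rewrite -[ltRHS]addr0 ltrD.
apply: (main 5%N 6%N) => //; first by rewrite lt_eqF.
by rewrite ltW// nmulr_lgt0// invr_lt0.
Qed.
End Bumps.
End Orthogonalization.

(** * Orthogonality and conclusion *)
Section Existence.
Context {R : realType}.
Implicit Types (f g chi psi : R -> R) (x y : R) (n : nat).
Notation mu := (@lebesgue_measure R).

(** The derivative of the extended cut-off vanishes outside ]0, 1[, and is not zero
    everywhere since the function passes from 1 to 0. *)
Lemma step_bump (a : R) chi : 0 < a < 1 -> smooth01 chi ->
  (\forall x \near a, chi x = 1) ->
  (\forall x \near (1 : R), x \in `[0, 1] -> chi x = 0) ->
  exists B : R -> R, exists y0 : R, [/\ smooth_on setT B,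
    forall y, ~~ (0 < y < 1) -> B y = 0 & B y0 != 0].
Proof.
move=> a01 sc h1 h0; have /andP[a0 a1] := a01; have sH := smooth_step a01 sc h1 h0.
set H := step a chi in sH.
have dH x : is_derive x 1 H (derive1 H x).
  by apply: DeriveDef; [exact: (sH 0%N x I)|rewrite derive1E].
have cH : {within `[a, 1], continuous H}.
  by apply: continuous_in_within => x _; exact: is_derive_continuous (dH x).
have [y0 _ E] := MVT_segment (ltW a1) (fun z _ => dH z) cH.
exists (derive1 H), y0; split; first exact: smooth_on_derive.
- move=> y; rewrite negb_and -!leNgt => /orP[y0'|y1].
    have hy : y - 1 < y < a by apply/andP; split; lra.
    apply: (@locally_constant_derive1 _ _ 1); apply: filterS (near_open_itv hy) => z /andP[_ za].
    by rewrite /H /step (ltW za).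
  apply: (@locally_constant_derive1 _ _ 0).
  by apply: filterS (step_right h0 (lt_le_trans a1 y1) y1) => z.
- apply/eqP => B0; move: E; rewrite B0 mul0r /H /step lexx (leNgt 1 a) a1/= ltxx; lra.
Qed.

(** Since psi vanishes where the singular part does not, the square of the sum is
    the sum of the squares, and the conditions on psi decouple from the
    distribution. *)
Lemma exists_orthogonal (s : R) k chi c M : -1 <= s <= 1 -> s != - 2^-1 -> s != 0 -> (2 <= k)%N ->
  smooth01 chi -> (\forall x \near (k%:R^-1 : R), chi x = 1) ->
  (\forall x \near (1 : R), x \in `[0, 1] -> chi x = 0) ->
  cutoff (k%:R^-1) 1 c chi (derive1n 1 chi) (derive1n 2 chi) M ->
  exists psi, test_function01 psi /\ orthogonality s k chi psi.
Proof.
move=> hs sN s0 k2 sc h1 h0 H.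
have a01 := @inv_nat01 R k k2; have /andP[a0 a1] := a01.
have [B [y0 [sB B0 By0]]] := step_bump a01 sc h1 h0.
set a : R := k%:R^-1 in a0 a1 a01.
have kp : 0 < k%:R * pi :> R by rewrite mulr_gt0 ?pi_gt0// ltr0n (leq_trans _ k2).
have s2 : 0 < Num.sqrt 2 :> R by rewrite sqrtr_gt0.
have ak : k%:R * pi * a = pi :> R.
  by rewrite /a mulrAC divff ?mul1r// pnatr_eq0 -lt0n (leq_trans _ k2).
have cL (x : R) : {for x, continuous (eigfun k : R -> R)} by exact: eigfun_continuous.
have cG (x : R) : {for x, continuous (derive1 (eigfun k : R -> R))}.
  rewrite derive_eigfun; apply: cvgM; first exact: cvg_cst.
  apply: cvgM; first exact: cvg_cst.
  exact: is_derive_continuous (is_derive_cos_lin _ x).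
have arg x y : x < y -> k%:R * pi * x < k%:R * pi * y by move=> xy; rewrite ltr_pM2l.
have Lpos x : 0 < x < a -> 0 < eigfun k x.
  move=> /andP[x0 xa]; rewrite /eigfun mulr_gt0//; apply: sin_gt0_pi.
  by have := arg _ _ xa; rewrite ak mulr_gt0.
have Gpos x : 0 < x < a / 2 -> 0 < derive1 (eigfun k) x.
  move=> /andP[x0 xa]; rewrite derive_eigfun mulr_gt0// mulr_gt0//.
  apply: cos_gt0_pihalf; have := arg _ _ xa; rewrite mulrA ak => ->; rewrite andbT.
  by apply: (@lt_trans _ _ 0); [have := pi_gt0 R; lra|rewrite mulr_gt0].
have Gneg x : a / 2 < x < a -> derive1 (eigfun k) x < 0.
  move=> /andP[ax xa]; rewrite derive_eigfun pmulr_rlt0// pmulr_rlt0//.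
  have := arg _ _ ax; have := arg _ _ xa; rewrite mulrA ak => e1 e2.
  have -> : cos (k%:R * pi * x) = - cos (pi - k%:R * pi * x).
    by rewrite cosB cospi sinpi; ring.
  by rewrite oppr_lt0; apply: cos_gt0_pihalf; apply/andP; split; have := pi_gt0 R; lra.
pose D := dsing s k chi (eigfun k).
pose q0 := if 0 < s then pairing (fsing s k chi) (fun x => fsing s k chi x * derive1 (eigfun k) x) else 0.
have [psi [tp pz pL pG]] := exists_test_quadratic a0 a1 sB B0 By0 cL cG Lpos Gpos Gneg (- D) (- q0).
exists psi; split => //.
have e1 : dsing_plus s k chi psi (eigfun k) = 0 by rewrite /dsing_plus pL -/D subrr.
split => [_ //|sp]; split => //.
have lf := fsing_L2 sp k2 H.
have lG : L2 (derive1 (eigfun k : R -> R)) by exact: L2_continuous.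
have lfG : L2 (fun x => fsing s k chi x * derive1 (eigfun k) x).
  apply: (@L2_mulb _ _ _ (Num.sqrt 2 * (k%:R * pi))) => //; first by case: lG.
  move=> x _; rewrite derive_eigfun normrM (gtr0_norm s2) ler_wpM2l ?(ltW s2)//.
  by rewrite normrM (gtr0_norm kp) -[leRHS]mulr1 ler_wpM2l ?(ltW kp)// cos_max.
have lp2 : L2 (fun x => psi x ^+ 2).
  by apply: L2_continuous => x; apply: cvgM; exact: test_continuous0.
transitivity (q0 + - q0); last by rewrite subrr.
rewrite {1}/q0 sp -pG /pairing -RintegralD//; [|exact: L2_mul|exact: L2_mul].
apply: eq_Rintegral => x _.
have fp : fsing s k chi x * psi x = 0.
  have [xa|ax] := leP x a; first by rewrite /fsing xa mul0r.
  by rewrite pz ?mulr0// ltW.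
have -> : (fsing s k chi x + psi x) ^+ 2 = fsing s k chi x ^+ 2 + psi x ^+ 2 + 2 * (fsing s k chi x * psi x) by ring.
by rewrite fp; ring.
Qed.
End Existence.

Theorem proposition3p3 (R : realType) (s : R)
    (s_bounds : -1 <= s <= 1) (s_neq_Nhalf : s != - 2^-1) (s_neq0 : s != 0) :
  exists alpha : R, alpha != 0 /\
  forall (k : nat) (chi : R -> R),
  (2 <= k)%N ->
  smooth01 chi ->
  (\forall x \near (k%:R^-1 : R), chi x = 1) ->
  (\forall x \near (1 : R), x \in `[0, 1] -> chi x = 0) ->
  [/\ - 2^-1 < s ->
        lebesgue_measure.-integrable `]0%R, 1%R[ (EFin \o fsing s k chi),
      s < - 2^-1 -> forall phi : R -> R, smooth01 phi ->
        cvg (fp_approx s k chi phi eps @[eps --> 0^'+]),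
      in_H_infty (s + 2^-1) (dsing s k chi),
      exists psi : R -> R, test_function01 psi /\ orthogonality s k chi psi &
      forall psi : R -> R, test_function01 psi -> orthogonality s k chi psi ->
        (forall w : R, cvgn (fun N =>
           \sum_(1 <= n < N) quad_kernel_term (dsing_plus s k chi psi) k w n)) /\
        exists2 nu : R, 0 < nu &
          exists2 C : R, 0 < C &
            \forall w \near +oo,
              `|quad_kernel (dsing_plus s k chi psi) k w - alpha / w `^ (2 + s)|
                <= C / w `^ (2 + s + nu)].
Proof.
have [alpha [alpha0 HK]] := perturbed_kernel s_bounds s_neq_Nhalf s_neq0.
exists alpha; split => // k chi k2 sc h1 h0.
have a01 := @inv_nat01 R k k2; have /andP[a0 a1] := a01.
have [c [M H]] := smooth_cutoff a01 sc h1 h0.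
split.
- exact: fsing_integrable k2 H.
- move=> sh phi sp; have [K K0 hK] := smooth_lipschitz sp.
  have /andP[s1 _] := s_bounds.
  have L := @fp_approx_cvg R s k chi c M H phi K sh s1 K0.
  apply: (cvgP _ (L _ _)).
    move=> x /andP[ax x1]; apply: is_derive_continuous (smooth_is_derive 0 sp _).
    by rewrite x1 (lt_trans a0).
  by move=> x /andP[ax x1]; apply: hK => //; exact: ltW.
- exact: dsing_in_H s_bounds s_neq_Nhalf k2 H.
- exact: exists_orthogonal s_bounds s_neq_Nhalf s_neq0 k2 sc h1 h0 H.
- by move=> psi tp orth; exact: HK k2 H tp orth.
Qed.
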